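(* Let $k=\mathbb{F}_q$ be a finite field of odd characteristic $p$ and let $g>1$ be an integer. Let $\operatorname{hyp}^{\bullet}(g)$ be the number of $k$-isomorphism classes of pointed hyperelliptic curves of genus $g$ over $k$. Then $$\operatorname{hyp}^{\bullet}(g)=2q^{2g-1}+2A_1\!\left(\frac{2g+1}{p}\right)+\sum_{1<m\mid 2g+1}2\varphi(m)\left[A_2\!\left(\frac{2g+1}{m}\right)\right]_{m\mid q-1}+\sum_{1<m\mid 2g}2\varphi(m)\left[A_2\!\left(\frac{2g}{m}\right)\right]_{2m\mid q-1}.$$ The sums run over the divisors $m>1$ of $2g+1$, respectively of $2g$.
   Context: A hyperelliptic curve of genus $g>1$ over $k$ is a smooth, projective, geometrically irreducible curve $C$ of genus $g$ over $k$ admitting a degree-$2$ morphism to $\mathbb{P}^1$ defined over $k$; its Weierstrass points are the ramification points of this morphism (equivalently the fixed points of the hyperelliptic involution). A pointed hyperelliptic curve over $k$ is a pair $(C,P)$ where $C$ is a hyperelliptic curve over $k$ and $P\in C(k)$ is a $k$-rational Weierstrass point of $C$. Two pointed curves $(C,P)$ and $(C',P')$ are $k$-isomorphic if there is a $k$-isomorphism $C\to C'$ sending $P$ to $P'$. $\varphi$ is Euler's totient function. For a positive integer $n$, $$A_1(n)=\begin{cases}q^{n-1}-q^{n-2},& n\ge 2,\\ 1,& n=1,\end{cases}\qquad A_2(n)=\frac{q^n-(-1)^n}{q+1}.$$ By convention, $A_1(x)=0$ if $x$ is not a positive integer. A term $[x]_{\text{condition}}$ equals $x$ if the condition is satisfied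 and is omitted (equals $0$) otherwise. *)

(* Defs.v *)
(* Curves are presented as in Hartshorne, I.6 (or as a Chevalley
   schema): an integral curve over k is given by its function field K, its set
   of closed points, and for each closed point P its local ring O_P, a subring
   of K.  The topology is cofinite and O(U) is the intersection of the O_P for
   P in U, so neither is part of the data. *)
From HB Require Import structures.
From mathcomp Require Import all_boot all_order all_algebra.
From mathcomp Require Import all_classical.

Set Implicit Arguments.
Unset Strict Implicit.
Unset Printing Implicit Defensive.

Import Order.TTheory GRing.Theory Num.Theory.

Local Open Scope classical_set_scope.
Local Open Scope ring_scope.

Local Notation "x %:F" := (@tofrac _ x) : ring_scope.

Record precurve (k : fieldType) := Precurve {
  funfield : fieldType;
  const : {rmorphism k -> funfield};
  point : Type;
  stalk : point -> set funfield
}.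

Section Curves.
Variable k : fieldType.
Implicit Types C D : precurve k.

Definition finite_degree (F K : fieldType) (s : F -> K) (n : nat) : Prop :=
  exists e : 'I_n -> K, forall z : K,
    exists! c : {ffun 'I_n -> F}, z = \sum_(i < n) s (c i) * e i.

(* O is a discrete valuation ring with k `<=` O and fraction field K: every
   z != 0 in K is a unit of O times a power of the uniformizer t. *)
Definition discrete_valuation_ring C (O : set (funfield C)) : Prop :=
  [/\ forall c : k, O (const C c),
      forall x y, O x -> O y -> O (x - y),
      forall x y, O x -> O y -> O (x * y)
    & exists t, [/\ t != 0, O t, ~ O t^-1
      & forall z, z != 0 -> exists n : int, O (z * t ^ n) /\ O (z * t ^ n)^-1]].

Definition nonunits C (O : set (funfield C)) : set (funfield C) :=
  [set z | O z /\ (z = 0 \/ ~ O z^-1)].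

Definition max_ideal C (P : point C) : set (funfield C) := nonunits (stalk P).

Definition dominates C (V O : set (funfield C)) : Prop :=
  O `<=` V /\ nonunits O `<=` nonunits V.

(* The function field is finitely generated of transcendence degree 1. *)
Definition one_dimensional C : Prop :=
  exists (s : {rmorphism {fraction {poly k}} -> funfield C}) (n : nat),
    (forall c : k, s (c%:P)%:F = const C c) /\ finite_degree s n.

(* k is meant to be perfect: smooth is then the same as regular, and every
   finite extension of k is some k[X]/(h) with h irreducible. *)
Definition smooth C : Prop :=
  forall P : point C, discrete_valuation_ring (stalk P).

(* Valuative criterion: existence is properness (for curves the same as
   projectivity) and uniqueness is separatedness. *)
Definition proper_curve C : Prop :=
  forall V : set (funfield C), discrete_valuation_ring V ->
    exists! P : point C, dominates V (stalk P).

(* The base change of C to L := k[X]/(h) has generic ring K[X]/(h); it is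
   irreducible for every finite extension L of k. *)
Definition geometrically_irreducible C : Prop :=
  forall h : {poly k}, irreducible_poly h ->
    irreducible_poly (map_poly (const C) h).

Definition smooth_projective_curve C : Prop :=
  [/\ one_dimensional C, smooth C, proper_curve C
    & geometrically_irreducible C].

(* The genus is the dimension over k of H^1(C, O_C), computed by the flasque
   resolution 0 -> O_C -> K -> (+)_P K/O_P -> 0, i.e., as the cokernel of
   K -> (+)_P K/O_P.  An element of the direct sum is represented by a family
   of functions r P, almost all of which lie in O_P. *)
Definition repartition C (r : point C -> funfield C) : Prop :=
  finite_set [set P | ~ stalk P (r P)].

Definition has_genus C (g : nat) : Prop :=
  exists e : 'I_g -> point C -> funfield C,
    (forall i, repartition (e i)) /\
    forall r, repartition r ->
      exists! c : {ffun 'I_g -> k}, exists f : funfield C, forall P,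
        stalk P (r P - (f + \sum_(i < g) const C (c i) * e i P)).

(* Nonconstant morphisms of curves over k: a map on closed points and a
   pullback of functions inducing local homomorphisms O_(f P) -> O_P. *)
Record morphism C D := Morphism {
  on_points : point C -> point D;
  pullback : {rmorphism funfield D -> funfield C};
  pullback_const : forall c : k, pullback (const D c) = const C c;
  pullback_stalk : forall P z, stalk (on_points P) z -> stalk P (pullback z);
  pullback_local : forall P z,
    max_ideal (on_points P) z -> max_ideal P (pullback z)
}.

Definition has_degree C D (f : morphism C D) (n : nat) : Prop :=
  finite_degree (pullback f) n.

Definition isomorphism C D (f : morphism C D) : Prop :=
  exists f' : morphism D C,
    [/\ cancel (on_points f) (on_points f'), cancel (on_points f') (on_points f),
        cancel (pullback f) (pullback f') & cancel (pullback f') (pullback f)].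

(* The image of m_(f P) lies in m_P^2 (which consists of products, as m_P is
   principal); for k perfect this is ramification at P. *)
Definition ramified C D (f : morphism C D) (P : point C) : Prop :=
  forall z, max_ideal (on_points f P) z ->
    exists x y, [/\ max_ideal P x, max_ideal P y & pullback f z = x * y].

(* The residue field of P is k. *)
Definition rational_point C (P : point C) : Prop :=
  forall z, stalk P z -> exists c : k, max_ideal P (z - const C c).

(* The closed points of P^1 are the monic irreducible polynomials, and the
   point at infinity (None). *)
Definition P1_point : Type :=
  option {p : {poly k} | p \is monic /\ irreducible_poly p}.

Definition P1_stalk (P : P1_point) : set {fraction {poly k}} :=
  match P with
  | Some p => [set z | exists a b : {poly k},
                 ~~ (sval p %| b)%R /\ z = a%:F / b%:F]
  | None => [set z | exists a b : {poly k},
                 [/\ b != 0, (size a <= size b)%N & z = a%:F / b%:F]]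
  end.

Definition P1_const : {rmorphism k -> {fraction {poly k}}} :=
  (@tofrac {poly k} \o polyC)%FUN.

Definition P1 : precurve k := Precurve P1_const P1_stalk.

Definition hyperelliptic_curve (g : nat) C : Prop :=
  [/\ (1 < g)%N, smooth_projective_curve C, has_genus C g
    & exists f : morphism C P1, has_degree f 2].

Definition weierstrass_point C (P : point C) : Prop :=
  exists f : morphism C P1, has_degree f 2 /\ ramified f P.

Record pointed_hyperelliptic_curve (g : nat) := PointedHyperellipticCurve {
  curve_of : precurve k;
  base_point : point curve_of;
  curve_ofP : hyperelliptic_curve g curve_of;
  base_point_rational : rational_point base_point;
  base_point_weierstrass : weierstrass_point base_point
}.

Definition pointed_isomorphic (g : nat)
    (X Y : pointed_hyperelliptic_curve g) : Prop :=
  exists f : morphism (curve_of X) (curve_of Y),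
    isomorphism f /\ on_points f (base_point X) = base_point Y.

End Curves.

(* The equivalence relation R has exactly n classes. *)
Definition num_classes (T : Type) (R : T -> T -> Prop) (n : nat) : Prop :=
  exists r : 'I_n -> T, forall x, exists! i, R x (r i).

Definition A1 (q : nat) (x : rat) : rat :=
  if (x \is a Num.nat) && (0 < x) then
    let n := Num.truncn x in
    if n == 1%N then 1 else q%:R ^+ (n - 1) - q%:R ^+ (n - 2)
  else 0.

Definition A2 (q n : nat) : rat := (q%:R ^+ n - (-1) ^+ n) / (q%:R + 1).

(* Main.v *)
(* Over a field of odd characteristic a pointed hyperelliptic curve of genus g is
   y^2 = f(x) with f monic separable of degree 2g + 1, the base point being the
   point at infinity; f is unique up to f |-> w^(-2(2g+1)) f(w^2 x + v), so the
   classes are the orbits of an affine group and are counted by Burnside's lemma.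
   - Geometry.  Points are valuations.  A coordinate x with a pole at the base
     point P exists because P is ramified over P^1; its valuation at P is -2, and
     completing the square gives y^2 = f(x).  The functions regular outside P are
     k[x] + k[x]y, so x is unique up to affine substitutions.  The genus is read
     off H^1: strong approximation reduces repartitions to P, where y/x, ...,
     y/x^g form a basis.  Conversely the discrete valuation rings of
     k(x)[y]/(y^2 - f) are the points of a curve with equation y^2 = f(x).
   - Counting.  (w, v) with w^2 = 1 and v <> 0 fixes the polynomials in
     x^p - v^(p-1) x; if w^2 has order m > 1, then (w, v) is conjugate to (w, 0)
     and fixes the polynomials h(x^m) and x h(x^m). *)
Require Import Defs.
From HB Require Import structures.
From mathcomp Require Import all_boot all_order all_algebra.
From mathcomp Require Import all_fingroup all_solvable all_field.
From mathcomp Require Import boolp ring zify.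

Set Implicit Arguments.
Unset Strict Implicit.
Unset Printing Implicit Defensive.

Import Order.TTheory GRing.Theory Num.Theory.
Local Open Scope ring_scope.

(** * Separable polynomials *)

(** The group consists of pairs [(w, v)], not of the substitutions themselves: it has order
    [(q - 1) q], and [w] and [-w] act alike, so every substitution is represented twice. This is the
    common factor 2 of the four terms of the formula. On the geometric side the data are only a
    ramified map of degree 2 and a genus. The polynomial under the square root has odd degree
    because in even degree [1/x] stays a uniformizer above infinity, against ramification. Its
    degree is then [2g + 1] because the genus of [y^2 = D(x)] is computed for every separable [D] of
    odd degree and the dimension of H^1 is unique. Local facts reduce to a quadratic extension of a
    field with a discrete valuation for which 2 is a unit and [D] has value 0 or 1, which is where
    separability of [D] enters. With [R] the valuation ring, either [R[y]] is the only valuation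
    ring above [R], or one localizes it at [y - c] for some [c] with [c^2 - D] of value 1. Explicit
    rings replace any general extension theorem for valuations. *)

Section SeparablePolynomials.
Variable k : fieldType.
Implicit Types f g a b : {poly k}.

Definition affine_poly (u v : k) : {poly k} := u *: 'X + v%:P.

Lemma size_affine_poly u v : u != 0 -> size (affine_poly u v) = 2%N.
Proof.
move=> u0; rewrite /affine_poly size_polyDl size_scale ?size_polyX //.
exact: leq_ltn_trans (size_polyC_leq1 _) _.
Qed.

Lemma deriv_affine_poly u v : (affine_poly u v)^`() = u%:P.
Proof. by rewrite /affine_poly derivD derivZ derivX derivC addr0 alg_polyC. Qed.

Lemma comp_affine_poly u v u' v' :
  affine_poly u v \Po affine_poly u' v' = affine_poly (u * u') (u * v' + v).
Proof.
rewrite /affine_poly comp_polyD comp_polyZ comp_polyX comp_polyC.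
by rewrite scalerDr scalerA -addrA -[u *: v'%:P]mul_polyC -!polyCM -polyCD.
Qed.

Lemma affine_poly1 : affine_poly 1 0 = 'X.
Proof. by rewrite /affine_poly scale1r addr0. Qed.

Lemma comp_affine_polyK f u v : u != 0 ->
  (f \Po affine_poly u v) \Po affine_poly u^-1 (- (u^-1 * v)) = f.
Proof.
move=> u0; rewrite -comp_polyA comp_affine_poly divff // mulrN mulrA divff //.
by rewrite mul1r addNr affine_poly1 comp_polyXr.
Qed.

Lemma size_comp_affine f u v : u != 0 -> size (f \Po affine_poly u v) = size f.
Proof. by move=> u0; rewrite size_comp_poly2 // size_affine_poly. Qed.

Lemma lead_coef_comp_affine f u v : u != 0 ->
  lead_coef (f \Po affine_poly u v) = lead_coef f * u ^+ (size f).-1.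
Proof.
move=> u0; rewrite lead_coef_comp ?size_affine_poly //; congr (_ * _ ^+ _).
by rewrite lead_coefE size_affine_poly // coefD coefZ coefX coefC mulr1 addr0.
Qed.

(** Composing a Bezout relation with [r] gives one for the composite, up to the constant [u].
    Besides affine substitutions this covers the additive polynomial [X^p - v^(p-1) X], whose
    derivative is a nonzero constant. *)
Lemma coprime_deriv_comp f r (u : k) : u != 0 -> r^`() = u%:P ->
  coprimep f f^`() -> coprimep (f \Po r) (f \Po r)^`().
Proof.
move=> u0 dr /Bezout_eq1_coprimepP[[a b] /= e].
apply/Bezout_eq1_coprimepP; exists (a \Po r, u^-1 *: (b \Po r)) => /=.
rewrite deriv_comp dr [_ * u%:P]mulrC mul_polyC -scalerAl -scalerAr scalerA.
by rewrite mulVf // scale1r -!comp_polyM -comp_polyD e rmorph1.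
Qed.

Lemma coprime_derivZ f c : c != 0 -> coprimep (c *: f) (c *: f)^`() = coprimep f f^`().
Proof. by move=> c0; rewrite derivZ coprimepZl // coprimepZr. Qed.

Lemma square_dvd_separable a f : coprimep f f^`() -> a ^+ 2 %| f -> size a = 1%N.
Proof.
move=> cf /dvdpP[b e].
have af : a %| f by rewrite e expr2 mulrA dvdp_mulIr.
have af' : a %| f^`().
  by rewrite e expr2 mulrA !derivM dvdp_add ?dvdp_mulIr // dvdp_mulr ?dvdp_mulIr.
have := coprimep_dvdr af (coprimep_dvdl af' cf).
by rewrite coprimepp => /eqP.
Qed.

(** After division by [gcdp a b], the square of each quotient divides the separable factor on the
    other side, so both quotients are constants. This yields uniqueness of the squarefree
    decomposition, and later the constant relating two equations of one curve. *)
Lemma square_separable_unique a b f g : a != 0 -> b != 0 ->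
  coprimep f f^`() -> coprimep g g^`() -> a ^+ 2 * f = b ^+ 2 * g ->
  exists2 c, c != 0 & b = c *: a /\ f = c ^+ 2 *: g.
Proof.
move=> a0 b0 cf cg e; pose d := gcdp a b.
have d0 : d != 0 by rewrite gcdp_eq0 negb_and a0.
have ea : a = (a %/ d) * d by rewrite divpK // dvdp_gcdl.
have eb : b = (b %/ d) * d by rewrite divpK // dvdp_gcdr.
have cab : coprimep (a %/ d) (b %/ d) by apply: coprimep_div_gcd; rewrite a0.
have e' : (a %/ d) ^+ 2 * f = (b %/ d) ^+ 2 * g.
  apply: (mulIf (expf_neq0 2 d0)).
  rewrite mulrAC -exprMn -ea e {1}eb exprMn; ring.
have sb : size (b %/ d) = 1%N.
  apply: (square_dvd_separable cf).
  have : (b %/ d) ^+ 2 %| (a %/ d) ^+ 2 * f by rewrite e' dvdp_mulIl.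
  by rewrite Gauss_dvdpr // coprimep_expl // coprimep_expr // coprimep_sym.
have sa : size (a %/ d) = 1%N.
  apply: (square_dvd_separable cg).
  have : (a %/ d) ^+ 2 %| (b %/ d) ^+ 2 * g by rewrite -e' dvdp_mulIl.
  by rewrite Gauss_dvdpr // coprimep_expl // coprimep_expr.
have /size_poly1P[x x0 ex] : size (a %/ d) == 1%N by rewrite sa.
have /size_poly1P[z z0 ez] : size (b %/ d) == 1%N by rewrite sb.
exists (z / x); first by rewrite mulf_neq0 ?invr_eq0.
split.
  rewrite eb ea ex ez !mul_polyC scalerA; congr (_ *: _).
  by rewrite divfK.
move: e'; rewrite ex ez -!polyC_exp !mul_polyC => e'.
apply: (scalerI (expf_neq0 2 x0)); rewrite e' scalerA -exprMn.
by rewrite mulrC -mulrA mulVf // mulr1.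
Qed.

End SeparablePolynomials.

Section FinitePerfect.
Variable k : finFieldType.

(** Only coefficients with index divisible by [p] survive, and each of them is a [p]-th power
    because Frobenius is injective, hence bijective, on a finite field. *)
Lemma deriv_eq0_pth_power (p : nat) (f : {poly k}) : p \in [pchar k] ->
  f^`() = 0 -> exists g : {poly k}, f = g ^+ p.
Proof.
move=> kp f'0.
have pp : prime p by case/andP: kp.
have p0 : (0 < p)%N by apply: prime_gt0.
have kP : p \in [pchar {poly k}] by rewrite (rmorph_pchar (@polyC k)).
have inj : injective (fun d : k => d ^+ p) by apply: (fmorph_inj (pFrobenius_aut kp)).
pose r c := invF inj c.
have rP c : r c ^+ p = c := f_invF inj c.
exists (\sum_(i < size f) r f`_(i * p) *: 'X^i).
have -> : (\sum_(i < size f) r f`_(i * p) *: 'X^i) ^+ p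
   = \sum_(i < size f) f`_(i * p) *: 'X^(i * p).
  rewrite -[LHS](pFrobenius_autE kP) rmorph_sum; apply: eq_bigr => i _.
  by rewrite -[LHS]/((r f`_(i * p) *: 'X^i) ^+ p) exprZn rP exprM.
have fi i : ~~ (p %| i)%N -> f`_i = 0.
  case: i => [|i]; first by rewrite dvdn0.
  move=> pi; have := congr1 (fun q : {poly k} => q`_i) f'0.
  rewrite coef_deriv coef0 -mulr_natr => /eqP; rewrite mulf_eq0 => /orP[/eqP //|].
  by rewrite -(dvdn_pcharf kp) (negbTE pi).
apply/polyP => i; rewrite coef_sum.
have [/dvdnP[j ->]|pi] := boolP (p %| i)%N; last first.
  rewrite fi // big1 // => j _; rewrite coefZ coefXn; case: eqP; rewrite ?mulr0 // => e.
  by move: pi; rewrite e dvdn_mull.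
have H (j' : nat) : (j * p == j' * p)%N = (j == j') by rewrite eqn_pmul2r.
have [js|js] := ltnP j (size f).
  rewrite (bigD1 (Ordinal js)) //= coefZ coefXn eqxx mulr1 big1 ?addr0 // => l lj.
  by rewrite coefZ coefXn H eq_sym -[(l : nat) == j]/(l == Ordinal js) (negbTE lj) mulr0.
rewrite nth_default; last by apply: (leq_trans js); rewrite leq_pmulr.
rewrite big1 // => l _; rewrite coefZ coefXn H; case: eqP; rewrite ?mulr0 // => e.
by have := ltn_ord l; rewrite -e ltnNge js.
Qed.

(** Write [f = b d] with [d] the gcd of [f] and its derivative. A common factor of [b] and [d] has
    its square dividing [f]. If there is none, [d] divides [b d'], hence [d'], so [d' = 0] and [d]
    is a [p]-th power. *)
Lemma square_factor (f : {poly k}) : f != 0 -> ~~ coprimep f f^`() ->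
  exists2 a : {poly k}, (1 < size a)%N & a ^+ 2 %| f.
Proof.
move=> f0 nc; have [p pp kp] := finPcharP k.
have : (1 < size (gcdp f f^`()))%N.
  rewrite ltn_neqAle eq_sym nc /= size_poly_gt0 gcdp_eq0 negb_and f0 //.
move=> sg.
pose d := gcdp f f^`().
have [b eb] : exists b, f = b * d by exists (f %/ d); rewrite divpK // dvdp_gcdl.
have [c ec] : exists c, f^`() = c * d by exists (f^`() %/ d); rewrite divpK // dvdp_gcdr.
have d0 : d != 0 by rewrite gcdp_eq0 negb_and f0.
have [cbd|cbd] := boolP (coprimep b d); last first.
  exists (gcdp b d).
    rewrite ltn_neqAle eq_sym cbd /= size_poly_gt0 gcdp_eq0 negb_and d0 orbT //.
  by rewrite eb expr2 dvdp_mul ?dvdp_gcdl ?dvdp_gcdr.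
have dd' : d %| d^`().
  have : d %| b * d^`().
    have -> : b * d^`() = f^`() - b^`() * d by rewrite eb derivM addrAC subrr add0r.
    by rewrite dvdp_sub ?dvdp_mulIr // ec dvdp_mulIr.
  by rewrite Gauss_dvdpr // coprimep_sym.
have d'0 : d^`() = 0.
  apply/eqP; apply: contraT => d'0; have := dvdp_leq d'0 dd'.
  by rewrite leqNgt lt_size_deriv.
have [g eg] := deriv_eq0_pth_power kp d'0.
exists g.
  rewrite ltnNge; apply/negP => /size1_polyC e.
  move: sg; rewrite -/d eg e -polyC_exp.
  by rewrite ltnNge (leq_trans (size_polyC_leq1 _)).
rewrite eb dvdp_mull // eg -(subnKC (prime_gt1 pp)) exprD dvdp_mulIl //.
Qed.

Lemma separable_part (f : {poly k}) : f != 0 ->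
  exists a g, [/\ a != 0, f = a ^+ 2 * g & coprimep g g^`()].
Proof.
have [n] := ubnP (size f); elim: n f => // n IH f sf f0.
have [cf|ncf] := boolP (coprimep f f^`()).
  by exists 1, f; rewrite oner_neq0 expr1n mul1r.
have [a a1 /dvdpP[b e]] := square_factor f0 ncf.
have a0 : a != 0 by rewrite -size_poly_gt0 ltnW.
have b0 : b != 0 by apply: contraNneq f0 => b0; rewrite e b0 mul0r.
have [|//|c [g [c0 eg cg]]] := IH b.
  move: sf; rewrite e size_mul ?expf_neq0 // expr2 size_mul //.
  by move: (size a) (size b) a1 => l m l1; lia.
by exists (a * c), g; rewrite mulf_neq0 // e eg; split=> //; ring.
Qed.

End FinitePerfect.

(** * Counting separable polynomials *)

Section MonicCount.
Variable k : finFieldType.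
Local Notation q := #|k|.
Implicit Types (f g h : {poly k}) (Q : pred {poly k}).

Definition monic_of n f := (f \is monic) && (size f == n.+1).

(* {poly_n k} is the finite type of polynomials of degree < n. *)
Definition to_monic n (a : {poly_n k}) : {poly k} := 'X^n + (a : {poly k}).

Definition of_monic n f : {poly_n k} := npolyp n (f - 'X^n).

Definition monic_count n Q : nat := #|[set a : {poly_n k} | Q (to_monic a)]|.

Lemma to_monicP n (a : {poly_n k}) : monic_of n (to_monic a).
Proof.
have sa : (size (a : {poly k}) < size ('X^n : {poly k}))%N.
  by rewrite size_polyXn ltnS size_npoly.
by rewrite /monic_of /to_monic monicE lead_coefDl // lead_coefXn eqxx size_polyDl // size_polyXn eqxx.
Qed.

Lemma to_monic_inj n : injective (@to_monic n).
Proof. by move=> a b /addrI/val_inj. Qed.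

Lemma of_monicK n f : monic_of n f -> to_monic (of_monic n f) = f.
Proof.
move=> /andP[/monicP lf /eqP sf]; rewrite /to_monic /of_monic npolypK; first by rewrite addrC subrK.
apply/leq_sizeP => j; rewrite leq_eqVlt => /orP[/eqP <-|nj].
  by rewrite coefB coefXn eqxx -[n in f`_n]/(n.+1.-1) -sf -lead_coefE lf subrr.
rewrite coefB coefXn gtn_eqF // subr0 nth_default // sf //.
Qed.

Lemma to_monicK n (a : {poly_n k}) : of_monic n (to_monic a) = a.
Proof. by apply: to_monic_inj; rewrite of_monicK ?to_monicP. Qed.

Lemma eq_monic_count n Q Q' : (forall f, monic_of n f -> Q f = Q' f) ->
  monic_count n Q = monic_count n Q'.
Proof. by move=> e; apply: eq_card => a; rewrite !inE e ?to_monicP. Qed.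

Lemma monic_count_bij m n Q Q' (phi : {poly k} -> {poly k}) :
  (forall f, monic_of m f -> Q f -> monic_of n (phi f) && Q' (phi f)) ->
  (forall f g, monic_of m f -> monic_of m g -> Q f -> Q g -> phi f = phi g -> f = g) ->
  (forall h, monic_of n h -> Q' h -> exists f, [/\ monic_of m f, Q f & phi f = h]) ->
  monic_count m Q = monic_count n Q'.
Proof.
move=> Hphi inj surj; pose F (a : {poly_m k}) := of_monic n (phi (to_monic a)).
rewrite /monic_count -(card_in_imset (f := F)); last first.
  move=> a b; rewrite !inE => Qa Qb e.
  have /andP[Ma _] := Hphi _ (to_monicP a) Qa; have /andP[Mb _] := Hphi _ (to_monicP b) Qb.
  apply: to_monic_inj; apply: inj; rewrite ?to_monicP //.
  by rewrite -(of_monicK Ma) -(of_monicK Mb) -/(F a) e.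
apply: eq_card => b; rewrite inE; apply/imsetP/idP => [[a]|Qb].
  rewrite inE => Qa ->; have /andP[Ma Q'a] := Hphi _ (to_monicP a) Qa.
  by rewrite of_monicK.
have [f [Mf Qf e]] := surj _ (to_monicP b) Qb.
by exists (of_monic m f); rewrite ?inE /F of_monicK // e to_monicK.
Qed.

Lemma monic_count_true n : monic_count n predT = (q ^ n)%N.
Proof.
rewrite /monic_count -card_npoly -cardsT; apply: eq_card => a.
by rewrite !inE.
Qed.

Lemma monic_count0 n Q : (forall f, monic_of n f -> Q f = false) -> monic_count n Q = 0%N.
Proof. by move=> H; apply: eq_card0 => a; rewrite inE H ?to_monicP. Qed.

Lemma monic_count_split n Q Q' : monic_count n Q =
  (monic_count n (fun f => Q f && Q' f) + monic_count n (fun f => Q f && ~~ Q' f))%N.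
Proof.
rewrite /monic_count -(cardsID [set a : {poly_n k} | Q' (to_monic a)]).
by congr (_ + _)%N; apply: eq_card => a; rewrite !inE // andbC.
Qed.

Definition separable f := coprimep f f^`().

Lemma monic_of_mul m n f g : monic_of m f -> monic_of n g -> monic_of (m + n) (f * g).
Proof.
move=> /andP[fm /eqP sf] /andP[gm /eqP sg]; rewrite /monic_of monicMl // gm /=.
by rewrite size_monicM ?monic_neq0 // sf sg addSn addnS.
Qed.

Lemma monic_of_monic n f : monic_of n f -> f \is monic.
Proof. by case/andP. Qed.

Lemma monic_of_size n f : monic_of n f -> size f = n.+1.
Proof. by case/andP => _ /eqP. Qed.

Lemma monic_size1 f : f \is monic -> (size f <= 1)%N -> f = 1.
Proof. by move=> + /size1_polyC e; rewrite e monicE lead_coefC => /eqP ->. Qed.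

Lemma separable1 : separable 1.
Proof. by rewrite /separable coprime1p. Qed.

Lemma separableZ (c : k) f : c != 0 -> separable (c *: f) = separable f.
Proof. exact: coprime_derivZ. Qed.

Lemma monic_separable_part f : f \is monic ->
  exists ab : {poly k} * {poly k},
    [/\ ab.1 \is monic, ab.2 \is monic, f = ab.1 ^+ 2 * ab.2 & separable ab.2].
Proof.
move=> fm; have [a [b [a0 e sb]]] := separable_part (monic_neq0 fm).
have la0 : lead_coef a != 0 by rewrite lead_coef_eq0.
have e' : f = ((lead_coef a)^-1 *: a) ^+ 2 * (lead_coef a ^+ 2 *: b).
  rewrite exprZn -scalerAl -scalerAr scalerA -exprMn mulVf // expr1n scale1r //.
have am : (lead_coef a)^-1 *: a \is monic by rewrite monicE lead_coefZ mulVf.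
exists ((lead_coef a)^-1 *: a, lead_coef a ^+ 2 *: b); split=> //=.
  by rewrite -(monicMl _ (monic_exp 2 am)) -e'.
by rewrite separableZ // expf_neq0.
Qed.

Lemma monic_separable_part_unique a b a' b' : a \is monic -> a' \is monic ->
  separable b -> separable b' -> a ^+ 2 * b = a' ^+ 2 * b' -> a = a' /\ b = b'.
Proof.
move=> am a'm sb sb' e.
have [c c0 [ea eb]] := square_separable_unique (monic_neq0 am) (monic_neq0 a'm) sb sb' e.
have c1 : c = 1.
  by have := monicP a'm; rewrite ea lead_coefZ (monicP am) mulr1.
by rewrite ea eb c1 scale1r expr1n scale1r.
Qed.

(* Write f = a^2 b with b separable.  Dropping the constant term c of a gives a
   bijection (aX + c)^2 b |-> (c, a^2 b). *)
Lemma nonseparable_count n :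
  monic_count n.+2 (fun f => ~~ separable f) = (q * q ^ n)%N.
Proof.
have dec f : f \is monic -> exists ab : {poly k} * {poly k},
    [/\ ab.1 \is monic, ab.2 \is monic, f = ab.1 ^+ 2 * ab.2 & separable ab.2].
  exact: monic_separable_part.
pose P (a : {poly_n k}) := projT1 (cid (dec _ (monic_of_monic (to_monicP a)))).
have PP (a : {poly_n k}) : [/\ (P a).1 \is monic, (P a).2 \is monic,
   to_monic a = (P a).1 ^+ 2 * (P a).2 & separable (P a).2].
  by rewrite /P; case: cid.
pose A (x : k * {poly_n k}) : {poly k} := (P x.2).1 * 'X + x.1%:P.
have Am x : A x \is monic /\ size (A x) = (size (P x.2).1).+1.
  have [m1 _ _ _] := PP x.2; rewrite /A; split.
    rewrite monicE lead_coefDl ?lead_coefMX ?(monicP m1) //.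
    by rewrite size_mulX ?monic_neq0 // (leq_ltn_trans (size_polyC_leq1 _)) // ltnS size_poly_gt0 monic_neq0.
  by rewrite size_MXaddC (negbTE (monic_neq0 m1)).
pose F (x : k * {poly_n k}) := of_monic n.+2 (A x ^+ 2 * (P x.2).2).
have FM x : monic_of n.+2 (A x ^+ 2 * (P x.2).2).
  have [m1 m2 e s2] := PP x.2; have [Am1 sA] := Am x.
  rewrite /monic_of monicMl ?monic_exp // m2 /=.
  have := monic_of_size (to_monicP x.2); rewrite e.
  rewrite !size_monicM ?monic_exp ?monic_neq0 // sA.
  have := monic_neq0 m1; rewrite -size_poly_gt0.
  by move: (size (P x.2).1) (size (P x.2).2) => i j i0 ij; apply/eqP; clear -i0 ij; lia.
have inj : injective F.
  move=> x z e; have [m1 m2 ex s2] := PP x.2; have [m1' m2' ez s2'] := PP z.2.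
  have e' : A x ^+ 2 * (P x.2).2 = A z ^+ 2 * (P z.2).2.
    by rewrite -(of_monicK (FM x)) -(of_monicK (FM z)) -/(F x) e.
  have [eA eP] := monic_separable_part_unique (Am x).1 (Am z).1 s2 s2' e'.
  have e1 : x.1 = z.1.
    have := congr1 (fun p : {poly k} => p.[0]) eA.
    by rewrite /A !hornerMXaddC !mulr0 !add0r.
  have e2 : (P x.2).1 = (P z.2).1.
    have X0 : 'X != 0 :> {poly k} by rewrite polyX_eq0.
    by apply: (mulIf X0); move: eA; rewrite /A e1 => /addIr.
  have e3 : x.2 = z.2 by apply: to_monic_inj; rewrite ex ez e2 eP.
  by case: x z e1 e3 {e e' eA eP e2 m1 m2 ex s2 m1' m2' ez s2'} => [x1 x2] [z1 z2] /= -> ->.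
rewrite -[(q * q ^ n)%N]/(q * q ^ n)%N -card_npoly -card_prod -cardsT -(card_imset _ inj).
apply: eq_card => b; rewrite inE; apply/idP/imsetP => [nb|[x _ ->]].
  (* Surjectivity: the square part [a] of a non-separable polynomial has positive degree, so [a] is
     [a' * 'X] plus a constant with [a'] monic, and [a' ^+ 2 * c] has degree [n]. *)
  have Mb := to_monicP b; have [[a c] /= [am cm e sc]] := monic_separable_part (monic_of_monic Mb).
  have sa : (1 < size a)%N.
    rewrite ltnNge; apply: contra nb => sa; rewrite e.
    by rewrite (monic_size1 am sa) expr1n mul1r.
  pose a' := drop_poly 1 a.
  have ea : a = a' * 'X + (a`_0)%:P.
    rewrite -[LHS](poly_take_drop 1) addrC; congr (_ + _).
    by apply/polyP => i; rewrite coef_take_poly coefC; case: i.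
  have a'0 : a' != 0.
    apply: contraTneq sa => a'0; rewrite ea a'0 mul0r add0r.
    by rewrite -leqNgt size_polyC_leq1.
  have a'm : a' \is monic.
    move: am; rewrite ea monicE lead_coefDl ?lead_coefMX ?monicE //.
    by rewrite size_mulX // (leq_ltn_trans (size_polyC_leq1 _)) // ltnS size_poly_gt0.
  have Ma' : monic_of n (a' ^+ 2 * c).
    have := monic_of_size Mb; rewrite e /monic_of monicMl ?monic_exp // cm /=.
    rewrite !size_monicM ?monic_exp ?monic_neq0 //.
    have -> : size a = (size a').+1 by rewrite ea size_MXaddC (negbTE a'0).
    have := a'0; rewrite -size_poly_gt0; move: (size a') (size c) => i j i0 ij.
    by apply/eqP; clear -i0 ij; lia.
  exists (a`_0, of_monic n (a' ^+ 2 * c)); first by rewrite inE.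
  have [m1 m2 ex s2] := PP (of_monic n (a' ^+ 2 * c)).
  rewrite of_monicK // in ex.
  have [e1 e2] := monic_separable_part_unique a'm m1 sc s2 ex.
  by rewrite /F /A /= -e1 -e2 -ea -e to_monicK.
have [m1 m2 e s2] := PP x.2; rewrite /F of_monicK //.
apply/negP => /square_dvd_separable H; have := H (A x) (dvdp_mulIl _ _).
rewrite (Am x).2 => -[] /eqP; rewrite size_poly_eq0 => /eqP m0.
by move: m1; rewrite m0 monicE lead_coef0 eq_sym oner_eq0.
Qed.

Lemma separable_count n : monic_count n.+2 separable = (q ^ n.+2 - q ^ n.+1)%N.
Proof.
have := monic_count_true n.+2; rewrite (monic_count_split _ _ separable).
rewrite -[X in (_ + X)%N]/(monic_count n.+2 (fun f => ~~ separable f)) nonseparable_count.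
by rewrite -expnS => <-; rewrite addnK; apply: eq_monic_count.
Qed.

Lemma separable_count1 : monic_count 1 separable = q.
Proof.
rewrite -[RHS]expn1 -(monic_count_true 1); apply: eq_monic_count => f /monic_of_size sf.
apply/negPn/negP => /square_factor-/(_ _)[].
  by rewrite -size_poly_gt0 sf.
move=> a sa /dvdp_leq; rewrite -size_poly_gt0 sf => /(_ isT).
have a0 : a != 0 by rewrite -size_poly_gt0 ltnW.
rewrite expr2 size_mul //; move: (size a) sa => l; clear; lia.
Qed.

Lemma separable_count0 : monic_count 0 separable = 1%N.
Proof.
rewrite -[RHS](expn0 q) -(monic_count_true 0); apply: eq_monic_count => f.
by move=> /andP[fm /eqP sf]; rewrite (monic_size1 fm) ?sf // separable1.
Qed.

End MonicCount.

(** * Separable polynomials fixed by an affine substitution *)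

Section FixedPolynomials.
Variable k : finFieldType.
Local Notation q := #|k|.
Implicit Types (f g h : {poly k}) (Q : pred {poly k}).

(** Nonvanishing at 0 is the extra condition on [h] under which [x h(x)], and [h(x^m)] with [m > 1]
    prime to the characteristic, are separable. *)
Definition nonzero_separable f := separable f && (f.[0] != 0).

Definition nonzero_count n := monic_count n nonzero_separable.

Lemma coprimep_X f : coprimep 'X f = (f.[0] != 0).
Proof. by rewrite coprimep_sym -['X]subr0 -polyC0 coprimep_XsubC. Qed.

Lemma separable_mulX f : separable (f * 'X) = nonzero_separable f.
Proof.
rewrite /nonzero_separable /separable derivM derivX mulr1 coprimepMl.
have e1 : coprimep f (f^`() * 'X + f) = coprimep f f^`() && coprimep f 'X.
  by rewrite addrC -{2}[f]mul1r coprimep_addl_mul coprimepMr.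
have e2 : coprimep 'X (f^`() * 'X + f) = (f.[0] != 0).
  by rewrite coprimep_X !hornerE.
by rewrite e1 e2 [coprimep f 'X]coprimep_sym coprimep_X -andbA andbb.
Qed.

Lemma monic_of_mulX n f : monic_of n f -> monic_of n.+1 (f * 'X).
Proof.
move=> Mf; rewrite -addn1; apply: monic_of_mul => //.
by rewrite /monic_of monicX size_polyX.
Qed.

Lemma factor_X f : f.[0] = 0 -> exists g, f = g * 'X.
Proof.
move=> f0; have : ('X - 0%:P) %| f by rewrite dvdp_XsubCl rootE f0.
by rewrite subr0 => /dvdpP.
Qed.

Lemma monic_of_divX n g : monic_of n.+1 (g * 'X) -> monic_of n g.
Proof.
move=> /andP[gm /eqP sg]; have g0 : g != 0.
  by apply: contraTneq gm => ->; rewrite mul0r monicE lead_coef0 eq_sym oner_eq0.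
move: sg; rewrite size_mulX // => -[sg].
by rewrite /monic_of sg eqxx andbT -(monicMr _ (monicX k)).
Qed.

(** A separable polynomial vanishing at 0 is ['X] times one that does not vanish there. The
    alternating sum resulting from this recursion is the source of the sign in [A2]. *)
Lemma nonzero_count_rec n : (nonzero_count n.+1 + nonzero_count n)%N =
  monic_count n.+1 (@separable k).
Proof.
rewrite [RHS](monic_count_split _ _ (fun f => f.[0] != 0)); congr (_ + _)%N.
apply: (@monic_count_bij _ _ _ _ _ (fun f => f * 'X)).
- move=> f Mf nf; rewrite monic_of_mulX //= separable_mulX nf.
  by rewrite hornerMX mulr0 eqxx.
- by move=> f g _ _ _ _ /(mulIf (_ : 'X != 0)); apply; rewrite polyX_eq0.
move=> h Mh /andP[sh /negPn/eqP/factor_X[f e]]; exists f.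
by rewrite -separable_mulX -e; split=> //; apply: monic_of_divX; rewrite -e.
Qed.

Lemma nonzero_count0 : nonzero_count 0 = 1%N.
Proof.
rewrite -[RHS](separable_count0 k); apply: eq_monic_count => f.
move=> /andP[fm /eqP sf]; rewrite (monic_size1 fm) ?sf //.
by rewrite /nonzero_separable hornerC oner_neq0 andbT.
Qed.

Lemma size_comp_gt1 (a r : {poly k}) : (1 < size a)%N -> (1 < size r)%N ->
  (1 < size (a \Po r))%N.
Proof.
move=> sa sr; have := size_comp_poly a r.
move: (size (a \Po r)) (size a) (size r) sa sr => i j l; clear.
case: j => // j; case: l => // l /= j0 l0 e.
by have := muln_gt0 j l; lia.
Qed.

(** A square factor [a ^+ 2] of [h] would become the square factor [(a \Po r) ^+ 2] of the
    composite. *)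
Lemma separable_of_comp (h r : {poly k}) : (1 < size r)%N -> h != 0 -> separable (h \Po r) -> separable h.
Proof.
move=> sr h0 sh; apply: contraT => /(square_factor h0)[a sa /dvdpP[b e]].
have : size (a \Po r) = 1%N.
  by apply: (square_dvd_separable sh); rewrite e comp_polyM rmorphXn dvdp_mulIr.
by have := size_comp_gt1 sa sr => /[swap] ->.
Qed.

Lemma monic_of_comp m d (h r : {poly k}) : (0 < d)%N -> monic_of d r ->
  (monic_of m h -> monic_of (m * d) (h \Po r)).
Proof.
move=> d0 /andP[rm /eqP sr] /andP[hm /eqP sh].
rewrite /monic_of monicE lead_coef_comp ?sr // (monicP hm) (monicP rm) expr1n mulr1 eqxx /=.
have hr0 : (0 < size (h \Po r))%N.
  by rewrite size_poly_gt0 comp_poly_eq0 ?sr // monic_neq0.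
by rewrite -(prednK hr0) size_comp_poly sh sr.
Qed.

Lemma comp_poly_monic_inj (r : {poly k}) : (1 < size r)%N ->
  injective (fun h => h \Po r).
Proof.
move=> sr f g /eqP; rewrite -subr_eq0 -comp_polyB comp_poly_eq0 // subr_eq0.
by move/eqP.
Qed.

Lemma monic_of_comp_inv n d (h r : {poly k}) : (0 < d)%N -> monic_of d r ->
  monic_of n (h \Po r) -> exists2 m, n = (m * d)%N & monic_of m h.
Proof.
move=> d0 /andP[rm /eqP sr] /andP[hm /eqP sh].
have h0 : h != 0.
  by apply: contraTneq hm => ->; rewrite comp_poly0 monicE lead_coef0 eq_sym oner_eq0.
exists (size h).-1.
  by have := size_comp_poly h r; rewrite sh sr.
rewrite /monic_of prednK ?size_poly_gt0 // eqxx andbT monicE.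
by move: hm; rewrite monicE lead_coef_comp ?sr // (monicP rm) expr1n mulr1.
Qed.

Section Translation.
Variables (p : nat) (v : k).
Hypotheses (kp : p \in [pchar k]) (v0 : v != 0).

Let pp : prime p. Proof. by case/andP: kp. Qed.
Let p1 : (1 < p)%N. Proof. exact: prime_gt1. Qed.

(* The product of the X - i v for i in F_p. *)
Definition translation_invariant : {poly k} := 'X^p - v ^+ p.-1 *: 'X.

Let L := translation_invariant.
Let tau := affine_poly 1 v.

Lemma translation_invariant_size : size L = p.+1.
Proof.
rewrite /L /translation_invariant size_polyDl size_polyXn // size_polyN.
by rewrite size_scale ?expf_neq0 // size_polyX ltnS.
Qed.

Lemma translation_invariant_monic : monic_of p L.
Proof.
rewrite /monic_of translation_invariant_size eqxx andbT monicE /L /translation_invariant.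
rewrite lead_coefDl ?lead_coefXn // size_polyN size_polyXn.
by rewrite size_scale ?expf_neq0 // size_polyX ltnS.
Qed.

Lemma translation_invariantP : L \Po tau = L.
Proof.
have kP : p \in [pchar {poly k}] by rewrite (rmorph_pchar (@polyC k)).
rewrite /L /translation_invariant comp_polyB comp_polyZ comp_polyX rmorphXn /= comp_polyX.
rewrite /tau /affine_poly scale1r.
have -> : ('X + v%:P) ^+ p = 'X^p + (v ^+ p)%:P.
  by rewrite -(pFrobenius_autE kP) rmorphD /= !pFrobenius_autE polyC_exp.
rewrite scalerDr -[v ^+ p.-1 *: v%:P]mul_polyC -polyCM -exprSr prednK ?prime_gt0 //.
by rewrite opprD addrACA subrr addr0.
Qed.

Lemma translation_invariant_deriv : L^`() = (- v ^+ p.-1)%:P.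
Proof.
rewrite /L /translation_invariant derivB derivXn derivZ derivX alg_polyC.
have -> : ('X^(p.-1) *+ p : {poly k}) = 0.
  by rewrite -mulr_natr -polyC_natr (pcharf0 kp) polyC0 mulr0.
by rewrite sub0r polyCN.
Qed.

(** [f - f(0)] vanishes at the [p] distinct multiples of [v], but has degree less than [p]. *)
Lemma translation_fixed_small f : (size f <= p)%N -> f \Po tau = f -> f = (f.[0])%:P.
Proof.
move=> sf ft; apply/eqP; rewrite -subr_eq0; apply: contraT => nz.
have val i : f.[v *+ i] = f.[0].
  elim: i => [|i IH]; first by rewrite mulr0n.
  rewrite mulrS addrC -IH -[in RHS]ft horner_comp /tau /affine_poly scale1r.
  by rewrite hornerD hornerX hornerC.
have := @max_poly_roots _ _ [seq v *+ i | i <- iota 0 p] nz.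
rewrite size_map size_iota => H; suff : (p < size (f - (f.[0])%:P)%R)%N.
  rewrite ltnNge; apply: contraNT => _.
  apply: leq_trans (size_polyD _ _) _; rewrite size_polyN geq_max sf.
  by rewrite (leq_trans (size_polyC_leq1 _)) // ltnW.
apply: H; first by apply/allP => x /mapP[i _ ->]; rewrite rootE hornerD hornerN hornerC val subrr.
rewrite map_inj_in_uniq ?iota_uniq // => i j; rewrite !mem_iota !add0n /= => ip jp.
wlog ij : i j ip jp / (i <= j)%N.
  by case/orP: (leq_total i j) => ij H e; [exact: H|symmetry; apply: H].
move=> /eqP; rewrite eq_sym -subr_eq0 -mulrnBr // -mulr_natr mulf_eq0 (negbTE v0) /=.
rewrite -(dvdn_pcharf kp) => /dvdnP[[|c] e]; first by move: e ij; rewrite mul0n; lia.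
by move: e; rewrite mulSn; lia.
Qed.

(** Uniqueness of Euclidean division by the invariant [L] makes quotient and remainder of an
    invariant polynomial invariant. The remainder is then constant, and induction applies to the
    quotient. *)
Lemma translation_fixed f : f \Po tau = f -> exists h, f = h \Po L.
Proof.
have [n] := ubnP (size f); elim: n f => // n IH f sf ft.
have [->|f0] := eqVneq f 0; first by exists 0; rewrite comp_poly0.
have sL := translation_invariant_size; have Lm := monic_of_monic translation_invariant_monic.
have L0 := monic_neq0 Lm.
have eD := divp_eq f L.
have sR : (size (f %% L)%R < size L)%N by rewrite ltn_modp.
have stau : size tau = 2%N by rewrite size_affine_poly ?oner_neq0.
have eD2 : f = ((f %/ L) \Po tau) * L + ((f %% L) \Po tau).
  by rewrite -[LHS]ft [in LHS]eD comp_polyD comp_polyM translation_invariantP.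
have sR2 : (size ((f %% L) \Po tau)%R < size L)%N by rewrite size_comp_poly2.
have eQ : (f %/ L) \Po tau = f %/ L by rewrite [in RHS]eD2 divp_addl_mul_small.
have eR : (f %% L) \Po tau = f %% L by rewrite [in RHS]eD2 modp_addl_mul_small.
have [|h eh] := IH (f %/ L) _ eQ.
  rewrite size_divp // sL /=; move: sf; have := f0; rewrite -size_poly_gt0.
  by move: (size f) => l; clear -p1; lia.
have eR0 : f %% L = ((f %% L).[0])%:P.
  by apply: translation_fixed_small => //; rewrite -ltnS -sL.
exists (h * 'X + ((f %% L).[0])%:P).
by rewrite comp_poly_MXaddC -eh -eR0.
Qed.

(** Composition with [L] is a bijection from the monic separable polynomials of degree [n / p]. It
    preserves separability since [L] has a nonzero constant derivative. *)
Lemma translation_count n : monic_count n (fun f => separable f && (f \Po tau == f)) =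
  if (p %| n)%N then monic_count (n %/ p) (@separable k) else 0%N.
Proof.
have p0 : (0 < p)%N by apply: prime_gt0.
have LM := translation_invariant_monic; have sL := translation_invariant_size.
have sL1 : (1 < size L)%N by rewrite sL ltnS.
have inv h : monic_of n h -> separable h && (h \Po tau == h) ->
    exists m f, [/\ n = (m * p)%N, monic_of m f, separable f & f \Po L = h].
  move=> Mh /andP[sh /eqP/translation_fixed[f e]]; rewrite e in Mh sh *.
  have [m en Mf] := monic_of_comp_inv p0 LM Mh; exists m, f; split=> //.
  by apply: separable_of_comp sh => //; apply: monic_neq0 (monic_of_monic Mf).
case: ifPn => [/dvdnP[m en]|pn]; last first.
  apply: monic_count0 => f Mf; apply/negP => /(inv f Mf)[m [h [e _ _ _]]].
  by move: pn; rewrite e dvdn_mull.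
rewrite en mulnK //; symmetry; apply: (@monic_count_bij _ _ _ _ _ (fun h => h \Po L)).
- move=> f Mf sf; rewrite monic_of_comp //= -comp_polyA translation_invariantP eqxx andbT.
  apply: coprime_deriv_comp translation_invariant_deriv _ => //.
  by rewrite oppr_eq0 expf_neq0.
- by move=> f g _ _ _ _; apply: comp_poly_monic_inj.
move=> h; rewrite -en => Mh Qh; have [m' [f [e Mf sf ef]]] := inv h Mh Qh.
exists f; split=> //; suff <- : m' = m by [].
by apply/eqP; rewrite -(eqn_pmul2r p0) -e -en.
Qed.

End Translation.

Section Scaling.
Variables (u : k) (m : nat).
Hypotheses (m1 : (1 < m)%N) (uP : m.-primitive_root u).

Let m0 : (0 < m)%N. Proof. exact: ltnW. Qed.

Let u0 : u != 0.
Proof.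
by apply: contra_eq_neq (prim_expr_order uP) => ->; rewrite expr0n gtn_eqF ?m0 // eq_sym oner_eq0.
Qed.

Let mk0 : m%:R != 0 :> k. Proof. exact: prim_root_natf_neq0 uP. Qed.

Lemma size_Xn_gt1 : (1 < size ('X^m : {poly k}))%N.
Proof. by rewrite size_polyXn ltnS. Qed.

Lemma monic_of_Xn : monic_of m ('X^m : {poly k}).
Proof. by rewrite /monic_of monicXn size_polyXn eqxx. Qed.

(** The derivative is [m x^(m-1) h'(x^m)]: here [m] is invertible in [k] because a primitive [m]-th
    root exists, and [x] is prime to [h(x^m)] because [h(0)] is nonzero. *)
Lemma separable_comp_Xn h : nonzero_separable h -> separable (h \Po 'X^m).
Proof.
move=> /andP[sh h0]; rewrite /separable deriv_comp derivXn -mulr_natr -polyC_natr.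
rewrite [_ * (m%:R)%:P]mulrC mul_polyC -scalerAr coprimepZr // coprimepMr.
have -> : coprimep (h \Po 'X^m) (h^`() \Po 'X^m).
  move/Bezout_eq1_coprimepP: sh => [[a b] /= e]; apply/Bezout_eq1_coprimepP.
  exists (a \Po 'X^m, b \Po 'X^m) => /=.
  by rewrite -!comp_polyM -comp_polyD e rmorph1.
rewrite coprimep_expr // coprimep_sym coprimep_X horner_comp hornerXn.
by rewrite expr0n gtn_eqF.
Qed.

Lemma coef_comp_scale f i : (f \Po affine_poly u 0)`_i = f`_i * u ^+ i.
Proof.
rewrite /affine_poly polyC0 addr0 comp_polyE.
have -> : \sum_(j < size f) f`_j *: (u *: 'X) ^+ j = \poly_(j < size f) (f`_j * u ^+ j).
  by rewrite poly_def; apply: eq_bigr => j _; rewrite exprZn scalerA.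
rewrite coef_poly; case: ltnP => // si.
by rewrite nth_default // mul0r.
Qed.

Lemma scale_comp_Xn h : (h \Po 'X^m) \Po affine_poly u 0 = h \Po 'X^m.
Proof.
apply/polyP => i; rewrite coef_comp_scale coef_comp_poly_Xn //.
case: ifP => [/dvdnP[j ->]|_]; last by rewrite mul0r.
by rewrite mulnC exprM (prim_expr_order uP) expr1n mulr1.
Qed.

(** Scaling multiplies the coefficient of index [i] by [u ^+ i], so for the eigenvalue [u ^+ n] only
    the indices congruent to [n] modulo [m] survive. *)
Lemma eigen_decompose f n : f \Po affine_poly u 0 = u ^+ n *: f ->
  exists h, f = 'X^(n %% m) * (h \Po 'X^m).
Proof.
move=> e; have fi i : f`_i != 0 -> (i %% m = n %% m)%N.
  move=> fi; have := congr1 (fun g : {poly k} => g`_i) e.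
  rewrite coef_comp_scale coefZ mulrC => /(mulIf fi)/eqP.
  by rewrite (eq_prim_root_expr uP) => /eqP.
exists (\poly_(j < size f) f`_(n %% m + j * m)).
apply/polyP => i; rewrite coefXnM coef_comp_poly_Xn // coef_poly.
have [fi0|/fi ei] := eqVneq f`_i 0.
  rewrite fi0; case: ltnP => // ni; case: ifP => // /dvdnP[j ej].
  rewrite ej mulnK //; case: ltnP => // _.
  by rewrite -ej subnKC.
have ni : (n %% m <= i)%N by rewrite -ei leq_mod.
have eij : i = (i %/ m * m + n %% m)%N by rewrite -ei -divn_eq.
have e1 : (i - n %% m = i %/ m * m)%N by rewrite {1}eij addnK.
rewrite ltnNge ni /= e1 dvdn_mull // mulnK // addnC -eij; case: ltnP => // sf.
rewrite nth_default // (leq_trans sf) // leq_div //.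
Qed.

(** Eigenvectors have the form [x^r h(x^m)] with [r = n %% m]. For [r >= 2] they are divisible by
    [x^2]; for [r] equal to 0 or 1 they are separable exactly when [h] is separable with [h(0)]
    nonzero. *)
Lemma scaling_count_mod n :
  monic_count n (fun f => separable f && (f \Po affine_poly u 0 == u ^+ n *: f)) =
  if (n %% m < 2)%N then nonzero_count (n %/ m) else 0%N.
Proof.
have sX := size_Xn_gt1; have MX := monic_of_Xn.
have X2 f : 'X ^+ 2 %| f -> ~ separable f.
  by move=> H /square_dvd_separable/(_ H); rewrite size_polyX.
case: ltnP => r2; last first.
  apply: monic_count0 => f Mf; apply/negP => /andP[sf /eqP/eigen_decompose[h e]].
  by apply: (X2 _ _ sf); rewrite e -(subnKC r2) exprD -mulrA dvdp_mulIl.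
symmetry; apply: (@monic_count_bij _ _ _ _ _ (fun h => 'X^(n %% m) * (h \Po 'X^m))).
- move=> f Mf nf; apply/andP; split.
    rewrite {1}(divn_eq n m) addnC; apply: monic_of_mul; last exact: monic_of_comp.
    by rewrite /monic_of monicXn size_polyXn eqxx.
  have un : u ^+ n = u ^+ (n %% m) by rewrite (prim_expr_mod uP).
  rewrite un comp_polyM scale_comp_Xn rmorphXn /= comp_polyX /affine_poly polyC0 addr0.
  rewrite exprZn scalerAl eqxx andbT.
  case: (n %% m)%N r2 => [|[|//]] _; first by rewrite mul1r separable_comp_Xn.
  rewrite mulrC separable_mulX /nonzero_separable separable_comp_Xn //= horner_comp hornerXn.
  by rewrite expr0n gtn_eqF //; case/andP: nf.
- move=> f g _ _ _ _ H; apply: (comp_poly_monic_inj sX).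
  by apply: (mulfI _ H); rewrite expf_neq0 // polyX_eq0.
move=> f Mf /andP[sf /eqP/eigen_decompose[h e]]; exists h; rewrite -e; split=> //.
  have [l el Mh] : exists2 l, (n = n %% m + l * m)%N & monic_of l h.
    have Mr : 'X^(n %% m) \is @monic k by apply: monicXn.
    have sh : monic_of (n - n %% m) (h \Po 'X^m).
      case/andP: Mf; rewrite e (monicMl _ Mr) => hm /eqP; rewrite size_monicM ?monic_neq0 //.
      rewrite size_polyXn /= => sh; rewrite /monic_of hm /= -(subSn (leq_mod n m)) -sh.
      by rewrite addKn.
    have [l el Mh] := monic_of_comp_inv m0 MX sh.
    by exists l; rewrite // -el subnKC // leq_mod.
  suff -> : (n %/ m)%N = l by [].
  by apply/eqP; rewrite -(eqn_pmul2r m0) -(eqn_add2l (n %% m)%N) -el addnC -divn_eq.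
have h0 : h != 0.
  apply: contraTneq (monic_of_monic Mf) => h0.
  by rewrite e h0 comp_poly0 mulr0 monicE lead_coef0 eq_sym oner_eq0.
have sh : separable (h \Po 'X^m).
  move: sf; rewrite e; case: (n %% m)%N r2 => [|[|//]] _; first by rewrite mul1r.
  by rewrite mulrC separable_mulX => /andP[].
rewrite /nonzero_separable (separable_of_comp sX h0 sh) /=; apply/eqP => /factor_X[g eg].
by apply: (X2 _ _ sh); rewrite eg comp_polyM comp_polyX -(subnKC m1) exprD dvdp_mull // dvdp_mulIl.
Qed.

(** Residue 0 or 1 modulo [m] is divisibility of [n] or of [n.-1], never of both as [m > 1]. The
    first case feeds the sum over divisors of [2g + 1], the second the sum over divisors of [2g]. *)
Lemma scaling_count n : (0 < n)%N ->
  monic_count n (fun f => separable f && (f \Po affine_poly u 0 == u ^+ n *: f)) =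
  ((if (m %| n)%N then nonzero_count (n %/ m) else 0) +
   (if (m %| n.-1)%N then nonzero_count (n.-1 %/ m) else 0))%N.
Proof.
case: n => // n _; rewrite scaling_count_mod /= modnS divnS //.
have [mn|mn] := boolP (m %| n.+1)%N; last by rewrite !ltnS leqn0 -/(m %| n)%N !add0n.
have -> : (m %| n)%N = false; last by rewrite addn0.
by apply: contraTF mn => mn; rewrite -addn1 dvdn_addr // dvdn1 gtn_eqF.
Qed.

End Scaling.

(* Conjugation by the translation to the fixed point of [x |-> u x + v]. *)
Lemma affine_count_conj n (u v a : k) : u != 1 ->
  monic_count n (fun f => separable f && (f \Po affine_poly u v == a *: f)) =
  monic_count n (fun f => separable f && (f \Po affine_poly u 0 == a *: f)).
Proof.
move=> u1; have u1' : 1 - u != 0 by rewrite subr_eq0 eq_sym.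
pose c := v / (1 - u); have ec : u * c + v = c.
  by rewrite /c; field.
have comp1 f b : (f \Po affine_poly 1 b) \Po affine_poly 1 (- b) = f.
  rewrite -comp_polyA comp_affine_poly !mul1r addNr affine_poly1 comp_polyXr //.
have comp2 f b : (f \Po affine_poly 1 (- b)) \Po affine_poly 1 b = f.
  by have := comp1 f (- b); rewrite opprK.
have Mc f b : monic_of n f -> monic_of n (f \Po affine_poly 1 b).
  move=> /andP[fm sf]; rewrite /monic_of size_comp_affine ?oner_neq0 // sf andbT.
  by rewrite monicE lead_coef_comp_affine ?oner_neq0 // expr1n mulr1 (monicP fm).
have sc f b : separable f -> separable (f \Po affine_poly 1 b).
  move=> sf; apply: (coprime_deriv_comp (oner_neq0 k)) sf.
  exact: deriv_affine_poly.
apply: (@monic_count_bij _ _ _ _ _ (fun f => f \Po affine_poly 1 c)).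
- move=> f Mf /andP[sf /eqP ef]; rewrite Mc // sc //=.
  rewrite -comp_polyA comp_affine_poly !mul1r add0r.
  have -> : affine_poly u c = affine_poly u v \Po affine_poly 1 c.
    by rewrite comp_affine_poly mulr1 ec.
  by rewrite comp_polyA ef comp_polyZ.
- by move=> f g _ _ _ _ e; rewrite -[f](comp1 f c) e comp1.
move=> h Mh /andP[sh /eqP eh]; exists (h \Po affine_poly 1 (- c)).
rewrite comp2; split=> //; first exact: Mc.
rewrite sc //= -comp_polyA comp_affine_poly !mul1r.
have -> : affine_poly u (v - c) = affine_poly u 0 \Po affine_poly 1 (- c).
  by rewrite comp_affine_poly mulr1 addr0; congr affine_poly; rewrite -{1}ec; ring.
by rewrite comp_polyA eh comp_polyZ.
Qed.

End FixedPolynomials.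

(** * Orbits of the affine group *)

Section UnitOrders.
Variable k : finFieldType.
Local Notation q := #|k|.

(** The unit group is cyclic of order [q.-1], so the elements of order [d] are the generators of its
    unique subgroup of order [d]. *)
Lemma card_unit_order d : #|[set x : {unit k} | #[x]%g == d]| =
  if (d %| q.-1)%N then totient d else 0%N.
Proof.
have /cyclicP[a ea] : cyclic [set: {unit k}] := field_unit_group_cyclic _.
have oa : #[a]%g = q.-1 by rewrite orderE -ea card_finField_unit.
case: ifPn => [dq|dq]; last first.
  apply: eq_card0 => x; rewrite inE; apply: contraNF dq => /eqP <-.
  by rewrite -oa [#[a]%g]orderE -ea; apply: order_dvdG; rewrite inE.
pose b := (a ^+ (#[a] %/ d))%g.
have q0 : (0 < q.-1)%N by rewrite -oa order_gt0.
have ob : #[b]%g = d.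
  by rewrite /b orderXdiv ?oa ?dvdn_div // divnA // mulKn.
rewrite -{2}ob totient_gen; apply: eq_card => x; rewrite !inE.
apply/eqP/idP => [ox|/eqP e]; last by rewrite orderE -e -orderE.
have dqa : (d %| #[a]%g)%N by rewrite oa.
have := cycle_sub_group dqa.
move=> /setP/(_ <[x]>%G); rewrite !inE -ea subsetT /= -orderE ox eqxx.
by move=> /esym/eqP/(congr1 val) /= e; rewrite /generator e eqxx.
Qed.

Lemma totient_double_odd m : odd m -> totient (2 * m) = totient m.
Proof. by move=> om; rewrite totient_coprime ?coprime2n // mul1n. Qed.

Lemma totient_double_even m : (0 < m)%N -> ~~ odd m -> totient (2 * m) = (2 * totient m)%N.
Proof.
move=> m0 om; have e : m = (2 ^ logn 2 m * (m %/ 2 ^ logn 2 m))%N.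
  by rewrite mulnC divnK // pfactor_dvdnn.
have co : coprime 2 (m %/ 2 ^ logn 2 m).
  rewrite prime_coprime //; apply/negP => /dvdnP[j ej].
  have : (2 ^ (logn 2 m).+1 %| m)%N by rewrite {2}e ej expnSr [(j * 2)%N]mulnC mulnA dvdn_mulr.
  by rewrite pfactor_dvdn // ltnn.
have l0 : (0 < logn 2 m)%N by rewrite logn_gt0 mem_primes m0 dvdn2 om.
have {e} [l [b [{}l0 {}co ->]]] : exists l b, [/\ (0 < l)%N, coprime 2 b & m = (2 ^ l * b)%N].
  by exists (logn 2 m), (m %/ 2 ^ logn 2 m)%N.
rewrite mulnA -expnS !totient_coprime ?coprimeXl // !totient_pfactor // mulnA.
by rewrite !mul1n -expnS prednK.
Qed.

(** The square of [x] has order [m] if and only if [x] has order [2m], or [m] is odd and [x] has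
    order [m]. For odd [m] this gives [phi(2m) + phi(m) = 2 phi(m)], for even [m] it gives
    [phi(2m) = 2 phi(m)]. As [q.-1] is even, an odd [m] divides it exactly when [2m] does. *)
Lemma card_unit_square_order m : odd q -> (0 < m)%N ->
  #|[set x : {unit k} | #[x ^+ 2]%g == m]| =
  if (2 * m %| q.-1)%N then (2 * totient m)%N else 0%N.
Proof.
move=> oq m0.
have q1 : (0 < q)%N by case: (q) oq.
have q2 : (2 %| q.-1)%N by rewrite dvdn2 -subn1 oddB // oq.
have ord2 (x : {unit k}) : (#[x ^+ 2]%g == m) = (#[x]%g == 2 * m)%N || (odd m && (#[x]%g == m)).
  rewrite orderXgcd; move: (#[x]%g) (order_gt0 x) => i i0.
  have [/dvdnP[j ej]|i2] := boolP (2 %| i)%N.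
    rewrite ej gcdnC gcdnMl mulnK // [(2 * m)%N]mulnC eqn_pmul2r //.
    case: (j =P m) => //= jm; apply/esym/negP => /andP[om /eqP e].
    by move: om; rewrite -e oddM andbF.
  have -> : gcdn i 2 = 1%N by apply/eqP; rewrite -/(coprime i 2) coprimen2 -[odd i]negbK -dvdn2.
  rewrite divn1; have -> : (i == 2 * m)%N = false.
    by apply: contraNF i2 => /eqP ->; rewrite dvdn_mulr.
  case: (i =P m) => [e|]; last by rewrite andbF.
  by rewrite -e -[odd i]negbK -dvdn2 i2.
case: (boolP (odd m)) => om.
  have -> : #|[set x : {unit k} | #[x ^+ 2]%g == m]| =
     (#|[set x : {unit k} | #[x]%g == (2 * m)%N]| + #|[set x : {unit k} | #[x]%g == m]|)%N.
    rewrite -cardsUI [X in (_ + X)%N](_ : _ = 0%N) ?addn0.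
      by apply: eq_card => x; rewrite !inE ord2 om.
    apply: eq_card0 => x; rewrite !inE; apply/negP => /andP[/eqP -> /eqP].
    by move: m0; lia.
  rewrite !card_unit_order totient_double_odd //.
  have -> : (m %| q.-1)%N = (2 * m %| q.-1)%N.
    by rewrite Gauss_dvd ?coprime2n // q2.
  by case: ifP => // _; rewrite mul2n addnn.
have -> : [set x : {unit k} | #[x ^+ 2]%g == m] = [set x : {unit k} | #[x]%g == (2 * m)%N].
  by apply/setP => x; rewrite !inE ord2 (negbTE om) orbF.
by rewrite card_unit_order totient_double_even.
Qed.

Lemma unit_order_primitive (x : {unit k}) : (#[x]%g).-primitive_root (val x).
Proof.
have xn i : (val x ^+ i == 1) = (#[x]%g %| i)%N.
  rewrite order_dvdn -FinRing.val_unitX -FinRing.val_unit1.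
  by apply/eqP/eqP => [/val_inj|->].
have x1 : val x ^+ #[x]%g = 1 by apply/eqP; rewrite xn.
have [m mx md] := prim_order_exists (order_gt0 x) x1.
suff -> : #[x]%g = m by [].
apply/eqP; rewrite eqn_dvd md -xn.
by rewrite (prim_expr_order mx) eqxx.
Qed.

End UnitOrders.

Section AffineAction.
Variables (k : finFieldType) (n : nat).
Local Notation q := #|k|.

Definition unit_val (w : {unit k}) : GRing.Field.sort k := val w.
Arguments unit_val : simpl never.

Lemma unit_valM (w t : {unit k}) : unit_val (w * t)%g = unit_val w * unit_val t.
Proof. by []. Qed.

Lemma unit_valV (w : {unit k}) : unit_val (w^-1)%g = (unit_val w)^-1.
Proof. by []. Qed.

Lemma unit_val1 : unit_val 1%g = 1. Proof. by []. Qed.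

(* (w, v) stands for the substitution [x |-> w^2 x + v]. *)
Definition affine_group : Type := ({unit k} * k)%type.
HB.instance Definition _ := Finite.on affine_group.

Implicit Types (x z : affine_group).

(** The composite of the affine map of [x] after that of [z]. Substituting it into [f] means
    substituting [x] and then [z], so polynomials carry a right action, as [act_morph] demands. *)
Definition affine_mul x z : affine_group :=
  ((x.1 * z.1)%g, unit_val x.1 ^+ 2 * z.2 + x.2).
Definition affine_inv x : affine_group := ((x.1^-1)%g, - (unit_val x.1 ^- 2 * x.2)).
Definition affine_one : affine_group := (1%g, 0).

Lemma affine_mulA : associative affine_mul.
Proof.
move=> x z t; rewrite /affine_mul /= mulgA; congr (_, _).
by rewrite unit_valM; ring.
Qed.

Lemma affine_mul1 : left_id affine_one affine_mul.
Proof. by case=> w v; rewrite /affine_mul /= mul1g unit_val1 expr1n mul1r addr0. Qed.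

Lemma affine_mulV : left_inverse affine_one affine_inv affine_mul.
Proof.
case=> w v; rewrite /affine_mul /affine_inv /affine_one /= mulVg; congr (_, _).
by rewrite unit_valV exprVn subrr.
Qed.

HB.instance Definition _ := Finite_isGroup.Build affine_group affine_mulA affine_mul1 affine_mulV.

(** The scalar makes the result monic again when [f] is monic of degree [n]. It is even in [w], so
    the action factors through [w ^+ 2]. *)
Definition affine_act x (f : {poly k}) : {poly k} :=
  unit_val x.1 ^- (2 * n) *: (f \Po affine_poly (unit_val x.1 ^+ 2) x.2).

Lemma unit_neq0 (w : {unit k}) : unit_val w != 0.
Proof. by rewrite -unitfE /unit_val; apply: valP. Qed.

Lemma affine_act1 f : affine_act 1%g f = f.
Proof.
by rewrite /affine_act /= unit_val1 expr1n invr1 scale1r expr1n affine_poly1 comp_polyXr.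
Qed.

Lemma affine_actM x z f : affine_act (x * z)%g f = affine_act z (affine_act x f).
Proof.
rewrite /affine_act comp_polyZ scalerA -comp_polyA comp_affine_poly.
rewrite -[(x * z)%g]/(affine_mul x z) /affine_mul /= unit_valM !exprMn invfM.
by rewrite [in RHS]mulrC.
Qed.

Lemma affine_act_monic x f : monic_of n f -> monic_of n (affine_act x f).
Proof.
have w0 := unit_neq0 x.1; have w20 : unit_val x.1 ^+ 2 != 0 by rewrite expf_neq0.
move=> /andP[/monicP fm /eqP sf]; rewrite /affine_act /monic_of.
rewrite size_scale ?invr_eq0 ?expf_neq0 // size_comp_affine // sf eqxx andbT.
by rewrite monicE lead_coefZ lead_coef_comp_affine // fm sf mul1r -exprM mulVf ?expf_neq0.
Qed.

Lemma affine_act_separable x f : separable (affine_act x f) = separable f.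
Proof.
have H z g : separable g -> separable (affine_act z g).
  move=> sg; have w0 := unit_neq0 z.1.
  rewrite /affine_act separableZ ?invr_eq0 ?expf_neq0 //.
  apply: (coprime_deriv_comp (expf_neq0 2 w0)) sg; exact: deriv_affine_poly.
apply/idP/idP; last exact: H.
by move=> /(H (x^-1)%g); rewrite -affine_actM mulgV affine_act1.
Qed.

Lemma affine_act_fixed x f :
  (affine_act x f == f) = (f \Po affine_poly (unit_val x.1 ^+ 2) x.2 == (unit_val x.1 ^+ 2) ^+ n *: f).
Proof.
have w0 : unit_val x.1 ^+ (2 * n) != 0 by rewrite expf_neq0 // unit_neq0.
rewrite /affine_act -exprM; apply/eqP/eqP => [e|->]; last by rewrite scalerA mulVf // scale1r.
by rewrite -[in RHS]e scalerA divff // scale1r.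
Qed.

Definition monic_act (a : {poly_n k}) x : {poly_n k} := of_monic n (affine_act x (to_monic a)).

Lemma monic_actE a x : to_monic (monic_act a x) = affine_act x (to_monic a).
Proof. by rewrite of_monicK // affine_act_monic // to_monicP. Qed.

Lemma monic_act1 a : monic_act a 1%g = a.
Proof. by apply: to_monic_inj; rewrite monic_actE affine_act1. Qed.

Lemma monic_actM a : act_morph monic_act a.
Proof. by move=> x z; apply: to_monic_inj; rewrite !monic_actE affine_actM. Qed.

Definition monic_action := TotalAction monic_act1 monic_actM.

Definition separable_monics : {set {poly_n k}} := [set a | separable (to_monic a)].

Definition affine_classes : {set {set {poly_n k}}} :=
  orbit monic_action [set: affine_group] @: separable_monics.

Lemma affine_classesP (A : {set {poly_n k}}) :
  reflect (exists2 a, a \in separable_monics & A = orbit monic_action [set: affine_group] a)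
          (A \in affine_classes).
Proof. exact: imsetP. Qed.

Lemma burnside : (\sum_(x : affine_group)
    monic_count n (fun f => separable f && (affine_act x f == f)) =
  #|affine_classes| * (q.-1 * q))%N.
Proof.
have acts : [acts [set: affine_group], on separable_monics | monic_action].
  apply/actsP => x _ a; rewrite !inE /= monic_actE affine_act_separable //.
have := Frobenius_Cauchy acts; rewrite -/affine_classes.
have -> : #|[set: affine_group]| = (q.-1 * q)%N.
  by rewrite cardsT card_prod -cardsT card_finField_unit.
move=> <-; apply: eq_big => [x|x _]; first by rewrite inE.
apply: eq_card => a; rewrite !inE; congr (_ && _).
rewrite sub1set inE; apply/eqP/eqP => [e|e].
  by apply: to_monic_inj; rewrite monic_actE.
by rewrite -[in RHS]e monic_actE.
Qed.

End AffineAction.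

(** * Evaluation of the Burnside sum *)

Section ClassCount.
Variables (k : finFieldType) (p : nat).
Hypotheses (kp : p \in [pchar k]) (oddp : odd p).
Local Notation q := #|k|.

Lemma odd_card : odd q.
Proof.
have pp : prime p by case/andP: kp.
have ab : (p.-abelem [set: k])%g by apply: fin_ring_pchar_abelem.
by rewrite -cardsT; apply: (odd_pgroup_odd oddp (abelem_pgroup ab)).
Qed.

Variable n : nat.
Hypothesis n0 : (0 < n)%N.

Local Notation fixed_count x :=
  (monic_count n (fun f => separable f && (affine_act n x f == f))).

Lemma fixed_countE (x : affine_group k) : fixed_count x =
  monic_count n (fun f => separable f &&
    (f \Po affine_poly (unit_val x.1 ^+ 2) x.2 == (unit_val x.1 ^+ 2) ^+ n *: f)).
Proof. by apply: eq_monic_count => f _; rewrite affine_act_fixed. Qed.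

Lemma unit_val_square (w : {unit k}) : unit_val w ^+ 2 = unit_val (w ^+ 2)%g.
Proof. by rewrite expgS expg1 unit_valM expr2. Qed.

Lemma fixed_count_identity (w : {unit k}) : #[w ^+ 2]%g = 1%N ->
  fixed_count ((w, 0) : affine_group k) = monic_count n (@separable k).
Proof.
move=> /eqP; rewrite order_eq1 => /eqP w1; rewrite fixed_countE /= unit_val_square w1 unit_val1.
by apply: eq_monic_count => f _; rewrite affine_poly1 comp_polyXr expr1n scale1r eqxx andbT.
Qed.

Lemma fixed_count_translation (w : {unit k}) (v : k) : #[w ^+ 2]%g = 1%N -> v != 0 ->
  fixed_count ((w, v) : affine_group k) =
  if (p %| n)%N then monic_count (n %/ p) (@separable k) else 0%N.
Proof.
move=> /eqP; rewrite order_eq1 => /eqP w1 v0; rewrite -(translation_count kp v0).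
rewrite fixed_countE /= unit_val_square w1 unit_val1.
by apply: eq_monic_count => f _; rewrite expr1n scale1r.
Qed.

Definition scaling_term m : nat :=
  ((if (m %| n)%N then nonzero_count k (n %/ m) else 0) +
   (if (m %| n.-1)%N then nonzero_count k (n.-1 %/ m) else 0))%N.

Lemma fixed_count_scaling (w : {unit k}) (v : k) : #[w ^+ 2]%g != 1%N ->
  fixed_count ((w, v) : affine_group k) = scaling_term #[w ^+ 2]%g.
Proof.
move=> w1; have u1 : unit_val w ^+ 2 != 1.
  rewrite unit_val_square; apply: contraNneq w1 => e; rewrite order_eq1.
  by apply/eqP/val_inj.
rewrite fixed_countE affine_count_conj // unit_val_square.
apply: scaling_count => //; last exact: unit_order_primitive.
by rewrite ltn_neqAle eq_sym w1 order_gt0.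
Qed.

Lemma card_neq0 : #|[pred v : k | v != 0]| = q.-1.
Proof. by rewrite -(cardC1 (0 : k)); apply: eq_card => v; rewrite !inE. Qed.

Lemma sum_fixed_count (w : {unit k}) : (\sum_(v : k) fixed_count ((w, v) : affine_group k) =
  if #[w ^+ 2]%g == 1%N then monic_count n (@separable k) +
    q.-1 * (if (p %| n)%N then monic_count (n %/ p) (@separable k) else 0)
  else q * scaling_term #[w ^+ 2]%g)%N.
Proof.
case: eqP => [w1|/eqP w1].
  rewrite (bigD1 0) //= fixed_count_identity //; congr (_ + _)%N.
  by rewrite (eq_bigr _ (fun v v0 => fixed_count_translation w1 v0)) sum_nat_const card_neq0.
by rewrite (eq_bigr _ (fun v _ => fixed_count_scaling v w1)) sum_nat_const.
Qed.

(** Groups the units by the order [m] of their square; only orders dividing [N] contribute, and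
    [card_unit_square_order] gives the size of each group. *)
Lemma sum_over_orders (G : nat -> nat) N : odd q -> (0 < N)%N ->
  (\sum_(w : {unit k} | #[(w ^+ 2)%g]%g != 1%N)
     (if (#[(w ^+ 2)%g]%g %| N)%N then G #[(w ^+ 2)%g]%g else 0) =
   \sum_(m <- divisors N | (1 < m)%N)
     (if (2 * m %| q.-1)%N then 2 * totient m else 0) * G m)%N.
Proof.
move=> oq N0.
transitivity (\sum_(m <- divisors N | (1 < m)%N)
    \sum_(w : {unit k} | #[(w ^+ 2)%g]%g == m) G m)%N; last first.
  rewrite big_seq_cond [RHS]big_seq_cond; apply: eq_bigr => m /andP[_ m1].
  by rewrite -card_unit_square_order ?(ltnW m1) // sum_nat_const cardsE.
rewrite (exchange_big_dep (fun w : {unit k} => #[(w ^+ 2)%g]%g != 1%N)) /=; last first.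
  by move=> m w m1 /eqP ->; rewrite gtn_eqF.
apply: eq_bigr => w w1; set d := #[_]%g.
have d1 : (1 < d)%N by rewrite ltn_neqAle eq_sym w1 order_gt0.
have [dN|dN] := boolP (d %| N)%N.
  rewrite -big_filter (_ : [seq m <- divisors N | (1 < m)%N && (d == m)] = [:: d]).
    by rewrite big_seq1.
  rewrite -(@filter_pred1_uniq _ (divisors N) d) ?divisors_uniq -?dvdn_divisors //.
  by apply: eq_filter => m /=; rewrite eq_sym; case: (m =P d) => [->|]; rewrite ?d1 ?andbF.
rewrite big_seq_cond big_pred0 // => m; rewrite -dvdn_divisors //.
by apply/negP => /and3P[mN _ /eqP e]; move: dN; rewrite e mN.
Qed.

(** The two units with square 1 contribute the identity and [q.-1] translations each, whence the
    factor 2. For any other unit all translation parts [v] give conjugate substitutions, whence the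
    factor [q]. *)
Lemma total_fixed_count : odd q -> (1 < n)%N ->
  (#|affine_classes k n| * (q.-1 * q) =
   2 * (monic_count n (@separable k) +
     q.-1 * (if (p %| n)%N then monic_count (n %/ p) (@separable k) else 0)) +
   q * (\sum_(m <- divisors n | 1 < m)
          (if (2 * m %| q.-1)%N then 2 * totient m else 0) * nonzero_count k (n %/ m) +
        \sum_(m <- divisors n.-1 | 1 < m)
          (if (2 * m %| q.-1)%N then 2 * totient m else 0) * nonzero_count k (n.-1 %/ m)))%N.
Proof.
move=> oq n1; rewrite -burnside.
have -> : (\sum_(x : affine_group k) fixed_count x =
    \sum_(w : {unit k}) \sum_(v : k) fixed_count ((w, v) : affine_group k))%N.
  by rewrite pair_bigA; apply: eq_bigr => -[w v].
rewrite (eq_bigr _ (fun w _ => sum_fixed_count w)).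
rewrite (bigID (fun w : {unit k} => #[(w ^+ 2)%g]%g == 1%N)) /=; congr (_ + _)%N.
  rewrite (eq_bigr (fun=> (monic_count n (@separable k) +
     q.-1 * (if (p %| n)%N then monic_count (n %/ p) (@separable k) else 0))%N)); last first.
    by move=> w /eqP ->.
  rewrite sum_nat_const -[X in (X * _)%N]cardsE card_unit_square_order //.
  by rewrite dvdn2 -subn1 oddB ?oq // ltnW // finNzRing_gt1.
rewrite (eq_bigr (fun w : {unit k} => q * scaling_term #[(w ^+ 2)%g]%g)%N); last first.
  by move=> w /negbTE ->.
rewrite -big_distrr /=; congr (_ * _)%N.
rewrite /scaling_term big_split /=; congr (_ + _)%N.
  exact: (sum_over_orders (fun m => nonzero_count k (n %/ m))).
apply: (sum_over_orders (fun m => nonzero_count k (n.-1 %/ m))) => //.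
by rewrite -ltnS prednK.
Qed.

Lemma separable_count_A1 j : (0 < j)%N ->
  (monic_count j (@separable k))%:R = q%:R * A1 q j%:R :> rat.
Proof.
case: j => [//|j] _; rewrite /A1 natr_nat ltr0n /= natrK.
case: j => [|j] /=; first by rewrite separable_count1 mulr1.
rewrite separable_count subn1 subn2 /= mulrBr -!exprS natrB ?natrX //.
by rewrite leq_exp2l // finNzRing_gt1.
Qed.

(** Both sides satisfy the same recursion, since [A2 q j.+1 + A2 q j = q ^+ j]. *)
Lemma nonzero_count_A2 j : (0 < j)%N ->
  (nonzero_count k j)%:R = (q%:R - 1) * A2 q j :> rat.
Proof.
have q1 : (1 < q)%N := finNzRing_gt1 k.
have nz : q%:R + 1 != 0 :> rat by rewrite natr1 pnatr_eq0.
elim: j => // j IH _; have := nonzero_count_rec k j.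
case: j IH => [|j] IH.
  rewrite nonzero_count0 separable_count1 => e.
  have -> : nonzero_count k 1 = (q - 1)%N by rewrite -e addnK.
  rewrite natrB ?(ltnW q1) // /A2 !expr1 opprK divff // mulr1 //.
rewrite separable_count => e.
have e' : (nonzero_count k j.+2)%:R + (nonzero_count k j.+1)%:R = q%:R ^+ j.+2 - q%:R ^+ j.+1 :> rat.
  by rewrite -natrD e natrB ?natrX // leq_exp2l.
have -> : (nonzero_count k j.+2)%:R = q%:R ^+ j.+2 - q%:R ^+ j.+1 - (nonzero_count k j.+1)%:R :> rat.
  by rewrite -e' addrK.
have A2E : A2 q j.+2 = q%:R ^+ j.+1 - A2 q j.+1.
  rewrite /A2; apply: (mulIf nz); rewrite divfK // [RHS]mulrBl divfK // !exprS; ring.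
rewrite IH // A2E [q%:R ^+ j.+2]exprS; ring.
Qed.

End ClassCount.

Lemma natr_sum_divisors (c d : nat -> bool) (B : nat -> nat) (A : nat -> rat) a N :
  (0 < N)%N -> (forall m, (m %| N)%N -> c m = d m) ->
  (forall j, (0 < j)%N -> (B j)%:R = a * A j) ->
  (\sum_(m <- divisors N | (1 < m)%N)
     (if c m then 2 * totient m else 0) * B (N %/ m))%N%:R =
  a * \sum_(m <- divisors N | (1 < m)%N)
     2 * (totient m)%:R * (if d m then A (N %/ m)%N else 0) :> rat.
Proof.
move=> N0 Hc HB; rewrite natr_sum mulr_sumr big_seq_cond [RHS]big_seq_cond.
apply: eq_bigr => m /andP[]; rewrite -(dvdn_divisors _ N0) => mN m1.
have j0 : (0 < N %/ m)%N by rewrite divn_gt0; [exact: dvdn_leq N0 mN | exact: ltnW].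
rewrite natrM (Hc m mN) (HB _ j0); case: (d m); last by rewrite mul0r !mulr0.
by rewrite natrM mulrCA.
Qed.

Lemma class_number_formula (k : finFieldType) (p g : nat) :
  p \in [pchar k] -> odd p -> (0 < g)%N ->
  let q := #|k| in
  #|affine_classes k (2 * g + 1)|%:R =
      2 * q%:R ^+ (2 * g - 1)%N
      + 2 * A1 q ((2 * g + 1)%N%:R / p%:R)
      + \sum_(m <- divisors (2 * g + 1)%N | (1 < m)%N)
          2 * (totient m)%:R *
          (if (m %| q - 1)%N then A2 q ((2 * g + 1) %/ m)%N else 0)
      + \sum_(m <- divisors (2 * g)%N | (1 < m)%N)
          2 * (totient m)%:R *
          (if (2 * m %| q - 1)%N then A2 q ((2 * g) %/ m)%N else 0)
      :> rat.
Proof.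
move=> kp oddp g0 q; have oq : odd q := odd_card kp oddp.
have pp : prime p by case/andP: kp.
have q1 : (1 < q)%N := finNzRing_gt1 k.
pose n := (2 * g + 1)%N; rewrite -/n.
have n1 : (1 < n)%N by rewrite /n; clear -g0; lia.
have en1 : n.-1 = (2 * g)%N by rewrite /n addn1.
have n0 : (0 < n)%N := ltnW n1.
have g20 : (0 < 2 * g)%N by rewrite muln_gt0.
have total := total_fixed_count kp n0 oq n1; rewrite en1 in total.
have qr : q%:R != 0 :> rat by rewrite pnatr_eq0 -lt0n ltnW.
have q1r : q%:R - 1 != 0 :> rat.
  by rewrite -(natrB rat (ltnW q1)) pnatr_eq0 -lt0n subn_gt0.
have predq : q.-1%:R = q%:R - 1 :> rat by rewrite -subn1 natrB // ltnW.
have Sn : (monic_count n (@separable k))%:R = (q%:R - 1) * (q%:R * q%:R ^+ (2 * g - 1)) :> rat.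
  have -> : n = (2 * g - 1).+2 by rewrite /n; clear -g0; lia.
  rewrite separable_count natrB ?natrX ?leq_exp2l // -exprS mulrBl mul1r -exprS //.
(* If [p] does not divide [n], then [n / p] is not a natural number and [A1] takes its default value
   0. *)
have Tn : (if (p %| n)%N then monic_count (n %/ p) (@separable k) else 0)%N%:R =
    q%:R * A1 q (n%:R / p%:R) :> rat.
  have p0 : p%:R != 0 :> rat by rewrite pnatr_eq0 -lt0n prime_gt0.
  case: ifPn => [/dvdnP[j ej]|pn].
    rewrite ej mulnK ?prime_gt0 // natrM mulfK // separable_count_A1 //.
    by move: n0; rewrite ej muln_gt0 => /andP[].
  rewrite /A1; case: ifP => [/andP[/natrP[j ej] _]|]; last by rewrite mulr0.
  case/negP: pn; apply/dvdnP; exists j; apply/eqP.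
  by rewrite -(eqr_nat rat) natrM -ej divfK.
have q2 : (2 %| q.-1)%N by rewrite dvdn2 -subn1 oddB // ?oq // ltnW.
(* Divisors of [2g + 1] are odd and [q - 1] is even. This is why only the second sum of the formula
   keeps the condition on [2m]. *)
have cA m : (m %| n)%N -> (2 * m %| q.-1)%N = (m %| q - 1)%N.
  move=> mn; have om : odd m by apply: dvdn_odd mn _; rewrite /n oddD mul2n odd_double.
  by rewrite Gauss_dvd ?coprime2n // q2 subn1.
have cB m : (m %| 2 * g)%N -> (2 * m %| q.-1)%N = (2 * m %| q - 1)%N by rewrite subn1.
have SumA := natr_sum_divisors n0 cA (fun j j0 => nonzero_count_A2 k j0).
have SumB := natr_sum_divisors g20 cB (fun j j0 => nonzero_count_A2 k j0).
have qq : (q%:R - 1) * q%:R != 0 :> rat by rewrite mulf_neq0.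
apply: (mulIf qq); move/(congr1 (fun i : nat => i%:R : rat)): total.
rewrite !natrM predq => ->.
rewrite ![in LHS](natrD, natrM) predq Sn Tn SumA SumB -/q.
by ring.
Qed.

(** * Valuations *)

(* all_classical shadows [point] of Defs. *)
From mathcomp Require Import all_classical.
Import Defs.

Local Open Scope classical_set_scope.
Local Open Scope ring_scope.

Local Notation "x %:F" := (@tofrac _ x) : ring_scope.

(** The last clause normalizes the value group to all of Z, so a valuation is determined away from 0
    by its valuation ring. *)
Definition valuation (K : fieldType) (v : K -> int) : Prop :=
  [/\ forall x y, x != 0 -> y != 0 -> v (x * y) = v x + v y,
      forall x y n, x != 0 -> y != 0 -> x + y != 0 ->
        n <= v x -> n <= v y -> n <= v (x + y)
    & exists t, t != 0 /\ v t = 1].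

(* The value of 0 is junk, so inequalities are stated with vge. *)
Definition vge (K : fieldType) (v : K -> int) (n : int) (z : K) : bool :=
  (z == 0) || (n <= v z).

Definition valring (K : fieldType) (v : K -> int) : set K :=
  [set z | vge v 0 z].

Section Valuation.
Variables (K : fieldType) (v : K -> int).
Hypothesis vP : valuation v.

Lemma valM x y : x != 0 -> y != 0 -> v (x * y) = v x + v y.
Proof. by case: vP => + _ _; apply. Qed.

Lemma val_uniformizer : exists t, t != 0 /\ v t = 1.
Proof. by case: vP. Qed.

Lemma val1 : v 1 = 0.
Proof.
have : v (1 * 1) = v 1 + v 1 by apply: valM; apply: oner_neq0.
by rewrite mulr1; lia.
Qed.

Lemma valV x : x != 0 -> v x^-1 = - v x.
Proof.
move=> x0; have := valM x0 (invr_neq0 x0); rewrite divff // val1; lia.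
Qed.

Lemma valX x n : x != 0 -> v (x ^+ n) = v x *+ n.
Proof.
move=> x0; elim: n => [|n IH]; first by rewrite expr0 val1.
by rewrite exprS mulrS valM ?expf_neq0 // IH.
Qed.

Lemma valXz x (n : int) : x != 0 -> v (x ^ n) = v x * n.
Proof.
move=> x0; case: n => n; first by rewrite valX // -mulr_natr; lia.
by rewrite NegzE -exprnN valV ?expf_neq0 // valX // -mulr_natr; lia.
Qed.

Lemma valN x : v (- x) = v x.
Proof.
have [->|x0] := eqVneq x 0; first by rewrite oppr0.
have N10 : -1 != 0 :> K by rewrite oppr_eq0 oner_neq0.
have H : v (-1) = 0.
  by have := valM N10 N10; rewrite mulrNN mulr1 val1; lia.
by rewrite -mulN1r valM // H add0r.
Qed.

Lemma vge0 n : vge v n 0. Proof. by rewrite /vge eqxx. Qed.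

Lemma vge_neq0 n z : z != 0 -> vge v n z = (n <= v z).
Proof. by rewrite /vge => /negbTE ->. Qed.

Lemma vgeW m n z : m <= n -> vge v n z -> vge v m z.
Proof. by rewrite /vge => mn /orP[->//|/(le_trans mn) ->]; rewrite orbT. Qed.

Lemma vgeN n z : vge v n (- z) = vge v n z.
Proof. by rewrite /vge oppr_eq0 valN. Qed.

Lemma vgeD n x y : vge v n x -> vge v n y -> vge v n (x + y).
Proof.
rewrite /vge.
have [->|x0 /= Hx] := eqVneq x 0; first by rewrite add0r.
have [->|y0 /= Hy] := eqVneq y 0; first by rewrite addr0 Hx orbT.
have [//|xy0] := eqVneq (x + y) 0.
by case: vP => _ + _ => ->.
Qed.

Lemma vgeB n x y : vge v n x -> vge v n y -> vge v n (x - y).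
Proof. by move=> Hx Hy; apply: vgeD; rewrite ?vgeN. Qed.

Lemma vgeM m n x y : vge v m x -> vge v n y -> vge v (m + n) (x * y).
Proof.
rewrite /vge mulf_eq0.
have [->|x0 /= Hx] := eqVneq x 0; first by [].
have [->|y0 /= Hy] := eqVneq y 0; first by [].
by rewrite valM // lerD.
Qed.

Lemma vgeM0l n x y : vge v 0 x -> vge v n y -> vge v n (x * y).
Proof. by move=> Hx Hy; rewrite -(add0r n); apply: vgeM. Qed.

Lemma vgeM0r n x y : vge v n x -> vge v 0 y -> vge v n (x * y).
Proof. by move=> Hx Hy; rewrite -(addr0 n); apply: vgeM. Qed.

Lemma vge_1 : vge v 0 1. Proof. by rewrite /vge val1 lexx orbT. Qed.

Lemma vgeX x n : vge v 0 x -> vge v 0 (x ^+ n).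
Proof.
move=> Hx; elim: n => [|n IH]; first by rewrite expr0 vge_1.
by rewrite exprS vgeM0l.
Qed.

Lemma vge_sum n I (r : seq I) (P : pred I) F :
  (forall i, P i -> vge v n (F i)) -> vge v n (\sum_(i <- r | P i) F i).
Proof. by move=> H; elim/big_ind: _ => //; [exact: vge0|exact: vgeD]. Qed.

Lemma vge_nat m : vge v 0 m%:R.
Proof.
elim: m => [|m IH]; first exact: vge0.
by rewrite mulrSr vgeD ?vge_1.
Qed.

Lemma vgeDl n x y : vge v n y -> vge v n (x + y) = vge v n x.
Proof.
move=> Hy; apply/idP/idP => H; last exact: vgeD.
by rewrite -(addrK y x) vgeB.
Qed.

Lemma vgeDr n x y : vge v n x -> vge v n (x + y) = vge v n y.
Proof. by rewrite addrC; apply: vgeDl. Qed.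

Lemma vgeBl n x y : vge v n y -> vge v n (x - y) = vge v n x.
Proof. by move=> H; rewrite vgeDl ?vgeN. Qed.

Lemma vgeBr n x y : vge v n x -> vge v n (x - y) = vge v n y.
Proof. by move=> H; rewrite vgeDr ?vgeN. Qed.

Lemma vge_mul_eq m x y : x != 0 -> vge v m (x * y) = vge v (m - v x) y.
Proof.
move=> x0; have [->|y0] := eqVneq y 0; first by rewrite mulr0 !vge0.
by rewrite !vge_neq0 ?mulf_neq0 // valM // lerBlDl.
Qed.

Lemma vge_unitM m x y : vge v 0 x -> ~~ vge v 1 x -> vge v m (x * y) = vge v m y.
Proof.
have [->|x0] := eqVneq x 0; first by rewrite !vge0.
rewrite (vge_mul_eq _ _ x0) !(vge_neq0 _ x0) => H1 H2.
by have -> : m - v x = m by lia.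
Qed.

Lemma vge1_prime x y : vge v 0 x -> vge v 0 y -> vge v 1 (x * y) ->
  vge v 1 x || vge v 1 y.
Proof.
move=> Hx Hy; have [//|Hx1] := boolP (vge v 1 x).
by rewrite vge_unitM.
Qed.

Lemma vge1X x n : vge v 0 x -> vge v 1 (x ^+ n) -> vge v 1 x.
Proof.
move=> Hx; elim: n => [|n IH].
  by rewrite expr0 {1}/vge oner_eq0 val1.
by rewrite exprS => /(vge1_prime Hx (vgeX n Hx)) /orP[].
Qed.

Lemma vge_sqr x : vge v 0 (x ^+ 2) = vge v 0 x.
Proof.
rewrite expr2; have [->|x0] := eqVneq x 0; first by rewrite mulr0.
by rewrite !vge_neq0 ?mulf_neq0 // valM //; lia.
Qed.

Lemma valD_lt x y : x != 0 -> ~~ vge v (v x + 1) x -> vge v (v x + 1) y ->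
  x + y != 0 /\ v (x + y) = v x.
Proof.
move=> x0 H1 H2; have H : ~~ vge v (v x + 1) (x + y) by rewrite vgeDl.
have xy0 : x + y != 0 by apply: contraNneq H => ->; rewrite vge0.
have H3 : vge v (v x) (x + y).
  apply: vgeD; first by rewrite vge_neq0.
  by apply: vgeW H2; lia.
by split=> //; move: H H3; rewrite !vge_neq0 //; lia.
Qed.

Lemma valD_ltr x y : x != 0 -> vge v (v x + 1) y -> x + y != 0 /\ v (x + y) = v x.
Proof. by move=> x0; apply: valD_lt => //; rewrite vge_neq0 //; lia. Qed.

Lemma val_eq0 x : vge v 0 x -> ~~ vge v 1 x -> x != 0 /\ v x = 0.
Proof.
move=> H1 H2; have x0 : x != 0 by apply: contraNneq H2 => ->; rewrite vge0.
by split=> //; move: H1 H2; rewrite !vge_neq0 //; lia.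
Qed.

Lemma val_div x y : x != 0 -> y != 0 -> v (x / y) = v x - v y.
Proof. by move=> x0 y0; rewrite valM ?invr_neq0 // valV. Qed.

Lemma val_assoc x y : x != 0 -> y != 0 -> vge v 0 (x / y) -> vge v 0 (y / x) ->
  v x = v y.
Proof.
move=> x0 y0; rewrite !vge_neq0 ?mulf_neq0 ?invr_neq0 // !val_div //; lia.
Qed.

End Valuation.

(** Discrete valuation rings are maximal subrings. If [w z >= 0 > v z], then for large [N] the
    element [u z^(-N)] lies in the ring of [v], hence of [w], so [w u >= 0] for every [u], which a
    uniformizer of [w] contradicts. Thus [w] is a multiple of [v], and normalization makes the
    factor 1. *)
Lemma valring_max (K : fieldType) (v w : K -> int) :
  valuation v -> valuation w -> valring v `<=` valring w ->
  forall z, z != 0 -> v z = w z.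
Proof.
move=> vP wP vw.
have wv (z : K) : z != 0 -> 0 <= w z -> 0 <= v z.
  move=> z0 wz; rewrite leNgt; apply/negP => vz.
  have H (u : K) : u != 0 -> 0 <= w u.
    move=> u0; set N := `|v u|%N.
    have Z0 : u * z ^- N != 0 by rewrite mulf_neq0 ?invr_neq0 ?expf_neq0.
    have := vw (u * z ^- N).
    rewrite /valring /= !vge_neq0 //.
    rewrite (valM vP) ?(valM wP) ?invr_neq0 ?expf_neq0 //.
    rewrite !valV ?expf_neq0 // !valX // -!mulNrn => H.
    have Nv : (- v z) *+ N >= N%:Z.
      have : 1 *+ N <= (- v z) *+ N by rewrite lerMn2r; apply/orP; right; lia.
      by rewrite natz.
    have Nw : w z *+ N >= 0 by rewrite mulrn_wge0.
    have : 0 <= w u + (- w z) *+ N by apply: H; lia.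
    by rewrite mulNrn; lia.
  have [t [t0 wt]] := val_uniformizer wP.
  have t'0 := invr_neq0 t0.
  by have := H _ t'0; rewrite (valV wP) // wt.
have [t [t0 vt]] := val_uniformizer vP.
have [r [r0 wr]] := val_uniformizer wP.
have vw0 (z : K) : z != 0 -> 0 <= v z -> 0 <= w z.
  by move=> z0 vz; have := vw z; rewrite /valring /= !vge_neq0 //; apply.
have uv (z : K) : z != 0 -> v z = 0 -> w z = 0.
  move=> z0 vz; have z'0 := invr_neq0 z0.
  have := vw0 _ z'0; have := vw0 _ z0; rewrite !valV // vz; lia.
have wE (z : K) : z != 0 -> w z = v z * w t.
  move=> z0; have Z0 : z * t ^ (- v z) != 0 by rewrite mulf_neq0 ?expfz_neq0.
  have := uv _ Z0; rewrite !valM ?expfz_neq0 // !valXz // vt mul1r subrr.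
  by move=> /(_ erefl) /eqP; rewrite mulrN subr_eq0 mulrC => /eqP.
have := wE _ r0; have := vw0 _ t0; rewrite vt wr => /(_ isT) wt H.
have wt1 : w t = 1.
  have : (w t %| 1)%Z by apply/dvdzP; exists (v r).
  by rewrite dvdz1; lia.
by move=> z z0; rewrite wE // wt1 mulr1.
Qed.

Lemma vge_comp (K L : fieldType) (phi : {rmorphism L -> K}) (w : K -> int) n z :
  vge (w \o phi) n z = vge w n (phi z).
Proof. by rewrite /vge /= fmorph_eq0. Qed.

Lemma valuation_comp (K L : fieldType) (phi : {rmorphism L -> K}) (w : K -> int) :
  valuation w -> (forall t, exists r, phi r = t) -> valuation (w \o phi).
Proof.
move=> wP surj; split=> [x z x0 z0|x z n x0 z0 xz0|] /=.
- by rewrite rmorphM valM ?fmorph_eq0.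
- by rewrite rmorphD; case: wP => _ + _; apply; rewrite -?rmorphD fmorph_eq0.
have [t [t0 wt]] := val_uniformizer wP; have [r er] := surj t; exists r.
by rewrite er -(fmorph_eq0 phi) er.
Qed.

Section PolynomialMorphism.
Variables (k K : fieldType) (w : K -> int) (phi : {rmorphism {poly k} -> K}).
Hypotheses (wP : valuation w) (wc : forall c, vge w 0 (phi c%:P)).

Lemma vge0_poly a : vge w 0 (phi 'X) -> vge w 0 (phi a).
Proof.
move=> wX; elim/poly_ind: a => [|a c IH]; first by rewrite rmorph0 vge0.
by rewrite rmorphD rmorphM vgeD // vgeM0l.
Qed.

(** If ['X] has a pole, the leading term strictly dominates the others. In particular the image of a
    nonzero polynomial is nonzero: a function with a pole is transcendental over [k]. *)
Lemma val_poly a : ~~ vge w 0 (phi 'X) -> a != 0 ->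
  phi a != 0 /\ w (phi a) = ((size a)%:Z - 1) * w (phi 'X).
Proof.
move=> wX; have X0 : phi 'X != 0 by apply: contraNneq wX => ->; rewrite vge0.
have wX1 : w (phi 'X) < 0 by move: wX; rewrite vge_neq0 // -ltNge.
elim/poly_ind: a => [|a c IH]; first by rewrite eqxx.
have [->|a0 _] := eqVneq a 0.
  rewrite mul0r add0r polyC_eq0 => c0; rewrite size_polyC c0 subrr mul0r.
  have C0 b : b != 0 -> phi b%:P != 0.
    by rewrite -[phi _]/((phi \o polyC) b) fmorph_eq0.
  have e : phi c^-1%:P = (phi c%:P)^-1.
    by rewrite -[phi _]/((phi \o polyC) c^-1) fmorphV.
  have := wc c^-1; have := wc c; rewrite e !vge_neq0 ?invr_eq0 ?C0 // valV ?C0 //.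
  by split=> //; lia.
have [p0 wa] := IH a0; have pX0 : phi a * phi 'X != 0 by rewrite mulf_neq0.
have wpX : w (phi a * phi 'X) = (size a)%:Z * w (phi 'X).
  by rewrite valM // wa mulrBl mul1r subrK.
rewrite size_MXaddC (negbTE a0) /= rmorphD rmorphM.
have H : vge w (w (phi a * phi 'X) + 1) (phi c%:P).
  apply: vgeW (wc c); rewrite wpX lezD1 nmulr_llt0 // ltz_nat size_poly_gt0 //.
have [n0 ->] := valD_ltr wP pX0 H; split=> //.
by rewrite wpX intS addrAC subrr add0r.
Qed.

End PolynomialMorphism.

(** [t ^ n] lies in [O] only for [n >= 0], so the exponent making [z * t ^ n] a unit is unique. The
    statement is about a bare field, so that it also serves to build valuations on k(x) and on its
    quadratic extensions. *)
Lemma dvr_valuation_uniformizer (K : fieldType) (O : set K) t :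
    O 1 -> (forall x y, O x -> O y -> O (x - y)) ->
    (forall x y, O x -> O y -> O (x * y)) -> t != 0 -> O t -> ~ O t^-1 ->
    (forall z, z != 0 -> exists n : int, O (z * t ^ n) /\ O (z * t ^ n)^-1) ->
  exists v, [/\ valuation v, O = valring v & v t = 1].
Proof.
move=> O1 OB OM t0 Ot nOt tP.
have O0 : O 0 by rewrite -(subrr 1); apply: OB.
have ON x : O x -> O (- x) by rewrite -sub0r; apply: OB.
have OD x y : O x -> O y -> O (x + y).
  by move=> Hx Hy; rewrite -(opprK y); apply/OB/ON.
have OX n : O (t ^+ n).
  by elim: n => [|n IH]; rewrite ?expr0 // exprS; apply: OM.
(* The exponent makes [z * t ^ n] a unit, so the value of [z] is the opposite of it. *)
pose w z : int := if pselect (z != 0) is left z0 then - projT1 (cid (tP z z0)) else 0.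
have wP z : z != 0 -> O (z * t ^ (- w z)) /\ O (z * t ^ (- w z))^-1.
  by rewrite /w; case: pselect => // z0 _; case: cid => n /= Hn; rewrite opprK.
have tz n : O (t ^ n) <-> 0 <= n.
  case: n => n; split=> //; first by move=> _; apply: OX.
  rewrite NegzE => H; case: nOt; have := OM _ _ H (OX n).
  by rewrite -exprnN exprS invfM mulrAC -mulrA divff ?expf_neq0 // mulr1.
have wO n z : z != 0 -> O (z * t ^ n) <-> - w z <= n.
  move=> z0; have [H1 H2] := wP z z0; split=> H.
    rewrite -subr_ge0; apply/tz; have := OM _ _ H H2.
    by rewrite invfM mulrACA divff // mul1r invr_expz -expfzDr.
  have /tz Hn : 0 <= n + w z by lia.
  by have := OM _ _ H1 Hn; rewrite -mulrA -expfzDr // addrCA addNr addr0.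
have wu n z : z != 0 -> O (z * t ^ n) -> O (z * t ^ n)^-1 -> w z = - n.
  move=> z0 /(wO _ _ z0) H1 H2; have := OM _ _ (wP z z0).1 H2.
  by rewrite invfM mulrACA divff // mul1r invr_expz -expfzDr // => /tz; lia.
have wt : w t = 1.
  rewrite (@wu (-1)) // -?exprnN ?expr1.
    by rewrite divff.
  by rewrite divff // invr1.
exists w; split=> //; last first.
  apply/seteqP; split=> z; rewrite /valring /= /vge.
    have [//|z0] := eqVneq z 0 => Oz /=.
    have /(wO 0 z z0) : O (z * t ^ 0) by rewrite expr0z mulr1.
    by lia.
  have [->//|z0 /=] := eqVneq z 0 => H.
  have /(wO 0 z z0) : - w z <= 0 by lia.
  by rewrite expr0z mulr1.
split=> [x y x0 y0|x y n x0 y0 xy0 nx ny|].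
- have [Hx Hx'] := wP x x0; have [Hy Hy'] := wP y y0.
  have e : x * y * t ^ (- w x - w y) = (x * t ^ (- w x)) * (y * t ^ (- w y)).
    by rewrite mulrACA -expfzDr.
  rewrite (@wu (- w x - w y)) ?mulf_neq0 //; [lia| |]; rewrite e ?invfM -?invfM.
    exact: OM.
  by rewrite invfM; apply: OM.
- have Hx : O (x * t ^ (- n)) by apply/wO => //; lia.
  have Hy : O (y * t ^ (- n)) by apply/wO => //; lia.
  by have := OD _ _ Hx Hy; rewrite -mulrDl => /(wO _ _ xy0); lia.
- by exists t.
Qed.

Section DvrValuation.
Variables (k : fieldType) (C : precurve k).
Implicit Types (O V : set (funfield C)) (v : funfield C -> int).

Lemma dvr_valuation O : discrete_valuation_ring O ->
  exists v, valuation v /\ O = valring v.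
Proof.
case=> Oc OB OM [t [t0 Ot nOt tP]].
have O1 : O 1 by rewrite -(rmorph1 (const C)).
by have [v [vP Ov _]] := dvr_valuation_uniformizer O1 OB OM t0 Ot nOt tP; exists v.
Qed.

Lemma valring_dvr v : valuation v -> (forall c, vge v 0 (const C c)) ->
  discrete_valuation_ring (valring v).
Proof.
move=> vP vc; split=> //; [by move=> x y; apply: vgeB|by move=> x y; apply: vgeM0l|].
have [t [t0 vt]] := val_uniformizer vP; exists t.
rewrite /valring /= !vge_neq0 ?invr_neq0 // valV // vt; split=> //.
move=> z z0; exists (- v z).
rewrite !vge_neq0 ?mulf_neq0 ?invr_neq0 ?mulf_neq0 ?expfz_neq0 //.
rewrite valV ?mulf_neq0 ?expfz_neq0 //.
by rewrite valM ?expfz_neq0 // valXz // vt mul1r subrr.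
Qed.

Lemma nonunits_valring v z : valuation v ->
  nonunits (valring v) z <-> vge v 1 z.
Proof.
move=> vP; rewrite /nonunits /valring /=.
have [->|z0] := eqVneq z 0; first by rewrite !vge0; split=> //; split=> //; left.
rewrite !vge_neq0 ?invr_neq0 // valV //; split.
  by case=> H1 [/eqP|]; [rewrite (negbTE z0)|lia].
by move=> H; split; [lia|right; lia].
Qed.

End DvrValuation.

Section Gauss.
Variables (K : fieldType) (v : K -> int).
Hypothesis vP : valuation v.

(* If A and B are the minimal valuations of the coefficients of p and q, each
   attained first at i and j, then the coefficient i + j of p * q has
   valuation exactly A + B. *)
Lemma gauss_monic (p q : {poly K}) : p \is monic -> q \is monic ->
  (forall i, vge v 0 (p * q)`_i) -> forall i, vge v 0 p`_i.
Proof.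
have first_min (r : {poly K}) : r \is monic -> exists (a : int) i,
    [/\ a <= 0, r`_i != 0, v r`_i = a, forall j, vge v a r`_j
      & forall j, (j < i)%N -> vge v (a + 1) r`_j].
  move=> rm.
  have rN0 : r`_(size r).-1 != 0.
    by rewrite -lead_coefE (monicP rm) oner_neq0.
  have sr : (0 < size r)%N by rewrite size_poly_gt0 monic_neq0.
  have sr' : ((size r).-1 < size r)%N by rewrite prednK.
  have [i Pi imin] := @arg_minP _ int _ (Ordinal sr') (fun i : 'I_(size r) => r`_i != 0) (fun i => v r`_i) rN0.
  have ge j : vge v (v r`_i) r`_j.
    have [jr|jr] := ltnP j (size r); last by rewrite [r`_j]nth_default // vge0.
    rewrite /vge; have [//|r0] := eqVneq r`_j 0 => /=.
    exact: (imin (Ordinal jr)).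
  have ex : exists j, (r`_j != 0) && (v r`_j == v r`_i).
    by exists i; rewrite Pi eqxx.
  case: (ex_minnP ex) => m /andP[m1 /eqP m2] mmin.
  exists (v r`_i), m; split=> //.
    have := ge (size r).-1; rewrite vge_neq0 // -lead_coefE (monicP rm).
    by rewrite val1.
  move=> j jm; have := ge j; rewrite /vge.
  have [//|r0 /=] := eqVneq r`_j 0 => H.
  have : ~~ (v r`_j == v r`_i).
    by apply/negP => /eqP e; have := mmin j; rewrite r0 e eqxx => /(_ isT); lia.
  by move=> ne; rewrite lezD1 lt_def ne H.
move=> pm qm pq n.
have [a [i [a0 pi vi pge plt]]] := first_min p pm.
have [b [j [b0 qj vj qge qlt]]] := first_min q qm.
suff : 0 <= a + b by move=> ab; apply: vgeW (pge n); lia.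
have ij : (i < (i + j).+1)%N by lia.
have := pq (i + j)%N; rewrite coefM (bigD1 (Ordinal ij)) //= addKn.
have H : v (p`_i * q`_j) = a + b by rewrite valM // vi vj.
have H0 : p`_i * q`_j != 0 by rewrite mulf_neq0.
set s := \sum_(_ < _ | _) _ => Hs.
have : vge v (v (p`_i * q`_j) + 1) s.
  apply: vge_sum => // m; rewrite -val_eqE /= => mi.
  have [mlt|mge] := ltnP m i.
    by rewrite H addrAC; apply: (vgeM vP) => //; apply: plt.
  have lm := ltn_ord m; move/eqP: mi => mi.
  rewrite H -addrA; apply: (vgeM vP) => //; apply: qlt; move: mi mge lm => /=; lia.
move=> /(valD_ltr vP H0) [n0 e].
by move: Hs; rewrite vge_neq0 // e H.
Qed.

End Gauss.

Section LiesOver.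
Variables (F K : fieldType) (s : {rmorphism F -> K}).

(** The ring of [w] dominates that of [v]; the ramification index is left open. *)
Definition lies_over (v : F -> int) (w : K -> int) : Prop :=
  forall z, (vge v 0 z -> vge w 0 (s z)) /\ (vge v 1 z -> vge w 1 (s z)).

Variables (v : F -> int) (w : K -> int).
Hypotheses (vP : valuation v) (wP : valuation w) (vw : lies_over v w).

(** [e] is the ramification index, that is, the value under [w] of a uniformizer [t] of [v]: the
    unit [z * t ^ (- v z)] goes to a unit. *)
Lemma lies_over_val z : z != 0 -> exists2 e, 0 < e & w (s z) = v z * e.
Proof.
move=> z0; have [t [t0 vt]] := val_uniformizer vP.
have st0 : s t != 0 by rewrite fmorph_eq0.
have sz0 : s z != 0 by rewrite fmorph_eq0.
exists (w (s t)).
  by have := (vw t).2; rewrite !vge_neq0 // vt; lia.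
have u0 : z * t ^ (- v z) != 0 by rewrite mulf_neq0 ?expfz_neq0.
have vu : v (z * t ^ (- v z)) = 0.
  by rewrite valM ?expfz_neq0 // valXz // vt mul1r subrr.
have u'0 := invr_neq0 u0.
have H1 := (vw (z * t ^ (- v z))).1; have H2 := (vw (z * t ^ (- v z))^-1).1.
move: H1 H2; rewrite !vge_neq0 ?fmorph_eq0 // (valV vP) // vu.
rewrite fmorphV (valV wP) ?fmorph_eq0 // rmorphM fmorphXz.
rewrite (valM wP) ?expfz_neq0 // valXz // mulrN [w (s t) * _]mulrC.
move=> /(_ isT) H1 /(_ isT) H2.
by lia.
Qed.

Lemma lies_over_vge n z : 0 <= n -> vge v n z -> vge w n (s z).
Proof.
move=> n0; have [->|z0] := eqVneq z 0; first by rewrite rmorph0 !vge0.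
have [e e0 we] := lies_over_val z0.
rewrite !vge_neq0 ?fmorph_eq0 // we => nv; apply: (le_trans nv).
by rewrite ler_peMr ?(le_trans n0 nv) //; lia.
Qed.

Lemma lies_over_vge0 z : vge w 0 (s z) = vge v 0 z.
Proof.
have [->|z0] := eqVneq z 0; first by rewrite rmorph0 !vge0.
have [e e0 we] := lies_over_val z0.
by rewrite !vge_neq0 ?fmorph_eq0 // we pmulr_lge0.
Qed.

Lemma lies_over_vge1 z : vge w 1 (s z) = vge v 1 z.
Proof.
have [->|z0] := eqVneq z 0; first by rewrite rmorph0 !vge0.
have [e e0 we] := lies_over_val z0.
by rewrite !vge_neq0 ?fmorph_eq0 // we -!gtz0_ge1 pmulr_lgt0.
Qed.

End LiesOver.

(** * Valuations of a quadratic extension *)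

Section Quadratic.
Variables (F K : fieldType) (s : {rmorphism F -> K}) (y : K) (D : F).
Hypotheses (yD : y ^+ 2 = s D) (yF : forall a, s a <> y)
  (span : forall z, exists a b, z = s a + s b * y).

Lemma span_inj a b c d : s a + s b * y = s c + s d * y -> a = c /\ b = d.
Proof.
move=> e; have e1 : s (a - c) = s (d - b) * y.
  by rewrite !rmorphB mulrBl; apply/eqP; rewrite subr_eq addrAC -subr_eq opprK addrC e addrC.
have [/eqP|db] := eqVneq (d - b) 0.
  rewrite subr_eq0 => /eqP db; move: e1; rewrite db subrr rmorph0 mul0r.
  by move/eqP; rewrite fmorph_eq0 subr_eq0 => /eqP.
case: (yF (a := (a - c) / (d - b))).
by rewrite rmorphM fmorphV e1 mulrAC divff ?mul1r // fmorph_eq0.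
Qed.

Lemma span_eq0 a b : s a + s b * y = 0 -> a = 0 /\ b = 0.
Proof. by move=> e; apply: span_inj; rewrite e rmorph0 mul0r addr0. Qed.

Lemma span_mul a b c d :
  (s a + s b * y) * (s c + s d * y) =
  s (a * c + b * d * D) + s (a * d + b * c) * y.
Proof. by rewrite !rmorphD !rmorphM -yD; ring. Qed.

Lemma nonsquare c : c ^+ 2 - D != 0.
Proof.
apply/negP => /eqP e; have : (y - s c) * (y + s c) = 0.
  by rewrite -subr_sqr yD -rmorphXn -rmorphB -opprB e oppr0 rmorph0.
move/eqP; rewrite mulf_eq0 subr_eq0 addr_eq0 => /orP[] /eqP H.
  by case: (yF (a := c)).
by case: (yF (a := - c)); rewrite rmorphN.
Qed.

Lemma norm_neq0 a b : s a + s b * y != 0 -> a ^+ 2 - b ^+ 2 * D != 0.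
Proof.
apply: contra_neq => e; have [b0|b0] := eqVneq b 0.
  move: e; rewrite b0 expr0n mul0r subr0 => /eqP; rewrite sqrf_eq0 => /eqP ->.
  by rewrite rmorph0 mul0r addr0.
suff : (a / b) ^+ 2 - D = 0 by move/eqP; rewrite (negbTE (nonsquare _)).
apply: (mulfI (expf_neq0 2 b0)).
by rewrite mulr0 mulrBr expr_div_n mulrCA divff ?mulr1 ?expf_neq0.
Qed.

(** Universal property of adjoining a square root of [D]. It provides both the conjugation
    [y |-> - y] and the isomorphism between two curves with the same equation. *)
Lemma quadratic_lift (L : fieldType) (r : {rmorphism F -> L}) x : x ^+ 2 = r D ->
  exists phi : {rmorphism K -> L}, forall a b, phi (s a + s b * y) = r a + r b * x.
Proof.
move=> xD.
pose f z := r (projT1 (cid (span z))) + r (projT1 (cid (projT2 (cid (span z))))) * x.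
have fE a b : f (s a + s b * y) = r a + r b * x.
  by rewrite /f; case: cid => a' /= H; case: cid => b' /= /span_inj[-> ->].
have fB : zmod_morphism f.
  move=> u z; have [a [b ->]] := span u; have [c [d ->]] := span z.
  have -> : s a + s b * y - (s c + s d * y) = s (a - c) + s (b - d) * y.
    by rewrite !rmorphB; ring.
  by rewrite !fE !rmorphB; ring.
have fM : monoid_morphism f.
  split=> [|u z].
    have -> : 1 = s 1 + s 0 * y by rewrite rmorph1 rmorph0 mul0r addr0.
    by rewrite fE rmorph1 rmorph0 mul0r addr0.
  have [a [b ->]] := span u; have [c [d ->]] := span z.
  by rewrite span_mul !fE !rmorphD !rmorphM -xD; ring.
pose A := GRing.isZmodMorphism.Build _ _ f fB.
pose M := GRing.isMonoidMorphism.Build _ _ f fM.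
by exists (HB.pack f A M : {rmorphism K -> L}).
Qed.

Variable v : F -> int.
Hypothesis vP : valuation v.
Hypothesis vD : vge v 0 D.

(** The ring [R[y]], with [R] the valuation ring of [v]. *)
Definition integral_span (z : K) : Prop :=
  exists a b, [/\ vge v 0 a, vge v 0 b & z = s a + s b * y].

Lemma integral_spanB x z : integral_span x -> integral_span z -> integral_span (x - z).
Proof.
move=> [a [b [Ha Hb ->]]] [c [d [Hc Hd ->]]]; exists (a - c), (b - d).
by rewrite !vgeB //; split=> //; rewrite !rmorphB; ring.
Qed.

Lemma integral_spanM x z : integral_span x -> integral_span z -> integral_span (x * z).
Proof.
move=> [a [b [Ha Hb ->]]] [c [d [Hc Hd ->]]].
exists (a * c + b * d * D), (a * d + b * c); rewrite span_mul; split=> //.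
  by rewrite vgeD ?vgeM0l.
by rewrite vgeD ?vgeM0l.
Qed.

Lemma integral_span_s a : vge v 0 a -> integral_span (s a).
Proof.
by move=> Ha; exists a, 0; rewrite rmorph0 mul0r addr0 vge0.
Qed.

Lemma integral_span_clear z : exists (c : F), [/\ c != 0, vge v 0 c & integral_span (s c * z)].
Proof.
have [t [t0 vt]] := val_uniformizer vP; have [a [b ->]] := span z.
have H e : exists n : nat, forall m, (n <= m)%N -> vge v 0 (t ^+ m * e).
  have [->|e0] := eqVneq e 0; first by exists 0%N => m _; rewrite mulr0 vge0.
  exists `|v e|%N => m Hm; rewrite vge_neq0 ?mulf_neq0 ?expf_neq0 // valM ?expf_neq0 //.
  by rewrite valX // vt -mulr_natr; lia.
have [n Hn] := H a; have [m Hm] := H b; exists (t ^+ (n + m)).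
rewrite expf_neq0 //; split=> //.
  by rewrite vge_neq0 ?expf_neq0 // valX // vt natz; lia.
exists (t ^+ (n + m) * a), (t ^+ (n + m) * b).
rewrite Hn ?leq_addr // Hm ?leq_addl //; split=> //.
by rewrite !rmorphM mulrDr mulrA.
Qed.

Lemma integral_span_vge w z : valuation w -> lies_over s v w ->
  integral_span z -> vge w 0 z.
Proof.
move=> wP vw [a [b [Ha Hb ->]]].
have wy : vge w 0 y by rewrite -vge_sqr // yD (lies_over_vge vP wP vw).
by rewrite vgeD // ?vgeM0l // (lies_over_vge vP wP vw).
Qed.

(** * Split and ramified places: [c^2 - D] has value 1 for some integral [c] *)

Section SplitOrRamified.
Variable c : F.
Hypotheses (vc : vge v 0 c) (vcD : v (c ^+ 2 - D) = 1).

Let t := y - s c.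

(* The complement of the principal prime ideal (y - c) of R[y]. *)
Let unit_span z := exists a b,
  [/\ vge v 0 a, vge v 0 b, z = s a + s b * y & ~~ vge v 1 (a + b * c)].

Let N := c ^+ 2 - D.

Let N0 : N != 0. Proof. exact: nonsquare. Qed.

Let tN : t * (y + s c) = - s N.
Proof. by rewrite /t -subr_sqr yD rmorphB rmorphXn opprB. Qed.

Let t0 : t != 0.
Proof.
by apply: contraTneq (N0) => t0; move/eqP: tN; rewrite t0 mul0r eq_sym oppr_eq0 fmorph_eq0 negbK.
Qed.

Let vN : vge v 1 N. Proof. by rewrite vge_neq0 // vcD. Qed.

Let div_N a : vge v 1 a -> exists2 a', vge v 0 a' & a = N * a'.
Proof.
move=> Ha; exists (N^-1 * a); last by rewrite mulrA divff ?mul1r.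
by rewrite vge_mul_eq ?invr_neq0 // valV // vcD.
Qed.

Let unit_span_neq0 z : unit_span z -> z != 0.
Proof.
move=> [a [b [_ _ -> H]]]; apply: contraNneq H => /span_eq0[-> ->].
by rewrite mul0r addr0 vge0.
Qed.

Let unit_spanW z : unit_span z -> integral_span z.
Proof. by case=> a [b [Ha Hb e _]]; exists a, b. Qed.

Let unit_spanM x z : unit_span x -> unit_span z -> unit_span (x * z).
Proof.
move=> [a [b [Ha Hb -> H1]]] [e [d [He Hd -> H2]]].
exists (a * e + b * d * D), (a * d + b * e); rewrite span_mul; split=> //.
- by rewrite vgeD ?vgeM0l.
- by rewrite vgeD ?vgeM0l.
have -> : a * e + b * d * D + (a * d + b * e) * c =
  (a + b * c) * (e + d * c) - b * d * N by rewrite /N; ring.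
rewrite vgeBl //; last by rewrite vgeM0l ?vgeM0l.
rewrite vge_unitM // vgeD ?vgeM0l //.
Qed.

Let unit_span1 : unit_span 1.
Proof.
exists 1, 0; rewrite vge0 vge_1 // rmorph1 rmorph0 !mul0r !addr0; split=> //.
by rewrite vge_neq0 ?oner_neq0 // val1.
Qed.

Let integral_spanP z : integral_span z ->
  unit_span z \/ exists2 z', integral_span z' & z = t * z'.
Proof.
move=> [a [b [Ha Hb ->]]].
have [H|H] := boolP (vge v 1 (a + b * c)); [right|by left; exists a, b].
have [a' Ha' e] := div_N H.
exists (s b - s a' * (y + s c)).
  apply: integral_spanB; first exact: integral_span_s.
  exists (a' * c), a'; rewrite vgeM0l //; split=> //.
  by rewrite rmorphM; ring.
have -> : a = N * a' - b * c by rewrite -e addrK.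
by rewrite mulrBr mulrCA tN /t rmorphB !rmorphM; ring.
Qed.

Let t_not_unit z : integral_span z -> ~ unit_span (t * z).
Proof.
move=> [a [b [Ha Hb ->]]] [e [d [He Hd E /negP]]]; apply.
have : t * (s a + s b * y) = s (b * D - c * a) + s (a - c * b) * y.
  by rewrite /t !rmorphB !rmorphM -yD; ring.
rewrite E => /span_inj[-> ->].
have -> : b * D - c * a + (a - c * b) * c = - b * N by rewrite /N; ring.
by rewrite vgeM0l // vgeN.
Qed.

(** Induction on the value of the norm: the norm of [t = y - s c] is [N = c^2 - D], of value 1, so
    each division by [t] lowers it by one, and it cannot become negative. *)
Let factor_integral z : integral_span z -> z != 0 ->
  exists n u, unit_span u /\ z = t ^+ n * u.
Proof.
move=> [a [b [Ha Hb ze]]] z0.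
have := norm_neq0; move/(_ a b); rewrite -ze => /(_ z0).
have [m] : exists m : nat, v (a ^+ 2 - b ^+ 2 * D) < m%:Z.
  by exists `|v (a ^+ 2 - b ^+ 2 * D)|.+1; move: (v _) => i; clear; lia.
elim: m a b Ha Hb z ze z0 => [|m IH] a b Ha Hb z ze z0 Hm n0.
  have : vge v 0 (a ^+ 2 - b ^+ 2 * D) by rewrite vgeB ?vgeM0l ?vgeX.
  by rewrite vge_neq0 // leNgt Hm.
have [U|] : unit_span z \/ exists2 z', integral_span z' & z = t * z'.
  by apply: integral_spanP; exists a, b.
  by exists 0%N, z; rewrite expr0 mul1r.
case=> z' [a' [b' [Ha' Hb' ez']]] ez.
have : s a + s b * y = s (b' * D - c * a') + s (a' - c * b') * y.
  by rewrite -ze ez ez' /t !rmorphB !rmorphM -yD; ring.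
case/span_inj => ea eb; move: n0 Hm.
have -> : a ^+ 2 - b ^+ 2 * D = N * (a' ^+ 2 - b' ^+ 2 * D).
  by rewrite ea eb /N; ring.
rewrite mulf_eq0 (negbTE N0) /= => n0; rewrite valM // vcD => H.
have z'0 : z' != 0 by apply: contraNneq z0 => z'0; rewrite ez z'0 mulr0.
rewrite intS ltrD2l in H.
have [n [u [uU eu]]] := IH _ _ Ha' Hb' z' ez' z'0 H n0.
by exists n.+1, u; rewrite exprS -mulrA -eu.
Qed.

Let factor z : z != 0 ->
  exists (n : int) u1 u2, [/\ unit_span u1, unit_span u2 & z = t ^ n * (u1 / u2)].
Proof.
move=> z0; have [d [d0 vd Hd]] := integral_span_clear z.
have sd0 : s d != 0 by rewrite fmorph_eq0.
have [n [u1 [U1 e1]]] := factor_integral Hd (mulf_neq0 sd0 z0).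
have [m [u2 [U2 e2]]] := factor_integral (integral_span_s vd) sd0.
exists (n%:Z - m%:Z), u1, u2; split=> //.
have -> : z = (t ^+ n * u1) / (t ^+ m * u2).
  by rewrite -e1 -e2 mulrAC divff ?mul1r.
by rewrite expfzDr // -exprnN invfM mulrACA.
Qed.

(** The valuation ring is the localization of [R[y]] at the prime ideal generated by [y - s c], and
    this generator is a uniformizer by [factor]. *)
Lemma split_ramified_exists : exists w,
  [/\ valuation w, lies_over s v w & vge w 1 (y - s c)].
Proof.
pose O : set K := [set z | exists b u, [/\ integral_span b, unit_span u & z = b / u]].
have int1 : integral_span 1 by apply: unit_spanW.
have Os a : vge v 0 a -> O (s a).
  by move=> Ha; exists (s a), 1; rewrite divr1; split=> //; apply: integral_span_s.
have intt : integral_span t.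
  exists (- c), 1; rewrite rmorph1 rmorphN mul1r addrC vgeN // vge_1 //.
have OM x z : O x -> O z -> O (x * z).
  move=> [b [u [Hb Hu ->]]] [b' [u' [Hb' Hu' ->]]].
  exists (b * b'), (u * u'); rewrite invfM mulrACA; split=> //.
    exact: integral_spanM.
  exact: unit_spanM.
have [|||||w [wP wO wt]] := @dvr_valuation_uniformizer K O t _ _ OM t0.
- by exists 1, 1; rewrite divr1.
- move=> x z [b [u [Hb Hu ->]]] [b' [u' [Hb' Hu' ->]]].
  exists (b * u' - b' * u), (u * u'); split; [|exact: unit_spanM|].
    by apply: integral_spanB; apply: integral_spanM => //; apply: unit_spanW.
  by rewrite -mulNr addf_div ?unit_span_neq0 // mulNr.
- by exists t, 1; rewrite divr1.
- move=> [b [u [Hb Hu e]]]; apply: (t_not_unit Hb).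
  suff -> : t * b = u by [].
  have u0 := unit_span_neq0 Hu; apply: (mulIf (invr_neq0 u0)).
  by rewrite -mulrA -e !divff.
- move=> z z0; have [n [u1 [u2 [H1 H2 e]]]] := factor z0.
  exists (- n); rewrite e mulrAC -expfzDr // subrr expr0z mul1r invf_div.
  by split; [exists u1, u2|exists u2, u1]; split=> //; apply: unit_spanW.
exists w; split=> // [a|]; last by rewrite vge_neq0 // wt.
split=> [/Os|/div_N[a' /Os Ha' ->]]; first by rewrite wO.
have -> : s (N * a') = t * (- (y + s c) * s a').
  by rewrite rmorphM -[s N]opprK -tN mulrA mulrN.
rewrite -[1]addr0; apply: vgeM => //; first by rewrite vge_neq0 ?wt.
have : O (- (y + s c) * s a').
  apply: OM => //; exists (- (y + s c)), 1; rewrite divr1; split=> //.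
  exists (- c), (-1); rewrite vgeN // vgeN // vge_1 // !rmorphN rmorph1.
  by split=> //; ring.
by rewrite wO.
Qed.

(** Since [a + b y = (a + b c) + b (y - c)], every element of [unit_span] has value 0 as soon as
    [y - c] has positive value. Factorization then determines the valuation up to the value of
    [y - c], which normalization makes 1. *)
Lemma split_ramified_unique w w' :
  valuation w -> lies_over s v w -> vge w 1 (y - s c) ->
  valuation w' -> lies_over s v w' -> vge w' 1 (y - s c) ->
  w (y - s c) = 1 /\ forall z, z != 0 -> w z = w' z.
Proof.
have key u : valuation u -> lies_over s v u -> vge u 1 t ->
    u t = 1 /\ forall n u1 u2, unit_span u1 -> unit_span u2 ->
    u (t ^ n * (u1 / u2)) = n.
  move=> uP vu ut.
  have uU z : unit_span z -> u z = 0.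
    move=> [a [b [Ha Hb -> H]]].
    have -> : s a + s b * y = s (a + b * c) + s b * t.
      by rewrite /t rmorphD rmorphM; ring.
    have H0 : vge u 0 (s (a + b * c)) by rewrite (lies_over_vge0 vP uP vu) // vgeD ?vgeM0l.
    have H1 : ~~ vge u 1 (s (a + b * c)) by rewrite (lies_over_vge1 vP uP vu).
    have [n0 e] := val_eq0 H0 H1.
    have H2 : vge u (u (s (a + b * c)) + 1) (s b * t).
      by rewrite e vgeM0l // (lies_over_vge0 vP uP vu).
    by have [_ ->] := valD_ltr uP n0 H2.
  have H n u1 u2 : unit_span u1 -> unit_span u2 ->
      u (t ^ n * (u1 / u2)) = u t * n.
    move=> U1 U2; have n1 := unit_span_neq0 U1; have n2 := unit_span_neq0 U2.
    rewrite valM ?expfz_neq0 ?mulf_neq0 ?invr_neq0 // valM ?invr_neq0 //.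
    rewrite valV // (uU u1) // (uU u2) // valXz //. ring.
  have ut1 : u t = 1.
    have [r [r0 ur]] := val_uniformizer uP.
    have [n [u1 [u2 [U1 U2 e]]]] := factor r0.
    move: ur; rewrite e H // => ur.
    have : (u t %| 1)%Z by apply/dvdzP; exists n; rewrite mulrC ur.
    by move: ut; rewrite vge_neq0 // dvdz1; lia.
  by split=> // n u1 u2 U1 U2; rewrite H // ut1 mul1r.
move=> wP vw wt w'P vw' w't.
have [wt1 Hw] := key w wP vw wt; have [_ Hw'] := key w' w'P vw' w't.
split=> // z /factor[n [u1 [u2 [U1 U2 ->]]]].
by rewrite Hw ?Hw'.
Qed.

End SplitOrRamified.

(** * Inert places: [D] is not a square in the residue field *)

Section Inert.
Hypothesis inert : forall c, vge v 0 c -> ~~ vge v 1 (c ^+ 2 - D).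

(** If [b] is a unit, the norm is [b ^+ 2] times [(a / b) ^+ 2 - D], a unit by hypothesis. Otherwise
    [a] is a unit and its square dominates. *)
Let norm_unit a b : vge v 0 a -> vge v 0 b -> ~~ (vge v 1 a && vge v 1 b) ->
  ~~ vge v 1 (a ^+ 2 - b ^+ 2 * D).
Proof.
move=> Ha Hb; have [H1|H1 _] := boolP (vge v 1 b).
  rewrite andbT => H2; rewrite vgeBl //; last first.
    by rewrite vgeM0r // expr2 vgeM0r.
  by apply: contra H2 => /(vge1X vP Ha).
have b0 : b != 0 by apply: contraNneq H1 => ->; rewrite vge0.
have [_ vb] := val_eq0 Hb H1.
have -> : a ^+ 2 - b ^+ 2 * D = b ^+ 2 * ((a / b) ^+ 2 - D) by field.
rewrite vge_unitM ?vgeX //; last by apply: contra H1 => /(vge1X vP Hb).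
by apply: inert; rewrite mulrC vge_mul_eq ?invr_neq0 // valV // vb.
Qed.

Let factor z : z != 0 -> forall t, t != 0 -> v t = 1 -> exists (n : int) a b,
  [/\ vge v 0 a, vge v 0 b, ~~ (vge v 1 a && vge v 1 b)
    & z = s t ^ n * (s a + s b * y)].
Proof.
move=> z0 t t0 vt; have [a [b e]] := span z.
have st0 : s t != 0 by rewrite fmorph_eq0.
have shift0 n r : vge v 0 (r * t ^ (- n)) = vge v n r.
  by rewrite mulrC vge_mul_eq ?expfz_neq0 // valXz // vt mul1r sub0r opprK.
have shift1 n r : vge v 1 (r * t ^ (- n)) = vge v (n + 1) r.
  by rewrite mulrC vge_mul_eq ?expfz_neq0 // valXz // vt mul1r opprK addrC.
suff [n [Ha Hb H]] : exists n, [/\ vge v n a, vge v n b & ~~ (vge v (n + 1) a && vge v (n + 1) b)].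
  exists n, (a * t ^ (- n)), (b * t ^ (- n)); rewrite !shift0 !shift1; split=> //.
  have E : s t ^ n * s t ^ (- n) = 1 by rewrite -expfzDr // subrr expr0z.
  rewrite !rmorphM !fmorphXz; move: E; move: (_ ^ n) (_ ^ (- n)) => T T' E.
  have -> : T * (s a * T' + s b * T' * y) = T * T' * (s a + s b * y) by ring.
  by rewrite E mul1r.
have [a0|a0] := eqVneq a 0.
  have b0 : b != 0.
    by apply: contraNneq z0 => b0; rewrite e a0 b0 rmorph0 mul0r addr0.
  by exists (v b); rewrite a0 !vge0 !vge_neq0 //; split=> //; lia.
have [b0|b0] := eqVneq b 0.
  by exists (v a); rewrite b0 !vge0 !vge_neq0 // andbT; split=> //; lia.
by exists (Num.min (v a) (v b)); rewrite !vge_neq0 //; split; lia.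
Qed.

Let unit_sum_val w a b : valuation w -> lies_over s v w ->
  vge v 0 a -> vge v 0 b -> ~~ (vge v 1 a && vge v 1 b) ->
  s a + s b * y != 0 /\ w (s a + s b * y) = 0.
Proof.
move=> wP vw Ha Hb /(norm_unit Ha Hb) H.
have B0 : vge w 0 (s a + s b * y) by apply: integral_span_vge => //; exists a, b.
apply: val_eq0 => //; apply: contra H => H1.
have : vge w 1 ((s a + s b * y) * (s a + s (- b) * y)).
  apply: vgeM0r => //; apply: integral_span_vge => //.
  by exists a, (- b); rewrite vgeN.
rewrite span_mul.
have -> : a * - b + b * a = 0 by ring.
rewrite rmorph0 mul0r addr0 (lies_over_vge1 vP wP vw) //.
by have -> : a * a + b * - b * D = a ^+ 2 - b ^+ 2 * D by ring.
Qed.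

(** Up to a power of a uniformizer of [v], every nonzero element has integral coefficients and a
    norm of value 0, and such elements have value 0 at any place above [v]. Normalization fixes the
    value of the uniformizer. *)
Lemma inert_unique w w' : valuation w -> lies_over s v w ->
  valuation w' -> lies_over s v w' ->
  (forall t, t != 0 -> v t = 1 -> w (s t) = 1) /\ forall z, z != 0 -> w z = w' z.
Proof.
have key u : valuation u -> lies_over s v u -> forall t, t != 0 -> v t = 1 ->
   u (s t) = 1.
  move=> uP vu t t0 vt; have st0 : s t != 0 by rewrite fmorph_eq0.
  have [r [r0 ur]] := val_uniformizer uP.
  have [n [a [b [Ha Hb H e]]]] := factor r0 t0 vt.
  have [n0 e0] := unit_sum_val uP vu Ha Hb H.
  move: ur; rewrite e valM ?expfz_neq0 // e0 addr0 valXz // => ur.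
  have : (u (s t) %| 1)%Z by apply/dvdzP; exists n; rewrite mulrC ur.
  by have := (vu t).2; rewrite !vge_neq0 // vt dvdz1; lia.
move=> wP vw w'P vw'; split; first exact: key.
have [t [t0 vt]] := val_uniformizer vP => z z0.
have st0 : s t != 0 by rewrite fmorph_eq0.
have [n [a [b [Ha Hb H e]]]] := factor z0 t0 vt.
have [n0 e0] := unit_sum_val wP vw Ha Hb H.
have [_ e0'] := unit_sum_val w'P vw' Ha Hb H.
by rewrite e !valM ?expfz_neq0 // e0 e0' !valXz // (key w) // (key w').
Qed.

(** Here [R[y]] is itself the valuation ring, with the uniformizer of [v]; an element of unit norm
    has its conjugate divided by the norm as inverse. *)
Lemma inert_exists : exists w, valuation w /\ lies_over s v w.
Proof.
have [t [t0 vt]] := val_uniformizer vP.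
have st0 : s t != 0 by rewrite fmorph_eq0.
have [|||||||w [wP wO wt]] := @dvr_valuation_uniformizer K integral_span (s t).
- by rewrite -(rmorph1 s); apply/integral_span_s/vge_1.
- exact: integral_spanB.
- exact: integral_spanM.
- exact: st0.
- by apply: integral_span_s; rewrite vge_neq0 // vt.
- move=> [a [b [Ha _ e]]].
  have : s (t^-1) + s 0 * y = s a + s b * y.
    by rewrite -e fmorphV rmorph0 mul0r addr0.
  move/span_inj => [e' _]; move: Ha; rewrite -e'.
  by rewrite vge_neq0 ?invr_neq0 // valV // vt.
- move=> z z0; have [n [a [b [Ha Hb H e]]]] := factor z0 t0 vt.
  have H1 := norm_unit Ha Hb H; exists (- n).
  rewrite e mulrAC -expfzDr // subrr expr0z mul1r.
  have H0 : vge v 0 (a ^+ 2 - b ^+ 2 * D) by rewrite vgeB ?vgeM0l ?vgeX.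
  have [n0 vn] := val_eq0 H0 H1.
  set N := a ^+ 2 - b ^+ 2 * D in n0 vn.
  split; first by exists a, b.
  exists (a / N), (- b / N).
  rewrite ![_ / N]mulrC !vge_mul_eq ?invr_neq0 // valV // vn vgeN //.
  split=> //.
  have sN0 : s N != 0 by rewrite fmorph_eq0.
  have E : (s a + s b * y) * (s a + s (- b) * y) = s N.
    rewrite span_mul; have -> : a * - b + b * a = 0 by ring.
    by rewrite rmorph0 mul0r addr0; congr (s _); rewrite /N; ring.
  have z'0 : s a + s b * y != 0.
    by apply: contraNneq sN0 => z'0; rewrite -E z'0 mul0r.
  apply: (mulfI z'0); rewrite divff // !rmorphM fmorphV.
  by rewrite -mulrA -mulrDr mulrCA E mulVf.
exists w; split=> // a; split.
  by move/integral_span_s; rewrite wO.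
have [->|a0] := eqVneq a 0; first by rewrite rmorph0 !vge0.
move=> Ha; have -> : a = t * (t^-1 * a) by rewrite mulrA divff ?mul1r.
rewrite rmorphM -[1]addr0; apply: vgeM => //; first by rewrite vge_neq0 // wt.
have : integral_span (s (t^-1 * a)).
  by apply: integral_span_s; rewrite vge_mul_eq ?invr_neq0 // valV // vt.
by rewrite wO.
Qed.

End Inert.

(** * All quadratic cases, with 2 a unit and [D] of value 0 or 1 *)

Hypothesis two_unit : ~~ vge v 1 2.
Hypothesis vD01 : v D = 0 \/ v D = 1.

Let D0 : D != 0.
Proof. by have := nonsquare 0; rewrite expr0n sub0r oppr_eq0. Qed.

Let n2 : (2 : F) != 0.
Proof. by apply: contraNneq two_unit => ->; rewrite vge0. Qed.

(* If v(c^2 - D) >= 2, then c + t works for a uniformizer t, as 2c is a unit. *)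
Lemma quadratic_cases :
  (exists2 c, vge v 0 c & v (c ^+ 2 - D) = 1)
  \/ (forall c, vge v 0 c -> ~~ vge v 1 (c ^+ 2 - D)).
Proof.
have [t [t0 vt]] := val_uniformizer vP.
case: vD01 => vD0; last first.
  by left; exists 0; rewrite ?vge0 // expr0n sub0r valN.
have [[c [Hc Hc1]]|H] := pselect (exists c, vge v 0 c /\ vge v 1 (c ^+ 2 - D)); last first.
  right=> c Hc; apply/negP => H1; apply: H.
  by exists c.
left; have [e|ne] := eqVneq (v (c ^+ 2 - D)) 1; first by exists c.
have H2 : vge v (1 + 1) (c ^+ 2 - D).
  by move: Hc1; rewrite !vge_neq0 ?nonsquare //; lia.
have c1 : ~~ vge v 1 c.
  apply/negP => c1; have : vge v 1 D.
    by rewrite -[D](subKr (c ^+ 2)) vgeB // expr2 vgeM0l.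
  by rewrite vge_neq0 // vD0.
have [c0 vc0] := val_eq0 Hc c1.
have v20 : v 2 = 0.
  by have := val_eq0 (vge_nat vP 2) two_unit; case.
have tct : 2 * t * c != 0 by rewrite !mulf_neq0.
have vct : v (2 * t * c) = 1.
  by rewrite !valM ?mulf_neq0 // v20 vt vc0.
exists (c + t); first by rewrite vgeD // vge_neq0 // vt.
have -> : (c + t) ^+ 2 - D = 2 * t * c + ((c ^+ 2 - D) + t * t) by ring.
have H : vge v (v (2 * t * c) + 1) (c ^+ 2 - D + t * t).
  by rewrite vct vgeD // vgeM // vge_neq0 // vt.
by have [_ ->] := valD_ltr vP tct H.
Qed.

Lemma quadratic_exists : exists w, valuation w /\ lies_over s v w.
Proof.
have [[c Hc e]|H] := quadratic_cases; last exact: inert_exists.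
by have [w [wP vw _]] := split_ramified_exists Hc e; exists w.
Qed.

Let split_factor w c : valuation w -> lies_over s v w -> vge v 0 c ->
  v (c ^+ 2 - D) = 1 -> vge w 1 (y - s c) || vge w 1 (y + s c).
Proof.
move=> wP vw Hc e.
have y0 : vge w 0 y by rewrite -vge_sqr // yD; apply: (vw _).1.
have Hsc : vge w 0 (s c) by apply: (vw _).1.
apply: (vge1_prime wP); [exact: vgeB|exact: vgeD|].
rewrite -subr_sqr yD -rmorphXn -rmorphB -opprB rmorphN vgeN //.
by apply: (vw _).2; rewrite vge_neq0 ?nonsquare // e.
Qed.

Let split_sign w c : valuation w -> lies_over s v w -> vge v 0 c ->
  v (c ^+ 2 - D) = 1 -> exists c', [/\ vge v 0 c', v (c' ^+ 2 - D) = 1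
    & vge w 1 (y - s c')].
Proof.
move=> wP vw Hc e.
have /orP[H|H] := split_factor wP vw Hc e; first by exists c.
by exists (- c); rewrite vgeN // rmorphN opprK sqrrN.
Qed.

(** In the split case [c] is a unit because [D] is. The factors [y - c] and [y + c] of [D - c^2]
    differ by the unit [2c], so only one vanishes at [w], and [c^2 - D] has value 1 under both [v]
    and [w]. *)
Lemma quadratic_unramified w t : valuation w -> lies_over s v w -> v D = 0 ->
  t != 0 -> v t = 1 -> w (s t) = 1.
Proof.
move=> wP vw vD0 t0 vt.
have [[c0 Hc0 e0]|H] := quadratic_cases; last first.
  by have [-> //] := inert_unique H wP vw wP vw.
have [c [Hc e Hw]] := split_sign wP vw Hc0 e0.
have [wt _] := split_ramified_unique Hc e wP vw Hw wP vw Hw.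
have c1 : ~~ vge v 1 c.
  apply/negP => c1; have : vge v 1 D.
    rewrite -[D](subKr (c ^+ 2)) vgeB //; first by rewrite expr2 vgeM0l.
    by rewrite vge_neq0 ?nonsquare // e.
  by rewrite vge_neq0 // vD0.
have N0 := nonsquare c.
have E : s (c ^+ 2 - D) = - ((y - s c) * (y + s c)).
  by rewrite -subr_sqr yD -rmorphXn -rmorphB -opprB rmorphN.
have sN0 : s (c ^+ 2 - D) != 0 by rewrite fmorph_eq0.
have /norP[z1 z2] : ~~ ((y - s c == 0) || (y + s c == 0)).
  by rewrite -mulf_eq0 -oppr_eq0 -E.
have w2 : w (y + s c) = 0.
  have -> : y + s c = (y - s c) + s (2 * c) by rewrite rmorphM rmorph_nat; ring.
  have sc1 : ~~ vge w 1 (s (2 * c)).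
    by rewrite (lies_over_vge1 vP wP vw) vge_unitM // vge_nat.
  have sc0 : vge w 0 (s (2 * c)) by apply: (vw _).1; rewrite vgeM0l // vge_nat.
  have [sc20 wsc] := val_eq0 sc0 sc1.
  have H : vge w (w (s (2 * c)) + 1) (y - s c) by rewrite wsc.
  by rewrite addrC; have [_ ->] := valD_ltr wP sc20 H.
have : w (s (c ^+ 2 - D)) = 1 by rewrite E valN // valM // wt w2.
have sq0 : (c ^+ 2 - D) / t != 0 by rewrite mulf_neq0 ?invr_neq0.
have [r'' r''0] := lies_over_val vP wP vw sq0.
rewrite valM ?invr_neq0 // valV // e vt subrr mul0r rmorphM fmorphV.
rewrite valM ?invr_neq0 ?fmorph_eq0 // valV ?fmorph_eq0 //.
by move=> /eqP; rewrite subr_eq0 => /eqP ->.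
Qed.

(** An element congruent to 1 at [w] and to 0 at any other place above [v], the local input of
    strong approximation. In the split case it is [(y + c) / (2c)], as [y] reduces to [c] at [w] and
    to [- c] at the other place; in the inert and ramified cases [w] is alone and 1 will do. *)
Lemma quadratic_separate w : valuation w -> lies_over s v w ->
  exists a b, [/\ vge v 0 a, vge v 0 b, vge w 1 (s a + s b * y - 1)
    & forall w', valuation w' -> lies_over s v w' ->
      (forall z, z != 0 -> w z = w' z) \/
      vge w' 1 (s a + s b * y) /\ forall t, t != 0 -> v t = 1 -> w' (s t) = 1].
Proof.
move=> wP vw.
have one : (forall w', valuation w' -> lies_over s v w' ->
      (forall z, z != 0 -> w z = w' z)) ->
  exists a b, [/\ vge v 0 a, vge v 0 b, vge w 1 (s a + s b * y - 1)
    & forall w', valuation w' -> lies_over s v w' ->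
      (forall z, z != 0 -> w z = w' z) \/
      vge w' 1 (s a + s b * y) /\ forall t, t != 0 -> v t = 1 -> w' (s t) = 1].
  move=> H; exists 1, 0.
  rewrite vge_1 // vge0 rmorph1 rmorph0 mul0r addr0 subrr vge0.
  by split=> // w' w'P vw'; left; apply: H.
have [[c0 Hc0 e0]|H] := quadratic_cases; last first.
  by apply: one => w' w'P vw'; have [_] := inert_unique H wP vw w'P vw'.
have [c [Hc e Hw]] := split_sign wP vw Hc0 e0.
have key w' : valuation w' -> lies_over s v w' ->
    (forall z, z != 0 -> w z = w' z) \/ vge w' 1 (y + s c).
  move=> w'P vw'; have /orP[Hw'|] := split_factor w'P vw' Hc e; last by right.
  by left; have [_] := split_ramified_unique Hc e wP vw Hw w'P vw' Hw'.
have [c1|c1] := boolP (vge v 1 c).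
  apply: one => w' w'P vw'; have [//|Hw'] := key w' w'P vw'.
  have : vge w' 1 (y - s c).
    have -> : y - s c = (y + s c) - s (2 * c) by rewrite rmorphM rmorph_nat; ring.
    by rewrite vgeB //; apply: (vw' _).2; rewrite vgeM0l // vge_nat.
  by move=> /(split_ramified_unique Hc e wP vw Hw w'P vw')[].
have c2 : ~~ vge v 1 (2 * c) by rewrite vge_unitM // vge_nat.
have c20 : vge v 0 (2 * c) by rewrite vgeM0l // vge_nat.
have [n0 e2] := val_eq0 c20 c2.
have sn0 : s (2 * c) != 0 by rewrite fmorph_eq0.
have Vn : vge v 0 (2 * c)^-1 by rewrite vge_neq0 ?invr_neq0 // valV // e2.
exists (c / (2 * c)), (2 * c)^-1; rewrite vgeM0l //.
have E : s (c / (2 * c)) + s (2 * c)^-1 * y = s (2 * c)^-1 * (y + s c).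
  by rewrite rmorphM; ring.
split=> //.
  rewrite E; have -> : s (2 * c)^-1 * (y + s c) - 1 = s (2 * c)^-1 * (y - s c).
    have : s (2 * c)^-1 * s (2 * c) = 1 by rewrite -rmorphM mulVf // rmorph1.
    move: (s (2 * c)^-1) => r; rewrite rmorphM rmorph_nat => <-; ring.
  by rewrite vgeM0l //; apply: (vw _).1.
move=> w' w'P vw'; have [H|H] := key w' w'P vw'; [by left|right].
split; first by rewrite E vgeM0l //; apply: (vw' _).1.
move=> t t0 vt; apply: quadratic_unramified => //.
have : ~~ vge v 1 (c ^+ 2 - (c ^+ 2 - D)).
  rewrite vgeBl //; last by rewrite vge_neq0 ?nonsquare // e.
  by rewrite expr2 vge_unitM.
by rewrite subKr vge_neq0 //; case: vD01 => ->.
Qed.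

(** Apply the hypothesis to a place [w] and to its conjugate: the sum [2a] and the difference [2by]
    are integral at [w]. Then [b ^+ 2 * D] is integral, and [v D <= 1] leaves no room for a pole of
    [b]. *)
Lemma quadratic_integral a b :
  (forall w, valuation w -> lies_over s v w -> vge w 0 (s a + s b * y)) ->
  vge v 0 a /\ vge v 0 b.
Proof.
move=> H; have [w [wP vw]] := quadratic_exists.
have [sig sigE'] := @quadratic_lift _ s (- y) (etrans (sqrrN y) yD).
have sigE c d : sig (s c + s d * y) = s c - s d * y by rewrite sigE' mulrN.
have sig_s c : sig (s c) = s c.
  by have := sigE c 0; rewrite rmorph0 mul0r addr0 subr0.
have wP' : valuation (w \o sig).
  apply: valuation_comp => // z; have [c [d ->]] := span z.
  by exists (s c + s (- d) * y); rewrite sigE rmorphN mulNr opprK.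
have vw' : lies_over s v (w \o sig) by move=> z; rewrite !vge_comp !sig_s; apply: vw.
have H1 := H w wP vw; have := H _ wP' vw'; rewrite vge_comp sigE => H2.
have two x : vge v 0 (2 * x) = vge v 0 x by rewrite vge_unitM // vge_nat.
split.
  have := vgeD wP H1 H2; rewrite addrACA subrr addr0 -mulr2n -mulr_natl.
  by rewrite -(rmorph_nat s) -rmorphM (lies_over_vge0 vP wP vw) two.
have := vgeB wP H1 H2.
have -> : s a + s b * y - (s a - s b * y) = s (2 * b) * y.
  by rewrite rmorphM rmorph_nat; ring.
rewrite -vge_sqr // exprMn yD -rmorphXn -rmorphM (lies_over_vge0 vP wP vw).
rewrite exprMn -mulrA vge_unitM; [|by []|exact/vgeX/vge_nat|]; last first.
  by apply: contra two_unit => /(vge1X vP (vge_nat vP 2)).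
have [->|b0] := eqVneq b 0; first by rewrite !vge0.
rewrite !vge_neq0 ?mulf_neq0 ?expf_neq0 // valM ?expf_neq0 // valX //.
by case: vD01 => ->; lia.
Qed.

End Quadratic.

Lemma frac_quotient (R : idomainType) (z : {fraction R}) :
  exists a b : R, b != 0 /\ z = a%:F / b%:F.
Proof.
elim/quotW: z => r; exists \n_r, \d_r; split; first exact: denom_ratioP.
have d0 : (\d_r)%:F != 0 :> {fraction R} by rewrite tofrac_eq0 denom_ratioP.
apply: (mulIf d0); rewrite divfK //; unlock tofrac.
rewrite -[LHS]FracField.pi_mul; apply/eqmodP.
rewrite /= FracField.equivfE /FracField.mulf /=.
rewrite !numden_Ratio ?mulf_neq0 ?denom_ratioP ?oner_eq0 //.
by rewrite !mulr1 mulrC.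
Qed.

(** * The projective line *)

Lemma frac_sub (R : idomainType) (a b c d : R) : b != 0 -> d != 0 ->
  a%:F / b%:F - c%:F / d%:F = (a * d - c * b)%:F / (b * d)%:F :> {fraction R}.
Proof.
move=> b0 d0; rewrite -mulNr addf_div ?tofrac_eq0 //.
by rewrite -tofracN -!tofracM -tofracD mulNr.
Qed.

Section FracLift.
Variables (R : idomainType) (K : fieldType) (phi : {rmorphism R -> K}).

Definition frac_lift (z : {fraction R}) : K :=
  phi (projT1 (cid (frac_quotient z))) /
  phi (projT1 (cid (projT2 (cid (frac_quotient z))))).

Hypothesis phi_neq0 : forall a, a != 0 -> phi a != 0.

Lemma frac_liftE a b : b != 0 -> frac_lift (a%:F / b%:F) = phi a / phi b.
Proof.
move=> b0; rewrite /frac_lift; case: cid => c /= H; case: cid => d /= [d0 e].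
have := phi_neq0 b0; have := phi_neq0 d0.
have /eqP : a%:F * d%:F = c%:F * b%:F :> {fraction R}.
  have b0' : b%:F != 0 :> {fraction R} by rewrite tofrac_eq0.
  have d0' : d%:F != 0 :> {fraction R} by rewrite tofrac_eq0.
  by move/eqP: e; rewrite eqr_div // => /eqP.
rewrite -!tofracM tofrac_eq => /eqP ad pd pb.
by apply/eqP; rewrite eqr_div // -!rmorphM ad.
Qed.

Lemma frac_lift_zmod_morphism : zmod_morphism frac_lift.
Proof.
move=> x z; have [a [b [b0 ->]]] := frac_quotient x.
have [c [d [d0 ->]]] := frac_quotient z.
rewrite frac_sub //.
rewrite !frac_liftE ?mulf_neq0 // -[- (phi c / _)]mulNr addf_div ?phi_neq0 //.
by rewrite rmorphB !rmorphM mulNr.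
Qed.

Lemma frac_lift_monoid_morphism : monoid_morphism frac_lift.
Proof.
split=> [|x z].
  have -> : 1 = 1%:F / 1%:F :> {fraction R} by rewrite tofrac1 divr1.
  by rewrite frac_liftE ?oner_neq0 // rmorph1 divr1.
have [a [b [b0 ->]]] := frac_quotient x.
have [c [d [d0 ->]]] := frac_quotient z.
rewrite mulf_div -!tofracM !frac_liftE ?mulf_neq0 //.
by rewrite !rmorphM mulf_div.
Qed.

Lemma frac_lift_exists :
  exists s : {rmorphism {fraction R} -> K}, forall a, s a%:F = phi a.
Proof.
pose A := GRing.isZmodMorphism.Build _ _ _ frac_lift_zmod_morphism.
pose M := GRing.isMonoidMorphism.Build _ _ _ frac_lift_monoid_morphism.
pose s : {rmorphism {fraction R} -> K} := HB.pack frac_lift A M.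
exists s => a; have -> : a%:F = a%:F / 1%:F :> {fraction R} by rewrite tofrac1 divr1.
by rewrite /s /= frac_liftE ?oner_neq0 // rmorph1 divr1.
Qed.

End FracLift.

Lemma quotient_cancel (K : fieldType) (a b x z : K) : a != 0 -> b != 0 -> z != 0 ->
  a * x * (b^-1 / z) * (b / a) = x / z.
Proof. by move=> a0 b0 z0; field; rewrite z0 a0 b0. Qed.

Section Line.
Variable k : fieldType.
Local Notation F := {fraction {poly k}}.
Implicit Types (a b d p : {poly k}) (z : F).

Lemma frac_polyP a b c d : b != 0 -> d != 0 ->
  a%:F / b%:F = c%:F / d%:F :> F -> a * d = c * b.
Proof.
move=> b0 d0 /eqP; rewrite eqr_div ?tofrac_eq0 // -!tofracM tofrac_eq.
by move=> /eqP.
Qed.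

Lemma irreducible_prime p a b : irreducible_poly p -> p %| a * b ->
  (p %| a) || (p %| b).
Proof.
move=> pI; have [//|pa] := boolP (p %| a) => /=.
by rewrite Gauss_dvdpr // irreducible_poly_coprime.
Qed.

Lemma factor_out p a : irreducible_poly p -> a != 0 ->
  exists m b, a = p ^+ m * b /\ ~~ (p %| b).
Proof.
move=> pI; have [n] := ubnP (size a); elim: n a => // n IH a sa a0.
have [/dvdpP[b e]|pa] := boolP (p %| a); last first.
  by exists 0%N, a; rewrite expr0 mul1r.
have b0 : b != 0 by apply: contraNneq a0 => b0; rewrite e b0 mul0r.
have p0 := irredp_neq0 pI.
have [|//|m [c [e' H]]] := IH b.
  move: sa; rewrite e size_mul //; case: pI => + _; move: (size p) (size b).
  by move=> [|[|sp]] sb //= _; lia.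
by exists m.+1, c; rewrite exprSr mulrAC -e' -e.
Qed.

Lemma irreducible_factor a : (1 < size a)%N ->
  exists p, [/\ p \is monic, irreducible_poly p & p %| a].
Proof.
have [n] := ubnP (size a); elim: n a => // n IH a sa a1.
have a0 : a != 0 by rewrite -size_poly_gt0; lia.
have [H|H] := pselect (exists b, [/\ size b != 1%N, b %| a & ~~ (b %= a)]).
  have [b [b1 ba nba]] := H.
  have b0 : b != 0 by apply: contraNneq a0 => b0; move: ba; rewrite b0 dvd0p.
  have sb : (0 < size b)%N by rewrite size_poly_gt0.
  have : (size b < size a)%N.
    by rewrite ltn_neqAle (dvdp_leq a0 ba) andbT dvdp_size_eqp.
  move=> ba'; have [||p [pm pI pb]] := IH b; [lia|lia|].
  by exists p; split=> //; apply: dvdp_trans ba.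
have l0 : (lead_coef a)^-1 != 0 by rewrite invr_eq0 lead_coef_eq0.
exists ((lead_coef a)^-1 *: a); split.
- by rewrite monicE lead_coefZ mulVf // lead_coef_eq0.
- split; first by rewrite size_scale.
  move=> b b1; rewrite dvdpZr // => ba.
  by rewrite (eqp_rtrans (eqp_scale _ l0)); apply: contra_notT H => nb; exists b.
- by rewrite dvdpZl.
Qed.

Definition P1_uniformizer (Q : P1_point k) : F :=
  match Q with Some p => (sval p)%:F | None => ('X%:F)^-1 end.

Definition is_P1_valuation (Q : P1_point k) (v : F -> int) :=
  [/\ valuation v, P1_stalk Q = valring v & v (P1_uniformizer Q) = 1].

(** At infinity the exponent is a difference of degrees; at [p] it is the difference of the
    multiplicities of [p] in numerator and denominator. *)
Lemma P1_valuation (Q : P1_point k) : exists v, is_P1_valuation Q v.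
Proof.
case: Q => [[p [pm pI]]|]; rewrite /is_P1_valuation /=; last first.
  have X0 : 'X%:F != 0 :> F by rewrite tofrac_eq0 polyX_eq0.
  set O := [set z | _].
  have [|||||||v H] := @dvr_valuation_uniformizer _ O ('X%:F)^-1; last by exists v.
  - by exists 1, 1; rewrite oner_neq0 divr1 tofrac1.
  - move=> _ _ [a [b [b0 ab ->]]] [c [d [d0 cd ->]]].
    exists (a * d - c * b), (b * d); rewrite mulf_neq0 //; split=> //.
      apply: leq_trans (size_polyD _ _) _; rewrite size_polyN geq_max.
      rewrite [size (b * d)]size_mul //; apply/andP; split.
        by apply: leq_trans (size_polyMleq _ _) _; rewrite -!subn1 leq_sub2r // leq_add2r.
      apply: leq_trans (size_polyMleq _ _) _.
      by rewrite -!subn1 leq_sub2r // [(size b + _)%N]addnC leq_add2r.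
    by rewrite frac_sub.
  - move=> _ _ [a [b [b0 ab ->]]] [c [d [d0 cd ->]]].
    exists (a * c), (b * d); rewrite mulf_neq0 //; split=> //; last first.
      by rewrite mulf_div !tofracM.
    rewrite [size (b * d)]size_mul //.
    apply: leq_trans (size_polyMleq _ _) _.
    by rewrite -!subn1 leq_sub2r // leq_add.
  - by rewrite invr_eq0.
  - by exists 1, 'X; rewrite polyX_eq0 size_poly1 size_polyX tofrac1 mul1r.
  - rewrite invrK => -[a [b [b0 ab]]]; rewrite -[LHS]divr1 -tofrac1.
    move=> /frac_polyP; rewrite oner_neq0 => /(_ isT b0) e.
    by move: ab; rewrite -[a]mulr1 -e mulrC size_mulX // ltnn.
  - move=> z; have [a [b [b0 ->]]] := frac_quotient z.
    rewrite mulf_eq0 invr_eq0 !tofrac_eq0 negb_or => /andP[a0 _].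
    have HO n m (e f : {poly k}) : e != 0 -> f != 0 -> (size e + n = size f + m)%N ->
        O (e%:F / f%:F * ('X%:F) ^+ n / ('X%:F) ^+ m).
      move=> e0 f0 H; exists (e * 'X^n), (f * 'X^m).
      rewrite mulf_neq0 ?expf_neq0 ?polyX_eq0 //; split=> //.
        by rewrite !size_mulXn // [(n + _)%N]addnC H [(m + _)%N]addnC.
      by rewrite !tofracM !tofracXn invfM mulrACA mulrA.
    have [ab|ba] := leqP (size a) (size b).
      exists (- (size b - size a)%N%:Z).
      rewrite exprz_inv opprK -exprnP; split.
        by have := @HO (size b - size a)%N 0%N a b a0 b0; rewrite expr0 divr1; apply; rewrite addn0 subnKC // ltnW.
      have := @HO 0%N (size b - size a)%N b a b0 a0.
      by rewrite expr0 mulr1 !invfM invrK [_^-1 * b%:F]mulrC; apply; rewrite addn0 subnKC // ltnW.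
    exists (size a - size b)%N%:Z; rewrite exprz_inv -exprnN; split.
      by have := @HO 0%N (size a - size b)%N a b a0 b0; rewrite expr0 mulr1; apply; rewrite addn0 subnKC // ltnW.
    have := @HO (size a - size b)%N 0%N b a b0 a0.
    by rewrite expr0 divr1 !invfM !invrK [_^-1 * b%:F]mulrC; apply; rewrite addn0 subnKC // ltnW.
have p0 : p != 0 := irredp_neq0 pI.
have pF0 : p%:F != 0 :> F by rewrite tofrac_eq0.
have nz b : ~~ (p %| b) -> b != 0 by apply: contraNneq => ->; rewrite dvdp0.
have npM b d : ~~ (p %| b) -> ~~ (p %| d) -> ~~ (p %| b * d).
  by move=> pb pd; apply/negP => /(irreducible_prime pI); rewrite (negbTE pb) (negbTE pd).
have np1 : ~~ (p %| 1).
  by rewrite dvdp1; case: pI => + _; case: (size p) => [|[]].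
set O := [set z | _].
have [|||||||v H] := @dvr_valuation_uniformizer _ O p%:F; last by exists v.
- by exists 1, 1; rewrite divr1 tofrac1.
- move=> _ _ [a [b [b0 ->]]] [c [d [d0 ->]]].
  exists (a * d - c * b), (b * d); rewrite npM //; split=> //.
  exact: (frac_sub _ _ (nz _ b0) (nz _ d0)).
- move=> _ _ [a [b [b0 ->]]] [c [d [d0 ->]]].
  by exists (a * c), (b * d); rewrite npM // mulf_div !tofracM.
- exact: pF0.
- by exists p, 1; rewrite tofrac1 divr1.
- move=> [a [b [b0 e]]].
  have : 1%:F / p%:F = a%:F / b%:F :> F by rewrite -e tofrac1 mul1r.
  by move/frac_polyP => /(_ p0 (nz _ b0)); rewrite mul1r => e'; move: b0; rewrite e' dvdp_mull.
- move=> z; have [a [b [b0 ->]]] := frac_quotient z.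
  rewrite mulf_eq0 invr_eq0 !tofrac_eq0 negb_or => /andP[a0 _].
  have [m [a' [ea pa]]] := factor_out pI a0.
  have [l [b' [eb pb]]] := factor_out pI b0.
  exists (l%:Z - m%:Z).
  have -> : a%:F / b%:F * p%:F ^ (l%:Z - m%:Z) = a'%:F / b'%:F.
    rewrite expfzDr // -exprnN -exprnP ea eb !tofracM !tofracXn invfM.
    by apply: quotient_cancel; rewrite ?expf_neq0 ?tofrac_eq0 ?(nz _ pb).
  by rewrite invf_div; split; [exists a', b'|exists b', a'].
Qed.

Lemma P1_stalkP Q v z : is_P1_valuation Q v -> P1_stalk Q z <-> vge v 0 z.
Proof. by case=> _ ->. Qed.

Lemma P1_valuation_const Q v c : is_P1_valuation Q v -> vge v 0 c%:P%:F.
Proof.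
move=> /P1_stalkP <-; case: Q => [[p [pm pI]]|] /=.
  exists c%:P, 1; rewrite tofrac1 divr1 dvdp1; split=> //.
  by case: pI => + _; case: (size p) => [|[]].
by exists c%:P, 1; rewrite oner_neq0 tofrac1 divr1 size_poly1 size_polyC leq_b1.
Qed.

Section FinitePoint.
Variables (p : {poly k}) (pP : p \is monic /\ irreducible_poly p).
Variable v : F -> int.
Hypothesis pv : is_P1_valuation (Some (exist _ p pP)) v.

Let vP : valuation v. Proof. by case: pv. Qed.
Let pI : irreducible_poly p. Proof. by case: pP. Qed.

Lemma finite_vgeP z : vge v 0 z <-> exists a b, ~~ (p %| b) /\ z = a%:F / b%:F.
Proof. by rewrite -(P1_stalkP z pv). Qed.

Lemma finite_vge0 a : vge v 0 a%:F.
Proof.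
apply/finite_vgeP; exists a, 1; rewrite tofrac1 divr1 dvdp1; split=> //.
by case: pI => + _; case: (size p) => [|[]].
Qed.

Lemma finite_val_prime : v p%:F = 1. Proof. by case: pv. Qed.

Lemma finite_vge1 a : vge v 1 a%:F = (p %| a).
Proof.
have [/dvdpP[b ->]|pa] := boolP (p %| a).
  rewrite tofracM vgeM0l ?finite_vge0 // vge_neq0 ?finite_val_prime //.
  by rewrite tofrac_eq0 irredp_neq0.
apply/negbTE/negP; have a0 : a != 0 by apply: contraNneq pa => ->; rewrite dvdp0.
have : vge v 0 (a%:F)^-1 by apply/finite_vgeP; exists 1, a; rewrite tofrac1 mul1r.
by rewrite !vge_neq0 ?invr_eq0 ?tofrac_eq0 // valV ?tofrac_eq0 //; lia.
Qed.

(** Polynomials represent all residue classes, because a denominator prime to [p] has an inverse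
    modulo [p] by Bezout. *)
Lemma finite_residue z : vge v 0 z -> exists a, vge v 1 (z - a%:F).
Proof.
move/finite_vgeP => [a [b [pb ->]]].
have /Bezout_eq1_coprimepP[[u w] /= e] : coprimep b p.
  by rewrite coprimep_sym irreducible_poly_coprime.
have b0 : b%:F != 0 :> F.
  by rewrite tofrac_eq0; apply: contraNneq pb => ->; rewrite dvdp0.
exists (a * u).
have -> : a%:F / b%:F - (a * u)%:F = (a * w * p)%:F / b%:F.
  apply: (mulIf b0); rewrite mulrBl !divfK // -tofracM -tofracB; congr _%:F.
  by rewrite -[a in X in X - _]mulr1 -e mulrDr !mulrA addrAC subrr add0r.
rewrite vgeM0r //; first by rewrite finite_vge1 dvdp_mull.
by apply/finite_vgeP; exists 1, b; rewrite tofrac1 mul1r.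
Qed.

Lemma finite_val_sqfree D : D != 0 -> coprimep D D^`() -> v D%:F = 0 \/ v D%:F = 1.
Proof.
move=> D0 DD'.
have DF0 : D%:F != 0 :> F by rewrite tofrac_eq0.
have [/dvdpP[E e]|pD] := boolP (p %| D); last first.
  by left; have [] := val_eq0 (finite_vge0 D); rewrite ?finite_vge1.
have pE : ~~ (p %| E).
  apply/negP => /dvdpP[G e'].
  have : p ^+ 2 %| D by rewrite e e' -mulrA dvdp_mulIr.
  by move/(square_dvd_separable DD') => sp; case: pI; rewrite sp.
right; rewrite e tofracM valM ?tofrac_eq0 ?(irredp_neq0 pI) //; last first.
  by apply: contraNneq pE => ->; rewrite dvdp0.
rewrite finite_val_prime; have [] := val_eq0 (finite_vge0 E); rewrite ?finite_vge1 //.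
by move=> _ ->.
Qed.

Lemma finite_lies_over (K : fieldType) (s : {rmorphism F -> K}) w :
  valuation w -> (forall c, vge w 0 (s c%:P%:F)) -> vge w 0 (s 'X%:F) ->
  vge w 1 (s p%:F) -> lies_over s v w.
Proof.
move=> wP wc wX wp.
have w0 a : vge w 0 (s a%:F) := vge0_poly (phi := (s \o (@tofrac {poly k}))%FUN) wP wc a wX.
have wb b : ~~ (p %| b) -> vge w 0 (s (b%:F)^-1).
  move=> pb; have /Bezout_eq1_coprimepP[[u t] /= e] : coprimep b p.
    by rewrite coprimep_sym irreducible_poly_coprime.
  have b0 : b%:F != 0 :> F.
    by rewrite tofrac_eq0; apply: contraNneq pb => ->; rewrite dvdp0.
  have wb1 : ~~ vge w 1 (s b%:F).
    apply/negP => H; have : vge w 1 (s (u * b + t * p)%:F).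
      by rewrite tofracD !tofracM rmorphD !rmorphM vgeD // vgeM0l.
    by rewrite e tofrac1 rmorph1 vge_neq0 ?oner_neq0 // val1.
  have [n0 wb0] := val_eq0 (w0 b) wb1.
  by rewrite fmorphV vge_neq0 ?invr_eq0 // valV // wb0.
move=> z; split.
  by move/finite_vgeP => [a [b [pb ->]]]; rewrite rmorphM vgeM0l ?wb.
have pF0 : p%:F != 0 :> F by rewrite tofrac_eq0 irredp_neq0.
move=> Hz; have : vge v 0 (p%:F^-1 * z).
  by rewrite vge_mul_eq ?invr_neq0 // valV // finite_val_prime.
move/finite_vgeP => [a [b [pb e]]].
have -> : z = p%:F * (a%:F / b%:F) by rewrite -e mulrA divff // mul1r.
by rewrite !rmorphM vgeM0r // vgeM0l ?wb.
Qed.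

End FinitePoint.

Section InfinitePoint.
Variable v : F -> int.
Hypothesis pv : is_P1_valuation None v.

Let vP : valuation v. Proof. by case: pv. Qed.

Let X0 : 'X%:F != 0 :> F.
Proof. by rewrite tofrac_eq0 polyX_eq0. Qed.

Lemma infinite_vgeP z : vge v 0 z <->
  exists a b, [/\ b != 0, (size a <= size b)%N & z = a%:F / b%:F].
Proof. by rewrite -(P1_stalkP z pv). Qed.

Lemma infinite_val_X : v 'X%:F = -1.
Proof. by case: pv => _ _ /=; rewrite valV // => /eqP; rewrite eqr_oppLR => /eqP. Qed.

(** [size a] is the degree plus one, so the value is minus the degree. *)
Lemma infinite_val a : a != 0 -> v a%:F = 1 - (size a)%:Z.
Proof.
move=> a0; have aF0 : a%:F != 0 :> F by rewrite tofrac_eq0.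
have Xn0 : ('X^((size a).-1))%:F != 0 :> F.
  by rewrite tofrac_eq0 expf_neq0 ?polyX_eq0.
have sa : (size a).-1.+1 = size a by rewrite prednK // size_poly_gt0.
have H1 : vge v 0 (a%:F / ('X^((size a).-1))%:F).
  apply/infinite_vgeP; exists a, 'X^((size a).-1).
  by rewrite expf_neq0 ?polyX_eq0 // size_polyXn sa.
have H2 : vge v 0 (('X^((size a).-1))%:F / a%:F).
  apply/infinite_vgeP; exists 'X^((size a).-1), a.
  by rewrite a0 size_polyXn sa.
rewrite (val_assoc vP aF0 Xn0 H1 H2) tofracXn (valX vP _ X0) infinite_val_X.
by rewrite mulNrn -[in RHS]sa; lia.
Qed.

Lemma infinite_lies_over (K : fieldType) (s : {rmorphism F -> K}) w :
  valuation w -> (forall c, vge w 0 (s c%:P%:F)) -> ~~ vge w 0 (s 'X%:F) ->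
  lies_over s v w.
Proof.
move=> wP wc wX.
have sX0 : s 'X%:F != 0 by rewrite fmorph_eq0.
have wX1 : w (s 'X%:F) < 0 by move: wX; rewrite vge_neq0 // -ltNge.
set e := - w (s 'X%:F); have e0 : 0 < e by rewrite /e; lia.
have wpoly a : a != 0 -> w (s a%:F) = (1 - (size a)%:Z) * e.
  pose phi : {rmorphism {poly k} -> K} := (s \o (@tofrac {poly k}))%FUN.
  move=> a0; have [_ /= ->] := val_poly (phi := phi) wP wc wX a0.
  by rewrite /e mulrN -mulNr opprB.
move=> z; have [->|z0] := eqVneq z 0; first by rewrite rmorph0 !vge0.
suff E : w (s z) = v z * e.
  by rewrite !vge_neq0 ?fmorph_eq0 // E -!gtz0_ge1 pmulr_lge0 // pmulr_lgt0.
have [a [b [b0 e']]] := frac_quotient z; move: z0; rewrite e'.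
rewrite mulf_eq0 invr_eq0 !tofrac_eq0 negb_or => /andP[a0 _].
have aF0 : a%:F != 0 :> F by rewrite tofrac_eq0.
have bF0 : b%:F != 0 :> F by rewrite tofrac_eq0.
rewrite (val_div vP aF0 bF0) (fmorph_div s a%:F b%:F).
have saF0 : s a%:F != 0 by rewrite fmorph_eq0 tofrac_eq0.
have sbF0 : s b%:F != 0 by rewrite fmorph_eq0 tofrac_eq0.
rewrite (val_div wP saF0 sbF0) (wpoly a a0) (wpoly b b0).
rewrite (infinite_val a0) (infinite_val b0) -mulrBl.
reflexivity.
Qed.

End InfinitePoint.

(** An irreducible factor of the denominator in lowest terms would give a pole. *)
Lemma polynomial_fraction z :
  (forall p (pP : p \is monic /\ irreducible_poly p) v,
    is_P1_valuation (Some (exist _ p pP)) v -> vge v 0 z) ->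
  exists a, z = a%:F.
Proof.
move=> H; have [a [b [b0 e]]] := frac_quotient z.
pose g := gcdp a b.
have g0 : g != 0 by rewrite gcdp_eq0 (negbTE b0) andbF.
have ea : a = (a %/ g) * g by rewrite divpK // dvdp_gcdl.
have eb : b = (b %/ g) * g by rewrite divpK // dvdp_gcdr.
have b'0 : b %/ g != 0 by apply: contraNneq b0 => b'0; rewrite eb b'0 mul0r.
have ez : z = (a %/ g)%:F / (b %/ g)%:F.
  apply/eqP; rewrite e eqr_div ?tofrac_eq0 // -!tofracM tofrac_eq.
  by rewrite [in X in X == _]ea [in X in _ == X]eb; apply/eqP; rewrite mulrAC mulrA.
have cop : coprimep (a %/ g) (b %/ g) by apply: coprimep_div_gcd; rewrite b0 orbT.
have [sb|sb] := leqP (size (b %/ g)) 1.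
  have [c ec] : exists c, b %/ g = c%:P by exists (b %/ g)`_0; apply: size1_polyC.
  have c0 : c != 0 by apply: contraNneq b'0 => c0; rewrite ec c0.
  exists (c^-1 *: (a %/ g)); rewrite ez ec -mul_polyC tofracM mulrC; congr (_ * _).
  have cF0 : c%:P%:F != 0 :> F by rewrite tofrac_eq0 polyC_eq0.
  by apply: (mulfI cF0); rewrite divff // -tofracM -polyCM divff // tofrac1.
have [p [pm pI pb]] := irreducible_factor sb.
have [v pv] := P1_valuation (Some (exist _ p (conj pm pI))).
have /(finite_vgeP pv)[c [d [pd e2]]] := H _ _ _ pv.
have d0 : d != 0 by apply: contraNneq pd => ->; rewrite dvdp0.
have : p %| (a %/ g) * d.
  by move: e2; rewrite ez => /(frac_polyP b'0 d0) ->; rewrite dvdp_mull.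
move/(irreducible_prime pI); rewrite (negbTE pd) orbF => pa.
have := coprimep_dvdr pa (coprimep_dvdl pb cop).
by rewrite coprimepp => /eqP sp; case: (pI); rewrite sp.
Qed.

(** If ['X] has a pole, [w] lies over infinity. Otherwise some numerator or denominator has positive
    value, and by induction on the degree so has one of its irreducible factors. *)
Lemma place_lies_over (K : fieldType) (s : {rmorphism F -> K}) w :
  valuation w -> (forall c, vge w 0 (s c%:P%:F)) ->
  (exists2 z, z != 0 & w (s z) != 0) ->
  exists Q v, is_P1_valuation Q v /\ lies_over s v w.
Proof.
move=> wP wc [z z0 wz].
have [wX|wX] := boolP (vge w 0 (s 'X%:F)); last first.
  have [v pv] := P1_valuation None; exists None, v.
  by split=> //; apply: infinite_lies_over.
have w0 a : vge w 0 (s a%:F) := vge0_poly (phi := (s \o (@tofrac {poly k}))%FUN) wP wc a wX.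
have [a a0 wa] : exists2 a, a != 0 & vge w 1 (s a%:F).
  have [a [b [b0 e]]] := frac_quotient z.
  have a0 : a != 0 by apply: contraNneq z0 => a0; rewrite e a0 tofrac0 mul0r.
  have [H|H] := boolP (vge w 1 (s a%:F)); first by exists a.
  have [H'|H'] := boolP (vge w 1 (s b%:F)); first by exists b.
  have [a1 e1] := val_eq0 (w0 a) H; have [b1 e2] := val_eq0 (w0 b) H'.
  by case/eqP: wz; rewrite e (fmorph_div s a%:F b%:F) (val_div wP a1 b1) e1 e2 subrr.
have [n] := ubnP (size a); elim: n a a0 wa => // n IH a a0 wa sa.
have a1 : (1 < size a)%N.
  rewrite ltnNge; apply/negP => /size1_polyC ea.
  move: wa a0; rewrite ea polyC_eq0; move: (a`_0) => c wa c0.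
  have : vge w 1 (s c%:P%:F * s c^-1%:P%:F) by rewrite vgeM0r.
  rewrite -rmorphM -tofracM -polyCM divff // tofrac1 rmorph1.
  by rewrite vge_neq0 ?oner_neq0 // val1.
have [p [pm pI /dvdpP[b e]]] := irreducible_factor a1.
have [wp|wp] := boolP (vge w 1 (s p%:F)).
  have [v pv] := P1_valuation (Some (exist _ p (conj pm pI))).
  exists (Some (exist _ p (conj pm pI))), v; split=> //.
  exact: (finite_lies_over pv).
have b0 : b != 0 by apply: contraNneq a0 => b0; rewrite e b0 mul0r.
apply: (IH b b0).
  by move: wa; rewrite e tofracM rmorphM mulrC vge_unitM.
move: sa; rewrite e size_mul ?(irredp_neq0 pI) //; case: pI => + _.
by move: (size p) (size b) => [|[|m]] l //= _; lia.
Qed.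

End Line.

Lemma mulrn_le_absz (j : nat) (x : int) : x *+ j <= (j * `|x|)%N%:Z.
Proof.
rewrite PoszM -mulr_natl natz ler_wpM2l //; lia.
Qed.

Lemma natz_le_mulrn (j : nat) (x : int) : 1 <= x -> j%:Z <= x *+ j.
Proof. by move=> x1; rewrite -mulr_natl natz ler_peMr. Qed.

(** * Curves with equation y^2 = D(x) *)

Section QuadraticField.
Variables (k : fieldType) (C : precurve k).
Local Notation K := (funfield C).
Local Notation F := {fraction {poly k}}.

(** Being nonnegative on constants means vanishing on nonzero ones, as their inverses are constants
    too. *)
Definition place (w : K -> int) : Prop :=
  valuation w /\ forall c, vge w 0 (const C c).

Definition quadratic_field (s : {rmorphism F -> K}) (y : K) (D : {poly k}) : Prop :=
  [/\ forall c, s c%:P%:F = const C c, y ^+ 2 = s D%:F, forall a, s a <> y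
    & forall z, exists a b, z = s a + s b * y].

Variables (s : {rmorphism F -> K}) (y : K) (D : {poly k}).
Hypotheses (two : (2 : k) != 0) (sy : quadratic_field s y D).
Hypothesis sepD : coprimep D D^`().

Let sc c : s c%:P%:F = const C c. Proof. by case: sy. Qed.
Let yD : y ^+ 2 = s D%:F. Proof. by case: sy. Qed.
Let yF : forall a, s a <> y. Proof. by case: sy. Qed.
Let span : forall z, exists a b, z = s a + s b * y. Proof. by case: sy. Qed.

Lemma quadratic_D_neq0 : D != 0.
Proof.
apply/eqP => D0; move: yD; rewrite D0 tofrac0 rmorph0 => /eqP.
by rewrite sqrf_eq0 => /eqP y0; case: (yF (a := 0)); rewrite rmorph0 y0.
Qed.

Lemma place_const w c : place w -> vge w 0 (s c%:P%:F).
Proof. by case=> _; rewrite sc. Qed.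

Lemma place_affine_poly w a : place w -> vge w 0 (s 'X%:F) -> vge w 0 (s a%:F).
Proof.
move=> wP wX; have wc c := place_const c wP.
exact: (vge0_poly (phi := (s \o (@tofrac {poly k}))%FUN) wP.1 wc a wX).
Qed.

Lemma place_affine_y w : place w -> vge w 0 (s 'X%:F) -> vge w 0 y.
Proof.
by move=> wP wX; case: (wP) => vP _; rewrite -(vge_sqr vP) yD place_affine_poly.
Qed.

(** If k(x) had only value 0, then [y], and with it all of [K], would be integral at [w]. *)
Lemma place_nontrivial w : place w -> exists2 z, z != 0 & w (s z) != 0.
Proof.
move=> wP; case: (wP) => vP _; apply: contrapT => H.
have H0 a : vge w 0 (s a).
  have [->|a0] := eqVneq a 0; first by rewrite rmorph0 vge0.
  have [wa|wa] := eqVneq (w (s a)) 0; first by rewrite /vge wa lexx orbT.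
  by case: H; exists a.
have wy : vge w 0 y by rewrite -(vge_sqr vP) yD.
have [t [t0 wt]] := val_uniformizer vP.
have : vge w 0 t^-1.
  by have [a [b ->]] := span t^-1; apply: (vgeD vP) => //; apply: (vgeM0l vP).
by rewrite vge_neq0 ?invr_eq0 // valV // wt.
Qed.

Lemma sX_neq0 : s 'X%:F != 0.
Proof. by rewrite fmorph_eq0 tofrac_eq0 polyX_eq0. Qed.

Lemma place_affine w : place w -> vge w 0 (s 'X%:F) ->
  exists p (pP : p \is monic /\ irreducible_poly p) v,
    is_P1_valuation (Some (exist _ p pP)) v /\ lies_over s v w.
Proof.
move=> wP wX; case: (wP) => vP _.
have [Q [v [Qv sv]]] := place_lies_over vP (fun c => place_const c wP) (place_nontrivial wP).
case: Q Qv => [[p pP]|] Qv; first by exists p, pP, v.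
have : vge w 1 (s ('X%:F)^-1).
  apply: (sv _).2; case: Qv => _ _ /= e.
  by rewrite /vge e lexx orbT.
have sX0 := sX_neq0.
move: wX; rewrite fmorphV !vge_neq0 ?invr_eq0 // valV //.
by move: (w _) => x; lia.
Qed.

Lemma P1_valuation_two Q v : is_P1_valuation Q v -> ~~ vge v 1 (2 : F).
Proof.
move=> Qv; have vP : valuation v by case: Qv.
apply/negP => H; have := vgeM0r vP H (P1_valuation_const (2^-1) Qv).
have -> : (2 : F) * (2^-1)%:P%:F = 1.
  have -> : (2 : F) = (2 : k)%:P%:F by rewrite !rmorph_nat.
  by rewrite -tofracM -polyCM divff // tofrac1.
by rewrite vge_neq0 ?oner_neq0 // val1.
Qed.

Lemma lies_over_place Q v w : is_P1_valuation Q v -> valuation w ->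
  lies_over s v w -> place w.
Proof.
move=> Qv wP sv; split=> // c; rewrite -sc; apply: (sv _).1.
exact: (P1_valuation_const c Qv).
Qed.

Section FinitePlace.
Variables (p : {poly k}) (pP : p \is monic /\ irreducible_poly p) (v : F -> int).
Hypothesis pv : is_P1_valuation (Some (exist _ p pP)) v.

Let vP : valuation v. Proof. by case: pv. Qed.
Let v2 := P1_valuation_two pv.
Let vD := finite_vge0 pv D.
Let vD01 := finite_val_sqfree pv quadratic_D_neq0 sepD.

(** The coefficients of the local separating element are replaced by polynomials congruent to them
    modulo [p]. Separation above [p] is kept, and the element becomes regular at all affine
    places. *)
Lemma finite_place_separate w : valuation w -> lies_over s v w ->
  exists e, [/\ vge w 1 (e - 1),
     forall w', place w' -> vge w' 0 (s 'X%:F) -> vge w' 0 e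
   & forall w', valuation w' -> lies_over s v w' ->
      (forall z, z != 0 -> w z = w' z) \/
      vge w' 1 e /\ w' (s p%:F) = 1].
Proof.
move=> wP vw.
have [a [b [Ha Hb H1 H]]] := quadratic_separate yD yF span vP vD v2 vD01 wP vw.
have [a' Ha'] := finite_residue pv Ha; have [b' Hb'] := finite_residue pv Hb.
have key w' : valuation w' -> lies_over s v w' ->
    vge w' 1 (s a + s b * y - (s a'%:F + s b'%:F * y)).
  move=> w'P vw'.
  have wy : vge w' 0 y by rewrite -(vge_sqr w'P) yD; apply: (vw' _).1.
  have -> : s a + s b * y - (s a'%:F + s b'%:F * y) =
     s (a - a'%:F) + s (b - b'%:F) * y.
    by rewrite !(rmorphB s); move: (s a) (s b) (s a'%:F) (s b'%:F) => *; ring.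
  apply: (vgeD w'P); first exact: (vw' _).2.
  by apply: (vgeM0r w'P) => //; apply: (vw' _).2.
exists (s a'%:F + s b'%:F * y); split.
- have := vgeB wP H1 (key w wP vw); set A := s a + s b * y; set B := s a'%:F + _.
  by rewrite addrAC subKr.
- move=> w' w'P wX; case: (w'P) => v'P _.
  apply: (vgeD v'P); first exact: place_affine_poly.
  by apply: (vgeM0l v'P); [exact: place_affine_poly|exact: place_affine_y].
move=> w' w'P vw'; have [?|[Hw' H2]] := H w' w'P vw'; first by left.
right; split; first by have := vgeB w'P Hw' (key w' w'P vw'); rewrite subKr.
apply: H2; last by case: pv.
by rewrite tofrac_eq0 irredp_neq0 //; case: (pP).
Qed.

Lemma finite_place_integral a b :
  (forall w, valuation w -> lies_over s v w -> vge w 0 (s a + s b * y)) ->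
  vge v 0 a /\ vge v 0 b.
Proof. exact: (quadratic_integral yD yF span vP vD v2 vD01). Qed.

End FinitePlace.

(** The coordinate ring of the affine curve is k[x] + k[x] y: at each [p] integrality passes to the
    two coefficients, and a fraction without finite poles is a polynomial. *)
Lemma affine_integral z :
  (forall w, place w -> vge w 0 (s 'X%:F) -> vge w 0 z) ->
  exists a b : {poly k}, z = s a%:F + s b%:F * y.
Proof.
move=> H; have [a [b e]] := span z.
have key p (pP : p \is monic /\ irreducible_poly p) v :
    is_P1_valuation (Some (exist _ p pP)) v -> vge v 0 a /\ vge v 0 b.
  move=> pv; apply: (finite_place_integral pv) => w wP vw; rewrite -e.
  apply: H; first exact: lies_over_place pv wP vw.
  by apply: (vw _).1; apply: (finite_vge0 pv).
have [|a' ea] := @polynomial_fraction _ a; first by move=> p pP v /key[].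
have [|b' eb] := @polynomial_fraction _ b; first by move=> p pP v /key[].
by exists a', b'; rewrite e ea eb.
Qed.

Lemma affine_poly_span w a b : place w -> vge w 0 (s 'X%:F) ->
  vge w 0 (s a%:F + s b%:F * y).
Proof.
move=> wP wX; case: (wP) => vP _.
apply: (vgeD vP); first exact: place_affine_poly.
by apply: (vgeM0l vP); [exact: place_affine_poly|exact: place_affine_y].
Qed.

Lemma clear_denominator r : exists (N : {poly k}) al,
  [/\ N != 0, r = al / s N%:F
    & forall w, place w -> vge w 0 (s 'X%:F) -> vge w 0 al].
Proof.
have [a [b e]] := span r.
have [a1 [a2 [a20 ea]]] := frac_quotient a.
have [b1 [b2 [b20 eb]]] := frac_quotient b.
exists (a2 * b2), (s (a1 * b2)%:F + s (b1 * a2)%:F * y); split.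
- by rewrite mulf_neq0.
- have n1 : s a2%:F != 0 by rewrite fmorph_eq0 tofrac_eq0.
  have n2 : s b2%:F != 0 by rewrite fmorph_eq0 tofrac_eq0.
  rewrite e ea eb (fmorph_div s a1%:F a2%:F) (fmorph_div s b1%:F b2%:F).
  rewrite !tofracM !(rmorphM s).
  move: (s a1%:F) (s a2%:F) (s b1%:F) (s b2%:F) n1 n2 => x1 x2 x3 x4 n1 n2.
  by field; rewrite n1 n2.
- by move=> w; apply: affine_poly_span.
Qed.

(* The map e |-> e^2 (3 - 2e) doubles the valuations of e and of e - 1. *)
Lemma strong_approximation w r : place w -> vge w 0 (s 'X%:F) ->
  exists f, vge w 0 (r - f) /\
    forall w', place w' -> vge w' 0 (s 'X%:F) ->
      (forall z, z != 0 -> w z = w' z) \/ vge w' 0 f.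
Proof.
move=> wP wX; case: (wP) => vP _.
have [p [pP [v [pv vw]]]] := place_affine wP wX.
have pI : irreducible_poly p by case: (pP).
have p0 : p != 0 := irredp_neq0 pI.
have [N [al [N0 er Hal]]] := clear_denominator r.
have [j [M [eN pM]]] := factor_out pI N0.
have /Bezout_eq1_coprimepP[[u t] /= eut] : coprimep M (p ^+ j).
  by rewrite coprimep_sym coprimep_expl // irreducible_poly_coprime.
have [e0 [e01 Ae0 He0]] := finite_place_separate pv vP vw.
(* [e] has to absorb the denominator [p ^+ j]: the factor [e - 1] must vanish at [w] to order [j]
   times the value of [p] there, and [e] to order [j] at another place above [p], where [p] has
   value 1. *)
pose J := (j * `|w (s p%:F)|)%N.
have [e [e1 Ae He]] : exists e, [/\ vge w J%:Z (e - 1),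
     forall w', place w' -> vge w' 0 (s 'X%:F) -> vge w' 0 e
   & forall w', valuation w' -> lies_over s v w' ->
      (forall z, z != 0 -> w z = w' z) \/
      vge w' J%:Z e /\ w' (s p%:F) = 1].
  have H (i : nat) : exists e, [/\ vge w (i.+1)%:Z (e - 1),
     forall w', place w' -> vge w' 0 (s 'X%:F) -> vge w' 0 e
   & forall w', valuation w' -> lies_over s v w' ->
      (forall z, z != 0 -> w z = w' z) \/
      vge w' (i.+1)%:Z e /\ w' (s p%:F) = 1].
    elim: i => [|i [e [e1 Ae He]]]; first by exists e0.
    exists (e ^+ 2 * (3 - 2 * e)); split.
    - have -> : e ^+ 2 * (3 - 2 * e) - 1 = (e - 1) * ((e - 1) * (- 1 - 2 * e)) by ring.
      apply: (vgeW (m := (i.+2)%:Z) (n := i.+1%:Z + i.+1%:Z)); first by clear; lia.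
      apply: (vgeM vP e1); apply: (vgeM0r vP e1).
      apply: (vgeB vP); first by rewrite vgeN // vge_1.
      by apply: (vgeM0l vP); [exact: vge_nat|exact: Ae].
    - move=> w' w'P wX'; case: (w'P) => v'P _.
      apply: (vgeM0l v'P); first by apply/(vgeX v'P)/Ae.
      by apply: (vgeB v'P); [exact: vge_nat|apply: (vgeM0l v'P); [exact: vge_nat|exact: Ae]].
    - move=> w' v'P vw'; have [?|[He' Hp]] := He w' v'P vw'; [by left|right; split=> //].
      apply: (vgeM0r v'P).
        rewrite expr2; apply: (vgeW (n := i.+1%:Z + i.+1%:Z)); first by clear; lia.
        exact: (vgeM v'P).
      have e'0 : vge w' 0 e by apply: vgeW He'.
      by apply: (vgeB v'P); [exact: vge_nat|apply: (vgeM0l v'P); [exact: vge_nat|]].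
  have [e [H1 H2 H3]] := H J; exists e; split=> //.
    by apply: vgeW H1; clear; lia.
  move=> w' v'P vw'; have [?|[He' Hp]] := H3 w' v'P vw'; [by left|right; split=> //].
  by apply: vgeW He'; clear; lia.
have sp0 : s p%:F != 0 by rewrite fmorph_eq0 tofrac_eq0.
have spj0 : s p%:F ^+ j != 0 by rewrite expf_neq0.
have M0 : M != 0 by apply: contraNneq pM => ->; rewrite dvdp0.
have sM0 : s M%:F != 0 by rewrite fmorph_eq0 tofrac_eq0.
have sN : s N%:F = s p%:F ^+ j * s M%:F.
  by rewrite eN tofracM tofracXn rmorphM rmorphXn.
have su : s u%:F * s M%:F + s t%:F * s p%:F ^+ j = 1.
  have := congr1 (fun a => s a%:F) eut.
  by rewrite tofracD !tofracM tofracXn tofrac1 rmorphD !rmorphM rmorphXn rmorph1.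
have wpj w' : valuation w' -> w' (s p%:F ^+ j)^-1 = - (w' (s p%:F) *+ j).
  by move=> v'P; rewrite valV // valX.
(* By Bezout [r] is [al u / p^j + al t / M]. The second summand is regular at [w], and the first,
   [f0], has affine poles only above [p]. *)
pose f0 := al * s u%:F / s p%:F ^+ j.
have Af0 w' : place w' -> vge w' 0 (s 'X%:F) -> vge w' 0 (al * s u%:F).
  move=> w'P wX'; case: (w'P) => v'P _.
  by apply: (vgeM0l v'P); [exact: Hal|exact: place_affine_poly].
have wp1 : 1 <= w (s p%:F).
  have := lies_over_vge1 (let: And3 vF _ _ := pv in vF) vP vw p%:F.
  by rewrite (finite_vge1 pv) dvdpp vge_neq0.
exists (f0 * e); split.
  have -> : r - f0 * e = al * s t%:F / s M%:F - f0 * (e - 1).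
    rewrite er sN /f0; move: su; move: (s u%:F) (s p%:F ^+ j) (s M%:F) (s t%:F) spj0 sM0.
    move=> U Q M' T Q0 M'0 su.
    have -> : al / (Q * M') = al * (U * M' + T * Q) / (Q * M') by rewrite su mulr1.
    by field; rewrite M'0 Q0.
  have wM : w (s M%:F) = 0.
    have H0 : vge w 0 (s M%:F) by apply: place_affine_poly.
    have H1 : ~~ vge w 1 (s M%:F).
      by rewrite (lies_over_vge1 (let: And3 vF _ _ := pv in vF) vP vw) (finite_vge1 pv).
    by have [] := val_eq0 H0 H1.
  have H1 : vge w 0 (s M%:F)^-1 by rewrite vge_neq0 ?invr_eq0 // valV // wM.
  apply: (vgeB vP).
    apply: (vgeM0r vP) => //; apply: (vgeM0l vP); first exact: Hal.
    exact: place_affine_poly.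
  rewrite /f0 -mulrA; apply: (vgeM0l vP); first exact: Af0.
  rewrite vge_mul_eq ?invr_eq0 // wpj // sub0r opprK.
  apply: vgeW e1; exact: mulrn_le_absz.
move=> w' w'P wX'; case: (w'P) => v'P _.
have [wp'|wp'] := boolP (vge w' 1 (s p%:F)).
  have vw' : lies_over s v w' by apply: (finite_lies_over pv) => // c; apply: place_const.
  have [?|[He' Hp']] := He w' v'P vw'; first by left.
  right; rewrite /f0 -mulrA; apply: (vgeM0l v'P); first exact: Af0.
  rewrite vge_mul_eq ?invr_eq0 // wpj // Hp' sub0r opprK.
  apply: vgeW He'; rewrite natz; apply: (le_trans _ (mulrn_le_absz j (w (s p%:F)))).
  exact: (natz_le_mulrn j wp1).
right; have [_ wp0] := val_eq0 (place_affine_poly p w'P wX') wp'.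
apply: (vgeM0l v'P); last exact: Ae.
apply: (vgeM0r v'P); first exact: Af0.
by rewrite vge_neq0 ?invr_eq0 // wpj // wp0 mul0rn oppr0.
Qed.

End QuadraticField.

Section Infinity.
Variables (k : fieldType) (C : precurve k).
Local Notation K := (funfield C).
Local Notation F := {fraction {poly k}}.
Variables (s : {rmorphism F -> K}) (y : K) (D : {poly k}).
Hypotheses (two : (2 : k) != 0) (sy : quadratic_field s y D).

Definition infinite_place (w : K -> int) : Prop := place w /\ ~~ vge w 0 (s 'X%:F).

Let yD : y ^+ 2 = s D%:F. Proof. by case: sy. Qed.
Let yF : forall a, s a <> y. Proof. by case: sy. Qed.
Let span : forall z, exists a b, z = s a + s b * y. Proof. by case: sy. Qed.

Lemma infinite_place_lies_over w v : infinite_place w -> is_P1_valuation None v ->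
  lies_over s v w.
Proof.
move=> [wP wX] Qv; apply: (infinite_lies_over Qv) => //; first by case: wP.
by move=> c; apply: (place_const sy c wP).
Qed.

Variable m : nat.
(* With 1/x as coordinate at infinity, the equation reads (y x^-m)^2 = D x^-2m. *)
Let c : F := ('X%:F)^-1 ^+ m.
Let yc := s c * y.
Let Dc : F := c ^+ 2 * D%:F.

Let c0 : c != 0.
Proof. by rewrite expf_neq0 // invr_eq0 tofrac_eq0 polyX_eq0. Qed.

Let sc0 : s c != 0. Proof. by rewrite fmorph_eq0; exact: c0. Qed.

Let ycD : yc ^+ 2 = s Dc.
Proof. by rewrite /yc /Dc exprMn yD (rmorphM s (c ^+ 2) D%:F) (rmorphXn s 2 c). Qed.

Let ycF a : s a <> yc.
Proof.
move=> e; case: (yF (a := c^-1 * a)).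
by rewrite rmorphM fmorphV e /yc mulrA mulVf // mul1r.
Qed.

Let spanc z : exists a b, z = s a + s b * yc.
Proof.
have [a [b ->]] := span z; exists a, (b / c).
by rewrite (fmorph_div s b c) /yc mulrA divfK.
Qed.

Let vDc v : is_P1_valuation None v -> v Dc = 1 - (size D)%:Z + 2 * m%:Z.
Proof.
move=> Qv; case: (Qv) => vP _ /= vX.
have D0 : D%:F != 0 :> F by rewrite tofrac_eq0; apply: (quadratic_D_neq0 sy).
have X0 : ('X%:F)^-1 != 0 :> F by rewrite invr_eq0 tofrac_eq0 polyX_eq0.
have c20 : c ^+ 2 != 0 := expf_neq0 2 c0.
rewrite /Dc (valM vP c20 D0) (valX vP 2 c0) (valX vP m X0) vX.
rewrite (infinite_val Qv); last by apply: (quadratic_D_neq0 sy).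
by rewrite natz mulr2n; move: (size D) => d; lia.
Qed.

(** [D] has even degree [2m], so [D x^(-2m)] is a unit at infinity. Against a ramified base point
    this will force the degree to be odd. *)
Lemma even_infinite_place_unramified w : size D = (2 * m).+1 ->
  infinite_place w -> w (s ('X%:F)^-1) = 1.
Proof.
move=> sD wI; have [v Qv] := P1_valuation (None : P1_point k).
have vw := infinite_place_lies_over wI Qv.
have vD0 : v Dc = 0 by rewrite (vDc Qv) sD; lia.
have vD : vge v 0 Dc by rewrite /vge vD0 lexx orbT.
case: wI => -[wP _] _; case: (Qv) => vP _ /= vX.
have X0 : ('X%:F)^-1 != 0 :> F by rewrite invr_eq0 tofrac_eq0 polyX_eq0.
exact: (quadratic_unramified ycD ycF spanc vP vD (P1_valuation_two two Qv) (or_introl vD0) wP vw vD0 X0 vX).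
Qed.

(** * Odd degree [2m - 1]: a single ramified place at infinity *)

Section Odd.
Hypotheses (sD : size D = (2 * m)%N).

Let vDc1 v : is_P1_valuation None v -> v Dc = 1.
Proof. by move=> Qv; rewrite (vDc Qv) sD; lia. Qed.

Lemma infinite_place_exists : exists w, infinite_place w.
Proof.
have [v Qv] := P1_valuation (None : P1_point k).
have vD1 := vDc1 Qv; case: (Qv) => vP _ /= vX.
have vD : vge v 0 Dc by rewrite /vge vD1 orbT.
have [w [wP vw]] := quadratic_exists ycD ycF spanc vP vD (P1_valuation_two two Qv) (or_intror vD1).
exists w; split; first exact: (lies_over_place sy Qv).
rewrite (lies_over_vge0 vP wP vw) vge_neq0 ?tofrac_eq0 ?polyX_eq0 //.
by rewrite (infinite_val_X Qv).
Qed.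

Let key w w' : infinite_place w -> infinite_place w' ->
  w yc = 1 /\ forall z, z != 0 -> w z = w' z.
Proof.
move=> wI w'I; have [v Qv] := P1_valuation (None : P1_point k).
have vw := infinite_place_lies_over wI Qv.
have vw' := infinite_place_lies_over w'I Qv.
have vD1 := vDc1 Qv; case: (Qv) => vP _ /= vX.
have vD : vge v 0 Dc by rewrite /vge vD1 orbT.
(* This is the ramified case with [c = 0]: [yc] vanishes at every place above infinity, so there is
   only one such place. *)
have vN : v (0 ^+ 2 - Dc) = 1 by rewrite expr0n sub0r valN.
have Hy u : valuation u -> lies_over s v u -> vge u 1 (yc - s 0).
  move=> uP vu; have H1 : vge u 1 (yc ^+ 2).
    by rewrite ycD; apply: (vu _).2; rewrite /vge vD1 orbT.
  rewrite rmorph0 subr0; apply: (vge1X uP _ H1).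
  by rewrite -(vge_sqr uP); apply: vgeW H1.
case: wI w'I => -[wP _] _ [[w'P _] _].
have := split_ramified_unique ycD ycF spanc vP vD (vge0 v 0) vN wP vw (Hy w wP vw) w'P vw' (Hy w' w'P vw').
by rewrite rmorph0 subr0.
Qed.

Lemma infinite_place_unique w w' : infinite_place w -> infinite_place w' ->
  forall z, z != 0 -> w z = w' z.
Proof. by move=> wI w'I; case: (key wI w'I). Qed.

Let y0 : y != 0.
Proof. by apply/eqP => e; case: (yF (a := 0)); rewrite rmorph0 e. Qed.

(** The ramification index is 2: [Dc] has value 1 at infinity and is the square of the uniformizer
    [yc] upstairs. *)
Lemma infinite_place_val w v a : infinite_place w -> is_P1_valuation None v ->
  a != 0 -> w (s a) = 2 * v a.
Proof.
move=> wI Qv a0; have vw := infinite_place_lies_over wI Qv.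
have [wy _] := key wI wI; have vD1 := vDc1 Qv.
case: (wI) => -[wP _] _; case: (Qv) => vP _ _.
have yc0 : yc != 0 by rewrite mulf_neq0.
have w2 : w (s Dc) = 2 by rewrite -ycD valX // wy.
have [e e0 we] := lies_over_val vP wP vw a0.
have DF0 : D%:F != 0 :> F by rewrite tofrac_eq0; apply: (quadratic_D_neq0 sy).
have Dc0 : Dc != 0 := mulf_neq0 (expf_neq0 2 c0) DF0.
have Dv0 : Dc ^ (- v a) != 0 := expfz_neq0 _ Dc0.
have z0 : a * Dc ^ (- v a) != 0 := mulf_neq0 a0 Dv0.
have vz : v (a * Dc ^ (- v a)) = 0.
  by rewrite (valM vP a0 Dv0) (valXz vP _ Dc0) vD1 mul1r subrr.
have [e' _] := lies_over_val vP wP vw z0; rewrite vz mul0r.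
have sDv : s (Dc ^ (- v a)) = s Dc ^ (- v a) by rewrite fmorphXz.
have sDc0 : s Dc != 0 by rewrite -ycD expf_neq0.
have sa0 : s a != 0 by rewrite fmorph_eq0; exact: a0.
rewrite rmorphM sDv (valM wP sa0) ?expfz_neq0 // (valXz wP _ sDc0) w2.
by move: (w (s a)) (v a) e' => i j; clear; lia.
Qed.

Lemma infinite_place_X w : infinite_place w -> w (s 'X%:F) = - 2.
Proof.
move=> wI; have [v Qv] := P1_valuation (None : P1_point k).
rewrite (infinite_place_val wI Qv) ?tofrac_eq0 ?polyX_eq0 //.
by rewrite (infinite_val_X Qv).
Qed.

Lemma infinite_place_y w : infinite_place w -> w y = 1 - 2 * m%:Z.
Proof.
move=> wI; have [wy _] := key wI wI; case: (wI) => -[wP _] _.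
have sX0 : s 'X%:F != 0 by apply: sX_neq0.
have -> : y = yc * s 'X%:F ^+ m.
  rewrite /yc /c rmorphXn fmorphV -mulrA [y * _]mulrC mulrA -exprMn.
  by rewrite mulVf // expr1n mul1r.
rewrite valM ?mulf_neq0 ?expf_neq0 // valX // wy infinite_place_X //.
by rewrite -mulr_natl natz; lia.
Qed.

(** The values of [s a] are even and those of [s b * y] odd, so the two terms cannot cancel. *)
Lemma infinite_place_span n w a b : infinite_place w ->
  vge w n (s a + s b * y) -> vge w n (s a) /\ vge w n (s b * y).
Proof.
move=> wI; case: (wI) => -[wP _] _.
have [->|a0] := eqVneq a 0; first by rewrite rmorph0 add0r vge0.
have [->|b0] := eqVneq b 0; first by rewrite rmorph0 mul0r addr0 vge0.
have [v Qv] := P1_valuation (None : P1_point k).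
have sa0 : s a != 0 by rewrite fmorph_eq0; exact: a0.
have sb0 : s b != 0 by rewrite fmorph_eq0; exact: b0.
have sby0 : s b * y != 0 by rewrite mulf_neq0.
have wa := infinite_place_val wI Qv a0.
have wb : w (s b * y) = 2 * v b + 1 - 2 * m%:Z.
  by rewrite valM // (infinite_place_val wI Qv b0) infinite_place_y // addrA.
have [ab|ba] := leP (w (s a)) (w (s b * y)).
  have H : vge w (w (s a) + 1) (s b * y).
    by rewrite vge_neq0 //; move: ab; rewrite wa wb; move: (v a) (v b) (m%:Z); clear; lia.
  have [n0 e] := valD_ltr wP sa0 H.
  rewrite (vge_neq0 _ _ n0) (vge_neq0 _ _ sa0) (vge_neq0 _ _ sby0) e => nw.
  by split=> //; apply: le_trans ab.
have H : vge w (w (s b * y) + 1) (s a).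
  by rewrite (vge_neq0 _ _ sa0); move: ba; rewrite lezD1.
have [n0 e] := valD_ltr wP sby0 H.
rewrite addrC (vge_neq0 _ _ n0) (vge_neq0 _ _ sa0) (vge_neq0 _ _ sby0) e => nw.
by split=> //; apply: le_trans nw (ltW ba).
Qed.

End Odd.
End Infinity.

Lemma infinite_polynomial_part (k : fieldType) (v : {fraction {poly k}} -> int) z :
  is_P1_valuation None v -> exists a : {poly k}, vge v 1 (z - a%:F).
Proof.
move=> Qv; have [a [b [b0 e]]] := frac_quotient z; exists (a %/ b).
have bF0 : b%:F != 0 :> {fraction {poly k}} by rewrite tofrac_eq0.
have -> : z - (a %/ b)%:F = (a %% b)%:F / b%:F.
  apply: (mulIf bF0); rewrite mulrBl e (divfK bF0) (divfK bF0).
  by rewrite [in X in X - _](divp_eq a b) tofracD tofracM addrAC subrr add0r.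
have [->|r0] := eqVneq (a %% b) 0; first by rewrite tofrac0 mul0r vge0.
have rF0 : (a %% b)%:F != 0 :> {fraction {poly k}} by rewrite tofrac_eq0.
have vP : valuation v by case: Qv.
rewrite /vge (val_div vP rF0 bF0) (infinite_val Qv r0) (infinite_val Qv b0).
apply/orP; right; have := ltn_modp a b; rewrite b0.
by move: (size (a %% b)) (size b) => l m; lia.
Qed.

Lemma infinite_vge1_poly (k : fieldType) (v : {fraction {poly k}} -> int) (a : {poly k}) :
  is_P1_valuation None v -> vge v 1 a%:F -> a = 0.
Proof.
move=> Qv H; apply/eqP; apply: contraT => a0.
have aF0 : a%:F != 0 :> {fraction {poly k}} by rewrite tofrac_eq0.
move: H; rewrite (vge_neq0 _ _ aF0) (infinite_val Qv a0).
by have := a0; rewrite -size_poly_gt0; move: (size a) => l; lia.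
Qed.

(** * Points of a smooth proper curve as places *)

Section SmoothProper.
Variables (k : fieldType) (C : precurve k).
Local Notation K := (funfield C).
Hypotheses (Csm : smooth C) (Cpr : proper_curve C).
Implicit Types (P : point C) (v w : K -> int).

Definition is_point_valuation P v := place v /\ stalk P = valring v.

Lemma point_valuation P : exists v, is_point_valuation P v.
Proof.
have [v [vP e]] := dvr_valuation (Csm P); exists v; split=> //; split=> // c.
by case: (Csm P) => + _ _ _ => /(_ c); rewrite e.
Qed.

Lemma max_idealP P v z : is_point_valuation P v -> max_ideal P z <-> vge v 1 z.
Proof. by case=> -[vP _] e; rewrite /max_ideal e; apply: nonunits_valring. Qed.

Lemma stalkP P v z : is_point_valuation P v -> stalk P z <-> vge v 0 z.
Proof. by case=> _ ->. Qed.

(** Separatedness: the common stalk dominates itself at both points. *)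
Lemma stalk_inj P Q : stalk P = stalk Q -> P = Q.
Proof.
move=> e; have [R [_ HR]] := Cpr (Csm P).
have domP : dominates (stalk P) (stalk P) by split.
have domQ : dominates (stalk P) (stalk Q) by rewrite -e.
by rewrite -(HR _ domP) (HR _ domQ).
Qed.

Lemma valring_eq v w : (forall z, z != 0 -> v z = w z) -> valring v = valring w.
Proof.
move=> H; apply/seteqP; split=> z; rewrite /valring /= /vge;
  by have [//|z0] := eqVneq z 0; rewrite H.
Qed.

(** Properness gives a point whose stalk is dominated by the ring of [w], and inclusion of discrete
    valuation rings of [K] is equality. *)
Lemma place_point w : place w -> exists P, is_point_valuation P w.
Proof.
move=> wP; case: (wP) => vP wc.
have [P [[PV _] _]] := Cpr (valring_dvr vP wc).
have [v [[v'P vc] e]] := point_valuation P; exists P; split=> //.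
by rewrite e; apply: valring_eq; apply: valring_max => //; rewrite -e.
Qed.

Lemma point_valuation_eq P Q v w : is_point_valuation P v ->
  is_point_valuation Q w -> (forall z, z != 0 -> v z = w z) -> P = Q.
Proof. by move=> [_ e] [_ e'] /valring_eq H; apply: stalk_inj; rewrite e e'. Qed.

End SmoothProper.

(** * Uniqueness of the genus *)

Section GenusUnique.
Variables (k : finFieldType) (C : precurve k).

Lemma repartition_sum n (e : 'I_n -> point C -> funfield C) (c : 'I_n -> k) :
  smooth C -> (forall i, repartition (e i)) ->
  repartition (fun P => \sum_(i < n) const C (c i) * e i P).
Proof.
move=> Csm He; rewrite /repartition.
apply: (@sub_finite_set _ _ (\bigcup_(i in [set: 'I_n]) [set P | ~ stalk P (e i P)])); last first.
  by apply: bigcup_finite => // i _; apply: He.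
move=> P /= H; apply: contrapT => H'; apply: H.
have [v Pv] := point_valuation Csm P; apply/(stalkP _ Pv).
case: (Pv) => -[vP vc] _; apply: (vge_sum vP) => i _; apply: (vgeM0l vP) => //.
by apply/(stalkP _ Pv); apply: contrapT => H1; apply: H'; exists i.
Qed.

(** Writing the combinations of the first basis in the second one gives an injection of [k^g1] into
    [k^g2]; as [k] is finite, cardinalities can be compared. *)
Lemma genus_le g1 g2 : smooth C -> has_genus C g1 -> has_genus C g2 -> (g1 <= g2)%N.
Proof.
move=> Csm [e1 [He1 H1]] [e2 [He2 H2]].
pose r (c : {ffun 'I_g1 -> k}) P := \sum_(i < g1) const C (c i) * e1 i P.
have Hr c : repartition (r c) by apply: repartition_sum.
pose phi c := projT1 (cid (H2 (r c) (Hr c))).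
have phiP c : exists f, forall P, stalk P (r c P - (f + \sum_(i < g2) const C (phi c i) * e2 i P)).
  by rewrite /phi; case: cid => d /= [].
have phi_inj : injective phi.
  move=> c d e; have [f Hf] := phiP c; have [h Hh] := phiP d.
  have [b [_ Hb]] := H1 (r c) (Hr c).
  rewrite -(Hb c); last first.
    exists 0 => P; rewrite add0r subrr; have [v Pv] := point_valuation Csm P.
    by apply/(stalkP _ Pv); apply: vge0.
  apply: Hb; exists (f - h) => P; have [v Pv] := point_valuation Csm P.
  apply/(stalkP _ Pv); case: (Pv) => -[vP vc] _.
  have /(stalkP _ Pv) A := Hf P; have /(stalkP _ Pv) B := Hh P.
  have := vgeB vP A B; rewrite e -/(r d P).
  set S := \sum_(i < g2) _; congr (is_true (vge v 0 _)).
  by move: (r c P) (r d P) S => x1 x2 x3; ring.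
have := leq_card phi phi_inj; rewrite !card_ffun !card_ord leq_exp2l //.
by apply: (leq_trans _ (max_card (pred2 (0 : k) 1))); rewrite card2 eq_sym oner_neq0.
Qed.

Lemma genus_unique g1 g2 : smooth C -> has_genus C g1 -> has_genus C g2 -> g1 = g2.
Proof.
by move=> Csm H1 H2; apply/eqP; rewrite eqn_leq !(genus_le Csm).
Qed.

End GenusUnique.

(** * Geometric irreducibility from a rational place *)

Section RationalInfinity.
Variables (k : fieldType) (C : precurve k) (w : funfield C -> int).
Local Notation K := (funfield C).
Hypothesis wP : place w.
Hypothesis residue : forall z, vge w 0 z -> exists c, vge w 1 (z - const C c).

Let vP : valuation w. Proof. by case: wP. Qed.
Let wc c : vge w 0 (const C c). Proof. by case: wP. Qed.

Let const_eq0 c : vge w 1 (const C c) -> c = 0.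
Proof.
move=> H; apply/eqP; apply: contraT => c0.
have := vgeM0r vP H (wc c^-1); rewrite -rmorphM divff // rmorph1.
by rewrite vge_neq0 ?oner_neq0 // val1.
Qed.

Let reduce (g : {poly K}) : g \is monic -> (forall i, vge w 0 g`_i) ->
  exists g' : {poly k}, [/\ g' \is monic, size g' = size g
    & forall i, vge w 1 (g`_i - const C g'`_i)].
Proof.
move=> gm Hg; pose f i := projT1 (cid (residue (Hg i))).
have fP i : vge w 1 (g`_i - const C (f i)) by rewrite /f; case: cid.
have sg : (0 < size g)%N by rewrite size_poly_gt0 monic_neq0.
have f1 : f (size g).-1 = 1.
  have := fP (size g).-1; rewrite -lead_coefE (monicP gm) -(rmorph1 (const C)) -rmorphB.
  by move/const_eq0/eqP; rewrite subr_eq0 => /eqP.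
have szf : size (\poly_(i < size g) f i) = size g.
  by apply: size_poly_eq; rewrite f1 oner_neq0.
exists (\poly_(i < size g) f i); split=> //.
  by rewrite monicE lead_coefE szf coef_poly prednK // leqnn f1.
move=> i; rewrite coef_poly; case: ltnP => // ig.
by rewrite nth_default // rmorph0 subrr vge0.
Qed.

(** Make a factorization of [h] over [K] monic. By Gauss its coefficients are integral at [w], and
    reduction to the residue field [k] turns it into a factorization over [k] with the same degrees,
    which irreducibility of [h] makes trivial. *)
Lemma rational_place_geometrically_irreducible : geometrically_irreducible C.
Proof.
move=> h hI; have h0 := irredp_neq0 hI.
set H := map_poly (const C) h.
have sH : size H = size h by rewrite size_map_poly.
have H0 : H != 0 by rewrite map_poly_eq0.
split; first by rewrite sH; case: hI.
move=> g g1 /dvdpP[u e].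
have /norP[u0 g0] : ~~ ((u == 0) || (g == 0)) by rewrite -mulf_eq0 -e.
have lg0 : (lead_coef g)^-1 != 0 by rewrite invr_eq0 lead_coef_eq0.
have lu0 : (lead_coef u)^-1 != 0 by rewrite invr_eq0 lead_coef_eq0.
set g' := (lead_coef g)^-1 *: g; set u' := (lead_coef u)^-1 *: u.
have gm : g' \is monic by rewrite monicE lead_coefZ mulVf // lead_coef_eq0.
have um : u' \is monic by rewrite monicE lead_coefZ mulVf // lead_coef_eq0.
have eh : u' * g' = map_poly (const C) ((lead_coef h)^-1 *: h).
  rewrite /u' /g' -scalerAl -scalerAr scalerA -e map_polyZ /=; congr (_ *: _).
  by rewrite -invfM mulrC -lead_coefM mulrC -e lead_coef_map fmorphV.
have Hge i : vge w 0 (u' * g')`_i by rewrite eh coef_map; apply: wc.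
have Hu := gauss_monic vP um gm Hge.
have Hg i : vge w 0 g'`_i by apply: (gauss_monic vP gm um) => j; rewrite mulrC.
have [u2 [u2m su2 Hu2]] := reduce um Hu; have [g2 [g2m sg2 Hg2]] := reduce gm Hg.
have eh2 : (lead_coef h)^-1 *: h = u2 * g2.
  apply/polyP => i; apply/eqP; rewrite -subr_eq0; apply/eqP/const_eq0.
  rewrite rmorphB -coef_map -eh [in X in X - _]coefM coefM rmorph_sum -sumrB.
  apply: (vge_sum vP) => j _; rewrite rmorphM.
  have -> : u'`_j * g'`_(i - j) - const C u2`_j * const C g2`_(i - j) =
      (u'`_j - const C u2`_j) * g'`_(i - j) +
      const C u2`_j * (g'`_(i - j) - const C g2`_(i - j)) by ring.
  by apply: (vgeD vP); [exact: (vgeM0r vP)|exact: (vgeM0l vP)].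
have lh0 : (lead_coef h)^-1 != 0 by rewrite invr_eq0 lead_coef_eq0.
have g2h : g2 %| h by rewrite -(dvdpZr _ _ lh0) eh2 dvdp_mull.
have sg : size g = size g2 by rewrite sg2 size_scale.
have [_ /(_ g2)] := hI; rewrite -sg => /(_ g1 g2h) /eqp_size sgh.
rewrite -dvdp_size_eqp; first by rewrite sH sg sgh.
by rewrite e dvdp_mull.
Qed.

End RationalInfinity.

(** * The point at infinity and the genus of [y^2 = D(x)] *)

Section HyperellipticEquation.
Variables (k : fieldType) (C : precurve k).
Local Notation K := (funfield C).
Local Notation F := {fraction {poly k}}.
Variables (s : {rmorphism F -> K}) (y : K) (D : {poly k}) (n : nat).
Hypotheses (two : (2 : k) != 0) (sy : quadratic_field s y D).
Hypotheses (sepD : coprimep D D^`()) (sD : size D = (2 * n.+1)%N).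
Hypotheses (Csm : smooth C) (Cpr : proper_curve C).

(** The term [s b * y] has odd value, so if integral it vanishes at [w]. The residue is that of [a],
    whose polynomial part is constant since [a] is regular at infinity. *)
Lemma infinite_place_residue w z : infinite_place s w -> vge w 0 z ->
  exists c, vge w 1 (z - const C c).
Proof.
move=> wI; have [_ _ _ /(_ z)[a [b ->]]] := sy.
move=> /(infinite_place_span two sy sD wI)[Ha Hb].
have [v Qv] := P1_valuation (None : P1_point k).
have vw := infinite_place_lies_over sy wI Qv.
have vP : valuation v by case: Qv.
case: (wI) => -[wP _] _.
have Hb1 : vge w 1 (s b * y).
  have [->|b0] := eqVneq b 0; first by rewrite rmorph0 mul0r vge0.
  have sb0 : s b != 0 by rewrite fmorph_eq0; exact: b0.
  have y0 : y != 0.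
    by apply/eqP => e; case: sy => _ _ /(_ 0) + _; apply; rewrite rmorph0 e.
  have sby0 := mulf_neq0 sb0 y0.
  move: Hb; rewrite !(vge_neq0 _ _ sby0) (valM wP sb0 y0).
  rewrite (infinite_place_val two sy sD wI Qv b0) (infinite_place_y two sy sD wI).
  by move: (v b) => x; lia.
have [q Hq] := infinite_polynomial_part a Qv.
have Hqa : vge v 0 q%:F.
  rewrite -(vgeBr vP _ (x := a)); first by apply: vgeW Hq.
  by rewrite -(lies_over_vge0 vP wP vw).
have sq : (size q <= 1)%N.
  have [->|q0] := eqVneq q 0; first by rewrite size_poly0.
  have qF0 : q%:F != 0 :> F by rewrite tofrac_eq0.
  move: Hqa; rewrite (vge_neq0 _ _ qF0) (infinite_val Qv q0).
  by move: (size q) => l; lia.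
exists q`_0; case: sy => sc _ _ _; rewrite -sc -(size1_polyC sq).
rewrite addrAC; apply: (vgeD wP) => //.
by rewrite -(rmorphB s); apply: (vw _).2.
Qed.

Lemma infinite_point_exists : exists P w, is_point_valuation P w /\ infinite_place s w.
Proof.
have [w wI] := infinite_place_exists two sy sD.
by have [P Pw] := place_point Csm Cpr wI.1; exists P, w.
Qed.

Lemma infinite_point_unique P Q v w : is_point_valuation P v -> infinite_place s v ->
  is_point_valuation Q w -> infinite_place s w -> P = Q.
Proof.
move=> Pv vI Qw wI; apply: (point_valuation_eq Csm Cpr Pv Qw).
exact: (infinite_place_unique two sy sD).
Qed.

(** Number the bad points and induct on how many numbers are in use: strong approximation at the
    affine bad point with the last number corrects it without creating new affine ones. *)
Lemma approximate_repartition r : repartition r ->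
  exists f, forall P, stalk P (s 'X%:F) -> stalk P (r P - f).
Proof.
move=> /finite_setP[N /card_set_bijP[lab [lab_fun lab_inj _]]].
have : exists lab : point C -> nat,
    (forall P, stalk P (s 'X%:F) -> ~ stalk P (r P) -> (lab P < N)%N) /\
    (forall P Q, ~ stalk P (r P) -> ~ stalk Q (r Q) -> lab P = lab Q -> P = Q).
  exists lab; split=> [P _ H|P Q HP HQ]; first exact: lab_fun.
  by apply: lab_inj; rewrite inE.
elim: N {lab lab_fun lab_inj} r => [|N IH] r [lab [labN lab_inj]].
  exists 0 => P HP; rewrite subr0; apply: contrapT => /(labN P HP).
  by rewrite ltn0.
have [[P [PX PN Pr]]|H] := pselect (exists P, [/\ stalk P (s 'X%:F), lab P = N & ~ stalk P (r P)]); last first.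
  apply: IH; exists lab; split=> // P PX Pr.
  have := labN P PX Pr; rewrite ltnS leq_eqVlt => /orP[/eqP e|//].
  by case: H; exists P.
have [v Pv] := point_valuation Csm P.
have [f [Hf Hf']] := strong_approximation two sy sepD (r P) Pv.1 ((stalkP _ Pv).1 PX).
have other Q : Q <> P -> stalk Q (s 'X%:F) -> stalk Q f.
  move=> QP QX; have [w Qw] := point_valuation Csm Q; apply/(stalkP _ Qw).
  have [e|//] := Hf' w Qw.1 ((stalkP _ Qw).1 QX).
  by case: QP; symmetry; apply: (point_valuation_eq Csm Cpr Pv Qw e).
have bad Q : stalk Q (s 'X%:F) -> ~ stalk Q (r Q - f) -> Q <> P /\ ~ stalk Q (r Q).
  move=> QX; have [w Qw] := point_valuation Csm Q => /(stalkP _ Qw) H.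
  have QP : Q <> P.
    move=> e; apply: H; move: Qw; rewrite e => Qw.
    by apply/(stalkP _ Qw)/(stalkP _ Pv).
  split=> // /(stalkP _ Qw) H1; apply: H; apply: vgeB => //; first by case: (Qw) => -[].
  by apply/(stalkP _ Qw)/other.
have [|g Hg] := IH (fun Q => if pselect (stalk Q (s 'X%:F)) then r Q - f else 0).
  exists lab; split=> [Q QX|Q R].
    case: pselect => // _ /(bad Q QX)[QP Qr].
    have := labN Q QX Qr; rewrite ltnS leq_eqVlt => /orP[/eqP e|//].
    by case: QP; apply: lab_inj => //; rewrite e PN.
  have st0 (S : point C) : stalk S 0.
    by have [w Sw] := point_valuation Csm S; apply/(stalkP _ Sw)/vge0.
  case: pselect => QX; last by move=> H; case: (H (st0 Q)).
  case: pselect => RX; last by move=> _ H; case: (H (st0 R)).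
  by move=> HQ HR; apply: lab_inj; [have [] := bad Q QX HQ|have [] := bad R RX HR].
exists (f + g) => Q QX; have /= := Hg Q QX; case: (pselect (stalk Q (s 'X%:F))) => // ? H.
by rewrite opprD addrA.
Qed.

Let X := s 'X%:F.

Let X0 : X != 0. Proof. exact: sX_neq0. Qed.

(* The coefficients of y/x, ..., y/x^n are arranged into a polynomial in order to
   reduce to statements about polynomial parts. *)
Definition gap_poly (c : 'I_n -> k) : {poly k} := \sum_(i < n) c i *: 'X^(n - i.+1).

Lemma gap_poly_coef c (i : 'I_n) : (gap_poly c)`_(n - i.+1) = c i.
Proof.
rewrite /gap_poly coef_sum (bigD1 i) //= coefZ coefXn eqxx mulr1 big1 ?addr0 //.
move=> j ji; rewrite coefZ coefXn; case: eqP; rewrite ?mulr0 // => e.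
case/eqP: ji; apply/val_inj => /=; have := ltn_ord i; have := ltn_ord j; lia.
Qed.

Lemma gap_poly_surj (q : {poly k}) : (size q <= n)%N ->
  q = gap_poly (fun i => q`_(n - i.+1)).
Proof.
move=> sq; rewrite -[LHS]coefK (_ : \poly_(i < size q) q`_i = \poly_(i < n) q`_i).
  by rewrite poly_def (reindex_inj rev_ord_inj).
apply/polyP => i; rewrite !coef_poly; case: ltnP => iq.
  by rewrite (leq_trans iq sq).
by case: ltnP => // _; rewrite nth_default.
Qed.

Lemma gap_poly_eval c :
  \sum_(i < n) const C (c i) * (y / X ^+ i.+1) = s (gap_poly c)%:F / X ^+ n * y.
Proof.
case: sy => sc _ _ _.
pose phi : {rmorphism {poly k} -> K} := (s \o (@tofrac {poly k}))%FUN.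
have phiE a m : phi (a *: 'X^m) = const C a * X ^+ m.
  by rewrite /phi /= -mul_polyC tofracM tofracXn (rmorphM s) (rmorphXn s) sc.
rewrite -[s _]/(phi (gap_poly c)) /gap_poly rmorph_sum !mulr_suml.
apply: eq_bigr => i _; rewrite phiE.
have -> : X ^+ n = X ^+ (n - i.+1) * X ^+ i.+1 by rewrite -exprD subnK.
have := expf_neq0 (n - i.+1) X0; have := expf_neq0 i.+1 X0.
by move: (X ^+ _) (X ^+ _) (const C _) => x1 x2 x3 h1 h2; field; rewrite h1 h2.
Qed.

(** Subtracting a global function moves a repartition to the single point [P0] at infinity. There
    [x] has a pole of order 2 and [y] one of order [2n + 1], so k[x] + k[x] y has no function with
    pole order 1, 3, ..., [2n - 1]; these are the pole orders of [y / x^n], ..., [y / x]. *)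
Lemma hyperelliptic_genus : has_genus C n.
Proof.
have [P0 [w [Pw wI]]] := infinite_point_exists.
have wP : valuation w by case: wI => -[].
have affine P : P <> P0 -> stalk P X.
  move=> PP; have [v Pv] := point_valuation Csm P; apply/(stalkP _ Pv).
  apply: contraT => H; case: PP; apply: (infinite_point_unique Pv _ Pw wI).
  by split=> //; case: Pv.
have st0 (S : point C) : stalk S 0.
  by have [v Sw] := point_valuation Csm S; apply/(stalkP _ Sw)/vge0.
pose e (i : 'I_n) P := if pselect (P = P0) then y / X ^+ i.+1 else 0.
have eP0 (c : {ffun 'I_n -> k}) : \sum_(i < n) const C (c i) * e i P0 = s (gap_poly c)%:F / X ^+ n * y.
  by rewrite -gap_poly_eval; apply: eq_bigr => i _; rewrite /e /=; case: (pselect (P0 = P0)) => [?|?] /=.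
have eP (c : {ffun 'I_n -> k}) P : P <> P0 -> \sum_(i < n) const C (c i) * e i P = 0.
  move=> PP; rewrite big1 // => i _; rewrite /e /=; case: (pselect (P = P0)) => [?|?] //=.
  by rewrite mulr0.
have [v Qv] := P1_valuation (None : P1_point k).
have vw := infinite_place_lies_over sy wI Qv.
have vP : valuation v by case: Qv.
have wX : w X = - 2 := infinite_place_X two sy sD wI.
have wy : w y = 1 - 2 * n.+1%:Z := infinite_place_y two sy sD wI.
have y0 : y != 0.
  by apply/eqP => e'; case: sy => _ _ /(_ 0) + _; apply; rewrite rmorph0 e'.
have Xn0 : X ^+ n != 0 by rewrite expf_neq0.
have wXn : w (X ^+ n) = - 2 * n%:Z.
  by rewrite (valX wP _ X0) wX -mulr_natl natz; clear; lia.
exists e; split.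
  move=> i; rewrite /repartition; apply: (@sub_finite_set _ _ [set P0]); last exact: finite_set1.
  by move=> P /=; rewrite /e /=; case: (pselect (P = P0)) => [?|?] //=; case.
move=> r Hr; have [f0 Hf0] := approximate_repartition Hr.
have [a [b eab]] : exists a b, r P0 - f0 = s a + s b * y by case: sy.
have [qa Ha] := infinite_polynomial_part a Qv.
have [q Hq] := infinite_polynomial_part ('X%:F ^+ n * b) Qv.
(* Modulo functions regular at [P0], [b y] is [q y / x^n]. The part [q1] contributes the function
   [q1 y], regular on the affine curve, and [q0] the coefficients in the basis. *)
pose q0 := take_poly n q; pose q1 := drop_poly n q.
have eq : q = q0 + q1 * 'X^n by rewrite poly_take_drop.
have sq0 : (size q0 <= n)%N by apply: size_take_poly.
pose c : {ffun 'I_n -> k} := [ffun i : 'I_n => q0`_(n - i.+1)].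
have ec : q0 = gap_poly c.
  by rewrite [LHS](gap_poly_surj sq0); apply: eq_bigr => i _; rewrite ffunE.
pose F1 := f0 + (s qa%:F + s q1%:F * y).
have HF1 P : stalk P (r P - (F1 + \sum_(i < n) const C (c i) * e i P)).
  have [PP|PP] := pselect (P = P0).
    rewrite PP eP0 /F1; apply/(stalkP _ Pw).
    have -> : r P0 - (f0 + (s qa%:F + s q1%:F * y) + s (gap_poly c)%:F / X ^+ n * y) =
       s (a - qa%:F) + s ('X%:F ^+ n * b - q%:F) / X ^+ n * y.
      rewrite -ec eq !opprD !addrA eab tofracD tofracM tofracXn.
      rewrite (rmorphB s) (rmorphB s) (rmorphD s) (rmorphM s _ b) (rmorphM s q1%:F) !(rmorphXn s) -/X.
      move: (s a) (s b) (s qa%:F) (s q0%:F) (s q1%:F) (X ^+ n) Xn0 => x1 x2 x3 x4 x5 x6 h.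
      by field.
    apply: (vgeD wP); first by apply: vgeW (_ : vge w 1 _) => //; apply: (vw _).2.
    have [->|R0] := eqVneq ('X%:F ^+ n * b - q%:F) 0; first by rewrite rmorph0 !mul0r vge0.
    have sR0 : s ('X%:F ^+ n * b - q%:F) != 0 by rewrite fmorph_eq0; exact: R0.
    have := Hq; rewrite (vge_neq0 _ _ R0) => Hv.
    rewrite vge_neq0 ?mulf_neq0 ?invr_eq0 // (valM wP) ?mulf_neq0 ?invr_eq0 //.
    rewrite (val_div wP sR0 Xn0) wXn wy (infinite_place_val two sy sD wI Qv R0).
    by move: Hv; move: (v _) => x; clear; lia.
  rewrite eP // addr0; have [u Pu] := point_valuation Csm P.
  have PX := affine P PP; have := Hf0 P PX.
  move=> /(stalkP _ Pu) H; apply/(stalkP _ Pu).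
  have uP : valuation u by case: Pu => -[].
  rewrite opprD addrA; apply: (vgeB uP) => //.
  by apply: (affine_poly_span sy) => //; [case: Pu|apply/(stalkP _ Pu)].
exists c; split; first by exists F1.
move=> d [f Hf]; apply/ffunP => i.
have [a' [b' eg]] : exists a b : {poly k}, f - F1 = s a%:F + s b%:F * y.
  apply: (affine_integral two sy sepD) => u uP uX.
  have [P Pu] := place_point Csm Cpr uP.
  have PP : P <> P0.
    move=> PP; have := Pw; rewrite -PP => Pw'; case: wI => _ /negP; apply.
    by apply/(stalkP _ Pw')/(stalkP _ Pu).
  have := HF1 P; have := Hf P; rewrite !eP // !addr0.
  move=> /(stalkP _ Pu) H1 /(stalkP _ Pu) H2; case: uP => uP _.
  by have := vgeB uP H2 H1; congr (is_true (vge u 0 _)); move: (r P) => z; ring.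
have := HF1 P0; have := Hf P0; rewrite !eP0.
move=> /(stalkP _ Pw) H1 /(stalkP _ Pw) H2.
have := vgeB wP H2 H1.
set B : F := b'%:F + (gap_poly d - gap_poly c)%:F / 'X%:F ^+ n.
have -> : r P0 - (F1 + s (gap_poly c)%:F / X ^+ n * y) -
    (r P0 - (f + s (gap_poly d)%:F / X ^+ n * y)) = s a'%:F + s B * y.
  have -> : f = s a'%:F + s b'%:F * y + F1 by rewrite -eg subrK.
  rewrite /B (rmorphD s) (fmorph_div s) (rmorphXn s) tofracB (rmorphB s) -/X.
  by move: (r P0) (s a'%:F) (s b'%:F) (s (gap_poly c)%:F) (s (gap_poly d)%:F) => *; ring.
move=> /(infinite_place_span two sy sD wI)[_ HB].
have XF0 : 'X%:F != 0 :> F by rewrite tofrac_eq0 polyX_eq0.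
have XnF0 : 'X%:F ^+ n != 0 :> F := expf_neq0 n XF0.
have eB : 'X%:F ^+ n * B = (b' * 'X^n + (gap_poly d - gap_poly c))%:F.
  rewrite /B mulrDr [_ * (_ / _)]mulrCA (divff XnF0) mulr1.
  by rewrite (tofracD (b' * 'X^n)) tofracM tofracXn [_ * b'%:F]mulrC.
(* [B * y] is integral at [P0] and [y] has value [-(2n + 1)], so [x^n B] has positive value at
   infinity; being a polynomial it is 0. The gap polynomials can then be compared in degrees below
   [n], where [b' x^n] does not interfere. *)
have : b' * 'X^n + (gap_poly d - gap_poly c) = 0.
  apply: (infinite_vge1_poly Qv); rewrite -eB.
  have [->|B0] := eqVneq B 0; first by rewrite mulr0 vge0.
  have sB0 : s B != 0 by rewrite fmorph_eq0; exact: B0.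
  rewrite (vge_mul_eq vP _ _ XnF0) (vge_neq0 _ _ B0) (valX vP _ XF0) (infinite_val_X Qv).
  move: HB; rewrite (vge_neq0 _ _ (mulf_neq0 sB0 y0)) (valM wP sB0 y0) wy.
  rewrite (infinite_place_val two sy sD wI Qv B0) -mulr_natl natz.
  by move: (v B) => x; clear; lia.
move=> /(congr1 (fun p : {poly k} => p`_(n - i.+1))).
rewrite coefD coefMXn coefB !gap_poly_coef coef0.
have -> : (n - i.+1 < n)%N by have := ltn_ord i; clear; lia.
by rewrite add0r => /eqP; rewrite subr_eq0 eq_sym => /eqP.
Qed.

End HyperellipticEquation.

(** * Isomorphisms and presentations *)

Section Substitution.
Variables (k : fieldType) (C : precurve k).
Local Notation K := (funfield C).
Local Notation F := {fraction {poly k}}.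

(** A function with a pole is transcendental, so evaluation of polynomials at [xi] extends to
    fractions. *)
Lemma substitution_exists w (xi : K) : place w -> ~~ vge w 0 xi ->
  exists s : {rmorphism F -> K}, (forall c, s c%:P%:F = const C c) /\ s 'X%:F = xi.
Proof.
move=> wP wxi.
pose phi : {rmorphism {poly k} -> K} := (horner_eval xi \o map_poly (const C))%FUN.
have phiC c : phi c%:P = const C c by rewrite /phi /= map_polyC /= /horner_eval hornerC.
have phiX : phi 'X = xi by rewrite /phi /= map_polyX /horner_eval hornerX.
have phi0 a : a != 0 -> phi a != 0.
  move=> a0; have wc c : vge w 0 (phi c%:P) by rewrite phiC; case: wP.
  by case: wP => vP _; have [] := val_poly vP wc (a := a); rewrite ?phiX.
have [s sE] := frac_lift_exists phi0; exists s; split=> [c|].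
  by rewrite sE phiC.
by rewrite sE phiX.
Qed.

Variables (s s' : {rmorphism F -> K}).
Hypotheses (sc : forall c, s c%:P%:F = const C c) (sc' : forall c, s' c%:P%:F = const C c).

Lemma comp_substitution p q : s' q%:F = s 'X%:F -> s' (p \Po q)%:F = s p%:F.
Proof.
move=> e; elim/poly_ind: p => [|p c IH].
  by rewrite comp_poly0 tofrac0 !rmorph0.
rewrite comp_poly_MXaddC.
rewrite (tofracD ((p \Po q) * q) c%:P) (tofracD (p * 'X) c%:P) (tofracM (p \Po q) q) (tofracM p 'X).
by rewrite (rmorphD s) (rmorphD s') (rmorphM s) (rmorphM s') IH e sc sc'.
Qed.

Lemma image_sub : (exists m, s' m = s 'X%:F) -> forall a, exists b, s a = s' b.
Proof.
move=> [m em].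
have H p : exists b, s p%:F = s' b.
  elim/poly_ind: p => [|p c [b IH]]; first by exists 0; rewrite tofrac0 !rmorph0.
  exists (b * m + c%:P%:F).
  rewrite (tofracD (p * 'X) c%:P) (tofracM p 'X) (rmorphD s) (rmorphM s).
  by rewrite (rmorphD s') (rmorphM s') IH em sc sc'.
move=> a; have [x [z [z0 ->]]] := frac_quotient a.
have [b eb] := H x; have [c ec] := H z; exists (b / c).
by rewrite (fmorph_div s x%:F z%:F) (fmorph_div s' b c) eb ec.
Qed.

End Substitution.

Section ChangeOfCoordinates.
Variables (k : fieldType) (C : precurve k).
Local Notation K := (funfield C).
Local Notation F := {fraction {poly k}}.
Variables (s : {rmorphism F -> K}) (y : K) (D : {poly k}).
Hypothesis sy : quadratic_field s y D.

(** The new coordinates are [(x - v) / u] and [e y]; they generate the same fields, and the pole at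
    [w] stays. *)
Lemma change_coordinates w (u v e : k) : infinite_place s w -> u != 0 -> e != 0 ->
  exists s' : {rmorphism F -> K},
    quadratic_field s' (const C e * y) (e ^+ 2 *: (D \Po affine_poly u v)) /\
    infinite_place s' w.
Proof.
move=> [wP wX] u0 e0; case: (sy) => sc yD yF span; case: (wP) => vP wc.
have Cu0 : const C u != 0 by rewrite fmorph_eq0.
have Ce0 : const C e != 0 by rewrite fmorph_eq0.
pose xi := const C u^-1 * (s 'X%:F - const C v).
have wxi : ~~ vge w 0 xi.
  apply: contra wX => H; have := vgeD vP (vgeM0l vP (wc u) H) (wc v).
  rewrite /xi mulrA -rmorphM divff // rmorph1 mul1r.
  by rewrite subrK.
have [s' [sc' sX']] := substitution_exists wP wxi.
have sX : s' (affine_poly u v)%:F = s 'X%:F.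
  rewrite /affine_poly -mul_polyC (tofracD (u%:P * 'X) v%:P) (tofracM u%:P 'X).
  rewrite (rmorphD s') (rmorphM s') !sc' sX' /xi fmorphV.
  by rewrite mulrA divff // mul1r subrK.
have sub1 : forall a, exists b, s a = s' b.
  by apply: (image_sub sc sc'); exists (affine_poly u v)%:F.
have sub2 : forall a, exists b, s' a = s b.
  apply: (image_sub sc' sc); exists (u^-1%:P * ('X - v%:P))%:F.
  rewrite (tofracM u^-1%:P ('X - v%:P)) (tofracB 'X v%:P) (rmorphM s) (rmorphB s) !sc.
  by rewrite sX'.
exists s'; split; last by split=> //; rewrite sX'.
split=> // [|a ea|z].
- rewrite exprMn yD -mul_polyC (tofracM (e ^+ 2)%:P (D \Po affine_poly u v)) (rmorphM s') sc' -rmorphXn.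
  by rewrite (comp_substitution sc sc' D sX).
- have [b eb] := sub2 ((e%:P)%:F^-1 * a); apply: (yF b).
  rewrite -eb (rmorphM s') fmorphV sc' ea mulrA mulVf // mul1r //.
- have [a [b ->]] := span z; have [a' ->] := sub1 a.
  have [b' eb] := sub1 (b / (e%:P)%:F); exists a', b'.
  rewrite -eb (fmorph_div s b (e%:P)%:F) sc mulrA divfK //.
Qed.

End ChangeOfCoordinates.

Section FieldIsomorphism.
Variables (k : fieldType) (C1 C2 : precurve k).
Local Notation F := {fraction {poly k}}.
Variables (s1 : {rmorphism F -> funfield C1}) (y1 : funfield C1).
Variables (s2 : {rmorphism F -> funfield C2}) (y2 : funfield C2) (D : {poly k}).
Hypotheses (sy1 : quadratic_field s1 y1 D) (sy2 : quadratic_field s2 y2 D).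

Lemma same_equation_morphism : exists phi : {rmorphism funfield C2 -> funfield C1},
  forall a b, phi (s2 a + s2 b * y2) = s1 a + s1 b * y1.
Proof.
by case: sy1 => _ yD1 _ _; case: sy2 => _ yD2 yF2 span2; apply: (quadratic_lift yD2 yF2 span2).
Qed.

End FieldIsomorphism.

Section CurveIsomorphism.
Variables (k : fieldType) (C1 C2 : precurve k).
Hypotheses (C1sm : smooth C1) (C1pr : proper_curve C1).
Hypotheses (C2sm : smooth C2) (C2pr : proper_curve C2).
Variables (phi : {rmorphism funfield C2 -> funfield C1}).
Variables (psi : funfield C1 -> funfield C2).
Hypotheses (phiK : cancel phi psi) (psiK : cancel psi phi).
Hypothesis phic : forall c, phi (const C2 c) = const C1 c.

(** Places are transported along [phi], and every place of the target is a point there. *)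
Lemma field_isomorphism_morphism : exists f : morphism C1 C2,
  pullback f = phi /\ forall P z, stalk (on_points f P) z <-> stalk P (phi z).
Proof.
have H P : exists Q, forall z, (stalk Q z <-> stalk P (phi z)) /\
   (max_ideal Q z <-> max_ideal P (phi z)).
  have [w Pw] := point_valuation C1sm P; case: (Pw) => -[wP wc] _.
  have uP : valuation (w \o phi) by apply: valuation_comp => // t; exists (psi t); rewrite psiK.
  have uP' : @place k C2 (w \o phi) by split=> // c; rewrite vge_comp phic.
  have [Q Qu] := place_point C2sm C2pr uP'; exists Q => z; split.
    by rewrite (stalkP _ Qu) (stalkP _ Pw) vge_comp.
  by rewrite (max_idealP _ Qu) (max_idealP _ Pw) vge_comp.
pose g P := projT1 (cid (H P)).
have gP P z : (stalk (g P) z <-> stalk P (phi z)) /\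
   (max_ideal (g P) z <-> max_ideal P (phi z)) by rewrite /g; case: cid.
have g1 P z : stalk (g P) z -> stalk P (phi z) by move=> /(gP P z).1.
have g2 P z : max_ideal (g P) z -> max_ideal P (phi z) by move=> /(gP P z).2.
by exists (Morphism phic g1 g2); split=> // P z; case: (gP P z).
Qed.

End CurveIsomorphism.

Lemma same_equation_isomorphism (k : fieldType) (C1 C2 : precurve k)
    (s1 : {rmorphism {fraction {poly k}} -> funfield C1}) (y1 : funfield C1)
    (s2 : {rmorphism {fraction {poly k}} -> funfield C2}) (y2 : funfield C2) (D : {poly k}) :
    smooth C1 -> proper_curve C1 -> smooth C2 -> proper_curve C2 ->
    quadratic_field s1 y1 D -> quadratic_field s2 y2 D ->
  exists f : morphism C1 C2, isomorphism f /\
    forall P, stalk (on_points f P) (s2 'X%:F) <-> stalk P (s1 'X%:F).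
Proof.
move=> sm1 pr1 sm2 pr2 sy1 sy2.
have [phi phiE] := same_equation_morphism sy1 sy2.
have [psi psiE] := same_equation_morphism sy2 sy1.
case: (sy1) => sc1 _ _ span1; case: (sy2) => sc2 _ _ span2.
have phiK : cancel phi psi.
  by move=> z; have [a [b ->]] := span2 z; rewrite phiE psiE.
have psiK : cancel psi phi.
  by move=> z; have [a [b ->]] := span1 z; rewrite psiE phiE.
have phis a : phi (s2 a) = s1 a.
  by have := phiE a 0; rewrite !rmorph0 !mul0r !addr0.
have psis a : psi (s1 a) = s2 a.
  by have := psiE a 0; rewrite !rmorph0 !mul0r !addr0.
have phic c : phi (const C2 c) = const C1 c by rewrite -sc1 -sc2 phis.
have psic c : psi (const C1 c) = const C2 c by rewrite -sc1 -sc2 psis.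
have [f [ef Hf]] := field_isomorphism_morphism sm1 sm2 pr2 psiK phic.
have [h [eh Hh]] := field_isomorphism_morphism sm2 sm1 pr1 phiK psic.
exists f; split; last by move=> P; rewrite Hf phis.
exists h; rewrite ef eh; split=> // P.
  apply: (stalk_inj sm1 pr1); apply/seteqP; split=> z.
    by rewrite Hh Hf psiK.
  by move=> H; apply/Hh/Hf; rewrite psiK.
apply: (stalk_inj sm2 pr2); apply/seteqP; split=> z.
  by rewrite Hf Hh phiK.
by move=> H; apply/Hf/Hh; rewrite phiK.
Qed.

Lemma square_quotient_clear (K : fieldType) (a b x : K) : b != 0 ->
  a ^+ 2 * x = b ^+ 2 * (a / b * (a / b) * x).
Proof. by move=> b0; field. Qed.

Section Compare.
Variables (k : fieldType) (C : precurve k).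
Local Notation K := (funfield C).
Local Notation F := {fraction {poly k}}.
Hypotheses (two : (2 : k) != 0) (Csm : smooth C) (Cpr : proper_curve C).
Variables (g : nat) (s s' : {rmorphism F -> K}) (y y' : K) (f f' : {poly k}).
Hypotheses (g0 : (0 < g)%N) (sy : quadratic_field s y f) (sy' : quadratic_field s' y' f').
Hypotheses (sepf : coprimep f f^`()) (sf : size f = (2 * g.+1)%N).
Hypotheses (sepf' : coprimep f' f'^`()) (sf' : size f' = (2 * g.+1)%N).

(** The function [x'] has its only pole at [w], of order 2, so it lies in k[x] + k[x] y and is a
    polynomial of degree 1 in [x]. Write [y' = A + B y]: its square lies in k(x), so [A = 0], and
    uniqueness of squarefree parts makes [B] constant. *)
Lemma compare_coordinates w : infinite_place s w -> infinite_place s' w ->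
  exists u v e, [/\ u != 0, e != 0 & f' = e ^+ 2 *: (f \Po affine_poly u v)].
Proof.
move=> wI wI'; case: (sy) => sc yD yF span; case: (sy') => sc' yD' yF' span'.
have wP : valuation w by case: wI => -[].
have [v Qv] := P1_valuation (None : P1_point k).
have y0 : y != 0.
  by apply/eqP => e; apply: (yF 0); rewrite rmorph0 e.
pose xi := s' 'X%:F.
have wxi : w xi = - 2 := infinite_place_X two sy' sf' wI'.
have [a [b exi]] : exists a b : {poly k}, xi = s a%:F + s b%:F * y.
  apply: (affine_integral two sy sepf) => u uP uX.
  apply: contraT => uX'; have uI : infinite_place s' u by split.
  have e := infinite_place_unique two sy' sf' uI wI'.
  case: wI => _ /negP[]; move: uX; rewrite /vge => /orP[->//|].
  by rewrite e ?sX_neq0 // => ->; rewrite orbT.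
have [Ha Hb] : vge w (-2) (s a%:F) /\ vge w (-2) (s b%:F * y).
  apply: (infinite_place_span two sy sf wI); rewrite -exi.
  by rewrite /vge wxi lexx orbT.
(* The pole order of [y] is [2g + 1 > 2], so [y] cannot occur in [xi]. *)
have b0 : b = 0.
  apply/eqP; apply: contraT => b0; move: Hb.
  have bF0 : b%:F != 0 :> F by rewrite tofrac_eq0.
  have sbF0 : s b%:F != 0 by rewrite fmorph_eq0 tofrac_eq0.
  rewrite (vge_neq0 _ _ (mulf_neq0 sbF0 y0)) (valM wP sbF0 y0).
  rewrite (infinite_place_y two sy sf wI) (infinite_place_val two sy sf wI Qv bF0).
  rewrite (infinite_val Qv b0); have := b0; rewrite -size_poly_gt0; move: g0.
  by move: (size b) => l; clear; lia.
have ea : xi = s a%:F by rewrite exi b0 tofrac0 rmorph0 mul0r addr0.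
have sa : (size a <= 2)%N.
  have [->|a0] := eqVneq a 0; first by rewrite size_poly0.
  have aF0 : a%:F != 0 :> F by rewrite tofrac_eq0.
  have saF0 : s a%:F != 0 by rewrite fmorph_eq0 tofrac_eq0.
  move: Ha; rewrite (vge_neq0 _ _ saF0) (infinite_place_val two sy sf wI Qv aF0).
  by rewrite (infinite_val Qv a0); move: (size a) => l; clear; lia.
pose u := a`_1; pose t := a`_0.
have ea2 : a = affine_poly u t.
  apply/polyP => i; rewrite /affine_poly coefD coefZ coefX coefC.
  case: i => [|[|i]] /=; rewrite ?mulr0 ?add0r ?mulr1 ?addr0 //.
  by rewrite nth_default // (leq_trans sa).
have u0 : u != 0.
  apply/eqP => u0; case: wI' => _ /negP[]; rewrite -/xi ea ea2 /affine_poly u0.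
  by rewrite scale0r add0r sc; case: wI => -[].
have sub : forall b, exists c, s' b = s c.
  by apply: (image_sub sc' sc); exists a%:F; rewrite -ea.
have comp : s (f' \Po a)%:F = s' f'%:F.
  by apply: (comp_substitution sc' sc); rewrite -ea.
have [A [B ey]] := span y'.
have e2 : s (f' \Po a)%:F + s 0 * y = s (A * A + B * B * f%:F) + s (A * B + B * A) * y.
  by rewrite rmorph0 mul0r addr0 comp -yD' expr2 {1 2}ey (span_mul yD).
have [e3 e4] := span_inj yF e2.
(* With [B = 0], [y'] would lie in k(x), which equals k(x'). *)
have nB : B != 0.
  apply/eqP => B0; have sub' : forall b, exists c, s b = s' c.
    apply: (image_sub sc sc'); exists ((u^-1%:P)%:F * ('X%:F - t%:P%:F)).
    have u'0 : const C u != 0 by rewrite fmorph_eq0.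
    rewrite (rmorphM s') (rmorphB s') !sc' -/xi ea ea2 /affine_poly -mul_polyC.
    rewrite (tofracD (u%:P * 'X) t%:P) (tofracM u%:P 'X) (rmorphD s) (rmorphM s) !sc.
    by rewrite addrK mulrA -rmorphM mulVf // rmorph1 mul1r.
  have [c ec] := sub' A; case: (yF' c); rewrite -ec ey B0.
  by rewrite rmorph0 mul0r addr0.
have A0 : A = 0.
  have /eqP : A * B + B * A = 0 by rewrite -e4.
  rewrite [B * A]mulrC -mulr2n -mulr_natl.
  have n2 : (2 : F) != 0.
    have -> : (2 : F) = (2 : k)%:P%:F by rewrite !rmorph_nat.
    by rewrite tofrac_eq0 polyC_eq0.
  rewrite (mulf_eq0 2) (negbTE n2) /= mulf_eq0 (negbTE nB) orbF.
  by move/eqP.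
have [be [ga [ga0 eB]]] := frac_quotient B.
have be0 : be != 0.
  by apply: contraNneq nB => be0; rewrite eB be0 tofrac0 mul0r.
have gaF0 : ga%:F != 0 :> F by rewrite tofrac_eq0.
have E : be ^+ 2 * f = ga ^+ 2 * (f' \Po a).
  apply/eqP; rewrite -tofrac_eq (tofracM (be ^+ 2) f) (tofracM (ga ^+ 2) (f' \Po a)) e3 A0.
  rewrite mulr0 add0r !tofracXn eB; apply/eqP.
  exact: square_quotient_clear.
have da : a^`() = u%:P by rewrite ea2 deriv_affine_poly.
have sepfa := coprime_deriv_comp u0 da sepf'.
have [e e0 [_ ef]] := square_separable_unique be0 ga0 sepf sepfa E.
have e'0 : e^-1 != 0 by rewrite invr_eq0.
exists u^-1, (- (u^-1 * t)), e^-1; rewrite invr_eq0; split=> //.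
rewrite ef comp_polyZ ea2 comp_affine_polyK // scalerA -exprMn mulVf //.
by rewrite expr1n scale1r.
Qed.

End Compare.

(** Comparing leading coefficients gives [e^2 u^(2n+1) = 1], so [u] is the square of [(e u^n)^-1].
    This is why the affine group is parametrized by [w] acting through [w ^+ 2]. *)
Lemma monic_change_square (k : fieldType) (n : nat) (f f' : {poly k}) u v e :
  f \is monic -> f' \is monic -> size f = (2 * n.+1)%N -> u != 0 -> e != 0 ->
  f' = e ^+ 2 *: (f \Po affine_poly u v) ->
  exists2 w, w != 0 & f' = w ^- (2 * (2 * n + 1)) *: (f \Po affine_poly (w ^+ 2) v).
Proof.
move=> fm f'm sf u0 e0 ef.
have := monicP f'm; rewrite ef lead_coefZ lead_coef_comp_affine // (monicP fm) mul1r sf.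
have -> : (2 * n.+1).-1 = (2 * n + 1)%N by lia.
move=> E; pose w := (e * u ^+ n)^-1.
have eu0 : e * u ^+ n != 0 by rewrite mulf_neq0 ?expf_neq0.
have w2 : w ^+ 2 = u.
  apply: (mulfI (expf_neq0 2 eu0)); rewrite /w exprVn divff ?expf_neq0 //.
  by rewrite exprMn -exprM -mulrA -exprSr mulnC -[(2 * n).+1]addn1 E.
have w0 : w != 0 by rewrite invr_eq0.
exists w => //; rewrite w2 exprM w2; congr (_ *: _).
by apply: (mulIf (expf_neq0 (2 * n + 1) u0)); rewrite mulVf ?expf_neq0.
Qed.

Lemma finite_degree2P (F K : fieldType) (s : {rmorphism F -> K}) : finite_degree s 2 ->
  exists e0 e1, (forall z, exists a b, z = s a * e0 + s b * e1) /\
    forall a b a' b', s a * e0 + s b * e1 = s a' * e0 + s b' * e1 -> a = a' /\ b = b'.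
Proof.
move=> [e He]; exists (e ord0), (e (lift ord0 ord0)).
have sumE (c : {ffun 'I_2 -> F}) : \sum_(i < 2) s (c i) * e i =
    s (c ord0) * e ord0 + s (c (lift ord0 ord0)) * e (lift ord0 ord0).
  by rewrite big_ord_recl big_ord1.
split=> [z|a b a' b' E].
  by have [c [ec _]] := He z; exists (c ord0), (c (lift ord0 ord0)); rewrite -sumE.
pose f (a b : F) : {ffun 'I_2 -> F} := [ffun i => if i == ord0 then a else b].
have [c [_ Hc]] := He (s a * e ord0 + s b * e (lift ord0 ord0)).
have H1 : c = f a b by apply: Hc; rewrite sumE !ffunE.
have H2 : c = f a' b' by apply: Hc; rewrite sumE !ffunE.
move: H2; rewrite H1 => /ffunP H.
by have := H ord0; have := H (lift ord0 ord0); rewrite !ffunE.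
Qed.

Lemma finite_degree2_of_span (F K : fieldType) (s : {rmorphism F -> K}) y :
  (forall a, s a <> y) -> (forall z, exists a b, z = s a + s b * y) -> finite_degree s 2.
Proof.
move=> yF span; pose e (i : 'I_2) := if i == ord0 then 1 else y.
have sumE (c : {ffun 'I_2 -> F}) : \sum_(i < 2) s (c i) * e i =
    s (c ord0) + s (c (lift ord0 ord0)) * y.
  by rewrite big_ord_recl big_ord1 /e /= mulr1.
exists e => z.
have [a [b ->]] := span z; exists [ffun i => if i == ord0 then a else b].
split=> [|c]; rewrite sumE ?ffunE //; move => /(span_inj yF)[ea eb].
apply/ffunP => i; rewrite ffunE; case: (unliftP ord0 i) => [j ->|->] /=; last exact: ea.
by rewrite eb; congr (c _); apply/val_inj; case: j => [[|]].
Qed.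

(** First a basis of the form [1, w] is extracted from the given one, by exchanging against 1 a
    basis vector with nonzero coefficient in it; then the square is completed. *)
Lemma degree2_square_root (F K : fieldType) (s : {rmorphism F -> K}) : (2 : F) != 0 ->
  finite_degree s 2 -> exists y D, [/\ y ^+ 2 = s D, forall a, s a <> y
    & forall z, exists a b, z = s a + s b * y].
Proof.
move=> n2 /finite_degree2P[e0 [e1 [span inj]]].
have [w [wF spanw]] : exists w, (forall a, s a <> w) /\
    forall z, exists a b, z = s a + s b * w.
  have [x0 [x1 E1]] := span 1.
  have inj0 a b : s a * e0 + s b * e1 = 0 -> a = 0 /\ b = 0.
    by move=> E; apply: inj; rewrite E !rmorph0 !mul0r addr0.
  have [x10|x10] := eqVneq x1 0.
    have x00 : x0 != 0.
      apply/eqP => x00; move/eqP: E1; rewrite x00 x10 !rmorph0 !mul0r addr0.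
      by rewrite oner_eq0.
    have sx00 : s x0 != 0 by rewrite fmorph_eq0.
    have ee0 : e0 = s x0^-1.
      by apply: (mulfI sx00); rewrite fmorphV divff // E1 x10 rmorph0 mul0r addr0.
    exists e1; split=> [a ea|z].
      have /inj0[_ /eqP] : s (- (a * x0)) * e0 + s 1 * e1 = 0.
        rewrite -ea rmorphN rmorphM rmorph1 mul1r ee0 mulNr -mulrA -rmorphM divff //.
        by rewrite rmorph1 mulr1 addNr.
      by rewrite oner_eq0.
    have [a [b ->]] := span z; exists (a / x0), b.
    by rewrite ee0 rmorphM.
  have sx10 : s x1 != 0 by rewrite fmorph_eq0.
  have ee1 : e1 = s x1^-1 + s (- (x0 / x1)) * e0.
    apply: (mulfI sx10); rewrite rmorphN rmorphM fmorphV.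
    have -> : s x1 * e1 = 1 - s x0 * e0 by rewrite E1; ring.
    by field.
  exists e0; split=> [a ea|z].
    have /inj0[/eqP] : s (1 - a * x0) * e0 + s (- (a * x1)) * e1 = 0.
      rewrite rmorphB rmorph1 rmorphN !rmorphM -[s a * s x0 in LHS]mulrC.
      have -> : (1 - s x0 * s a) * e0 + - (s a * s x1) * e1 =
        e0 - s a * (s x0 * e0 + s x1 * e1) by ring.
      by rewrite -E1 mulr1 ea subrr.
    rewrite subr_eq0 => /eqP H /eqP; rewrite oppr_eq0 mulf_eq0 (negbTE x10) orbF => /eqP a0.
    by move/eqP: H; rewrite a0 mul0r oner_eq0.
  have [a [b ->]] := span z; exists (b / x1), (a - b * x0 / x1).
  by rewrite ee1 rmorphB !rmorphM rmorphN fmorphV rmorphM fmorphV; ring.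
have [al [be ew]] := spanw (w ^+ 2).
have sn2 : (2 : K) != 0 by rewrite -(rmorph_nat s) fmorph_eq0.
(* Completing the square in [w^2 = al + be w]. *)
exists (w - s (be / 2)), (al + (be / 2) ^+ 2); split=> [|a ea|z].
- rewrite sqrrB ew rmorphD rmorphXn rmorphM fmorphV rmorph_nat.
  by field.
- by apply: (wF (a + be / 2)); rewrite rmorphD ea subrK.
have [a [b ->]] := spanw z; exists (a + b * (be / 2)), b.
by rewrite rmorphD (rmorphM s b); ring.
Qed.

Lemma quotient_square_clear (K : fieldType) (a b c h : K) : b != 0 -> c != 0 ->
  h * c ^+ 2 = a * b -> (b / c) ^+ 2 * (a / b) = h.
Proof.
move=> b0 c0 e; apply: (mulIf (expf_neq0 2 c0)); rewrite e.
by field; rewrite b0 c0.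
Qed.

(** * The equation of a pointed curve *)

Section PointedCurve.
Variables (k : finFieldType) (g : nat) (X : pointed_hyperelliptic_curve k g).
Hypothesis two : (2 : k) != 0.
Local Notation F := {fraction {poly k}}.

Definition presented (C : precurve k) (P : point C) (f : {poly k}) : Prop :=
  exists (s : {rmorphism F -> funfield C}) y w,
    [/\ quadratic_field s y f, is_point_valuation P w & infinite_place s w].

Definition hyperelliptic_poly (f : {poly k}) : Prop :=
  [/\ f \is monic, coprimep f f^`() & size f = (2 * g.+1)%N].

Let C := curve_of X.
Let P := base_point X.
Let K := funfield C.

Lemma curve_of_smooth : smooth C. Proof. by case: (curve_ofP X) => _ []. Qed.
Lemma curve_of_proper : proper_curve C. Proof. by case: (curve_ofP X) => _ []. Qed.

(** If the image of [P] is not infinity, rationality of [P] gives a constant [c] with [x - c]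
    vanishing at [P], and [1 / (x - c)] is a coordinate of the same line with a pole there.
    Ramification says that its inverse has value at least 2. *)
Let ramified_coordinate : exists (s0 s : {rmorphism F -> K}) w,
  [/\ finite_degree s0 2,
     (forall a, exists b, s0 a = s b) /\ (forall a, exists b, s a = s0 b),
     forall c, s c%:P%:F = const C c,
     is_point_valuation P w & infinite_place s w /\ vge w 2 (s ('X%:F)^-1)].
Proof.
have [f [f2 fram]] := base_point_weierstrass X.
set s0 := pullback f in f2.
have [w Pw] := point_valuation curve_of_smooth P.
have s0c c : s0 c%:P%:F = const C c := pullback_const f c.
case: (Pw) => wpl _; case: (wpl) => wP wc.
have X0 : 'X%:F != 0 :> F by rewrite tofrac_eq0 polyX_eq0.
have ram z : max_ideal (on_points f P) z -> vge w 2 (s0 z).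
  move=> /fram[x [x' [/(max_idealP _ Pw) Hx /(max_idealP _ Pw) Hx' ->]]].
  exact: (vgeM wP Hx Hx').
have [v Qv] := P1_valuation (on_points f P).
have vP : valuation v by case: Qv.
have maxv z : @max_ideal k (P1 k) (on_points f P) z <-> vge v 1 z.
  case: Qv => _ e _; rewrite /max_ideal /= e; exact: nonunits_valring.
have stv z : vge v 0 z -> vge w 0 (s0 z).
  move=> /(P1_stalkP _ Qv) H; apply/(stalkP _ Pw); exact: (@pullback_stalk _ _ _ f P z H).
case E : (on_points f P) Qv => [[p pP]|] Qv; last first.
  exists s0, s0, w.
  have H2 : vge w 2 (s0 ('X%:F)^-1).
    apply/ram/maxv; case: Qv => _ _ /= e.
    by rewrite /vge e lexx orbT.
  split=> //; first by split=> a; exists a.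
  split=> //; split=> //; move: H2; have X'0 : s0 ('X%:F)^-1 != 0 by rewrite fmorph_eq0 invr_eq0 tofrac_eq0 polyX_eq0.
  have sX0 : s0 'X%:F != 0 by rewrite fmorph_eq0 tofrac_eq0 polyX_eq0.
  rewrite (vge_neq0 _ _ X'0) (vge_neq0 _ _ sX0) fmorphV (valV wP sX0).
  by move: (w _) => x; clear; lia.
have vX : vge v 0 'X%:F := finite_vge0 Qv 'X.
have [c Hc] : exists c : k, vge w 1 (s0 'X%:F - const C c).
  have [c] := base_point_rational ((stalkP _ Pw).2 (stv _ vX)).
  by move/(max_idealP _ Pw); exists c.
have Xc : 'X - c%:P != 0 by rewrite polyXsubC_eq0.
have XcF : ('X - c%:P)%:F != 0 :> F by rewrite tofrac_eq0.
have sXc : s0 ('X - c%:P)%:F = s0 'X%:F - const C c.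
  by rewrite (tofracB 'X c%:P) (rmorphB s0) s0c.
have vXc : vge v 1 ('X - c%:P)%:F.
  apply: contraT => H; have [_ v0] := val_eq0 (finite_vge0 Qv ('X - c%:P)) H.
  have : vge v 0 (('X - c%:P)%:F)^-1 by rewrite /vge (valV vP XcF) v0 oppr0 lexx orbT.
  move/stv; rewrite fmorphV sXc => Hi.
  have sn0 : s0 'X%:F - const C c != 0 by rewrite -sXc fmorph_eq0 tofrac_eq0.
  by have := vgeM wP Hc Hi; rewrite divff // vge_neq0 ?oner_neq0 // (val1 wP).
have H2 : vge w 2 (s0 ('X - c%:P)%:F) by apply/ram/maxv.
have sn0 : s0 ('X - c%:P)%:F != 0 by rewrite fmorph_eq0 tofrac_eq0.
have wxi : ~~ vge w 0 (s0 ('X - c%:P)%:F)^-1.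
  rewrite vge_neq0 ?invr_eq0 // (valV wP sn0); move: H2; rewrite vge_neq0 //.
  by move: (w _) => x; clear; lia.
have [s [sc sX]] := substitution_exists wpl wxi.
exists s0, s, w; split=> //.
- split; last by apply: (image_sub sc s0c); exists (('X - c%:P)%:F)^-1; rewrite fmorphV sX.
  apply: (image_sub s0c sc); exists (('X%:F)^-1 + c%:P%:F).
  by rewrite (rmorphD s) fmorphV sX invrK sc sXc subrK.
- by split; [split=> //; rewrite sX|rewrite fmorphV sX invrK].
Qed.

Theorem pointed_curve_presented : exists2 f, hyperelliptic_poly f & presented P f.
Proof.
have [s0 [s [w [deg [im im'] sc Pw [wI ram]]]]] := ramified_coordinate.
have n2 : (2 : F) != 0.
  have -> : (2 : F) = (2 : k)%:P%:F by rewrite !rmorph_nat.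
  by rewrite tofrac_eq0 polyC_eq0.
have [y [D0 [yD yF span]]] := degree2_square_root n2 deg.
have [a0 ea0] := im D0; have [a [b [b0 eab]]] := frac_quotient a0.
have bF0 : b%:F != 0 :> F by rewrite tofrac_eq0.
have y0 : y != 0 by apply/eqP => e; apply: (yF 0); rewrite rmorph0 e.
have a'0 : a != 0.
  apply: contraNneq y0 => a'0; move/eqP: yD; rewrite ea0 eab a'0 tofrac0 mul0r rmorph0.
  by rewrite sqrf_eq0.
have [c [h [c0 eh ch]]] := separable_part (mulf_neq0 a'0 b0).
have cF0 : c%:F != 0 :> F by rewrite tofrac_eq0.
(* From [y^2 = a / b] and [a b = c^2 h] one gets [(b y / c)^2 = h]. *)
pose q : F := b%:F / c%:F.
have q0 : q != 0 := mulf_neq0 bF0 (invr_neq0 cF0).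
have sq0 : s q != 0 by rewrite fmorph_eq0; exact: q0.
have sy : quadratic_field s (s q * y) h.
  split=> // [|x ex|z].
  - rewrite exprMn yD ea0 -(rmorphXn s) -(rmorphM s); congr (s _).
    have eh' : h%:F * c%:F ^+ 2 = a%:F * b%:F :> F.
      by rewrite -tofracXn -!tofracM eh mulrC.
    by rewrite eab; exact: (quotient_square_clear bF0 cF0 eh').
  - have [x' ex'] := im' (x / q); apply: (yF x').
    by rewrite -ex' (fmorph_div s x q) ex mulrC mulKf.
  - have [x [x' ->]] := span z; have [x1 ->] := im x; have [x2 ->] := im x'.
    by exists x1, (x2 / q); rewrite (fmorph_div s x2 q) mulrA divfK.
have [_ [_ sm pr _] gX _] := curve_ofP X.
(* An odd [size], that is, an even degree, would make [1/x] a uniformizer at [P], whereas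
   ramification gives it value at least 2. *)
have [n sh] : exists n, size h = (2 * n.+1)%N.
  have h0 : h != 0 := quadratic_D_neq0 sy.
  have := odd_double_half (size h); case: (odd (size h)) => /= esz.
    have sh : size h = (2 * (size h)./2).+1 by rewrite -[LHS]esz mul2n.
    have := even_infinite_place_unramified two sy sh wI => w1.
    have X0 : s ('X%:F)^-1 != 0 by rewrite fmorph_eq0 invr_eq0 tofrac_eq0 polyX_eq0.
    by move: ram; rewrite (vge_neq0 _ _ X0) w1.
  exists (size h)./2.-1; move: h0 esz; rewrite -size_poly_gt0 add0n -mul2n.
  by move: (size h)./2 (size h) => m l; clear; lia.
have gn := hyperelliptic_genus two sy ch sh sm pr.
have en : n = g := genus_unique sm gn gX.
rewrite en in sh.
pose l := lead_coef h.
have l0 : l != 0 by rewrite lead_coef_eq0; apply: (quadratic_D_neq0 sy).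
have u0 : l^-1 != 0 by rewrite invr_eq0.
have e0 : l ^+ g != 0 by rewrite expf_neq0.
(* Replacing [x] by [l^-1 x] and [y] by [l^g y] gives the leading coefficient
   [l^(2g) * l * l^-(2g+1) = 1]. *)
have [s' [sy' wI']] := change_coordinates sy 0 wI u0 e0.
exists ((l ^+ g) ^+ 2 *: (h \Po affine_poly l^-1 0)); last by exists s', (const C (l ^+ g) * (s q * y)), w.
have E20 : (l ^+ g) ^+ 2 != 0 by rewrite expf_neq0.
split.
- rewrite monicE lead_coefZ lead_coef_comp_affine // sh -/l -exprM.
  have -> : (2 * g.+1).-1 = (g * 2).+1 by clear; lia.
  by rewrite exprVn exprS invfM (mulVKf l0) divff ?expf_neq0.
- rewrite coprime_derivZ //; apply: (coprime_deriv_comp u0) => //.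
  exact: deriv_affine_poly.
- by rewrite size_scale // size_comp_affine.
Qed.

End PointedCurve.

(** * Existence of a pointed curve with a given equation *)

Lemma quadratic_extension (F : fieldType) (d : F) : (forall c, c ^+ 2 != d) ->
  exists (K : fieldType) (s : {rmorphism F -> K}) (y : K),
    [/\ y ^+ 2 = s d, forall a, s a <> y & forall z, exists a b, z = s a + s b * y].
Proof.
move=> nd; pose h : {poly F} := 'X^2 - d%:P.
have sh : size h = 3%N by rewrite /h size_XnsubC.
have hm : h \is monic by rewrite /h monicXnsubC.
have hI : monic_irreducible_poly h.
  split=> //; apply: cubic_irreducible; first by rewrite sh.
  by move=> c; rewrite rootE /h !hornerE subr_eq0 nd.
pose K : fieldType := {poly %/ h with hI}.
have mkh : mk_monic h = h by rewrite mk_monicE.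
pose s : {rmorphism F -> K} := qpolyC h.
have in0 (p : {poly F}) : h %| p -> in_qpoly h p = 0 :> K.
  by move=> /dvdpP[q ->]; apply/val_inj; rewrite /= mkh Pdiv.RingMonic.rmodp_mull.
have inC c : in_qpoly h c%:P = s c.
  by apply/val_inj/in_qpoly_small; rewrite mkh sh (leq_ltn_trans (size_polyC_leq1 _)).
have inX : ('qX : {poly %/ h}) = 'X :> {poly F} by rewrite qpolyXE // sh.
exists K, s, ('qX : {poly %/ h}); split.
- apply/eqP; rewrite -subr_eq0; apply/eqP.
  rewrite -inC -[('qX : {poly %/ h})]/(in_qpoly h 'X) -rmorphXn -rmorphB.
  exact: in0.
- move=> a /(congr1 val) /=; rewrite -[X in _ = X -> _]/(('qX : {poly %/ h}) : {poly F}) inX.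
  move=> /(congr1 (fun p : {poly F} => p`_1)); rewrite coefC coefX /= => /eqP.
  by rewrite eq_sym oner_eq0.
move=> z; pose p : {poly F} := val z.
have sp : (size p <= 2)%N by rewrite -ltnS (leq_trans (size_mk_monic z)) // mkh sh.
exists p`_0, p`_1.
have ep : p = (p`_0)%:P + (p`_1)%:P * 'X.
  apply/polyP => i; rewrite coefD coefC coefCM coefX.
  case: i => [|[|i]] /=; rewrite ?mulr0 ?mulr1 ?addr0 ?add0r //.
  by rewrite nth_default // (leq_trans sp).
have -> : z = in_qpoly h p by apply/esym/val_inj/in_qpoly_small; rewrite mkh sh.
rewrite [in LHS]ep -!inC -[('qX : {poly %/ h})]/(in_qpoly h 'X).
by rewrite rmorphD rmorphM.
Qed.

Section Model.
Variables (k : finFieldType) (g : nat) (f : {poly k}).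
Hypotheses (two : (2 : k) != 0) (g1 : (1 < g)%N) (fP : hyperelliptic_poly g f).
Local Notation F := {fraction {poly k}}.

Let sf : size f = (2 * g.+1)%N. Proof. by case: fP. Qed.
Let cf : coprimep f f^`(). Proof. by case: fP. Qed.

(** [f] has odd degree, hence odd value at infinity. *)
Lemma hyperelliptic_poly_nonsquare (c : F) : c ^+ 2 != f%:F.
Proof.
apply/eqP => e; have [v Qv] := P1_valuation (None : P1_point k).
have vP : valuation v by case: Qv.
have f0 : f != 0 by rewrite -size_poly_gt0 sf.
have fF0 : f%:F != 0 :> F by rewrite tofrac_eq0.
have c0 : c != 0.
  apply/eqP => c0; move: e; rewrite c0 expr0n => /esym /eqP.
  by rewrite tofrac_eq0 (negbTE f0).
have := valX vP 2 c0; rewrite e (infinite_val Qv f0) sf.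
by move: (v c) => x; clear; lia.
Qed.

Section Construction.
Variables (K : fieldType) (s : {rmorphism F -> K}) (y : K).
Hypotheses (yD : y ^+ 2 = s f%:F) (yF : forall a, s a <> y).
Hypothesis span : forall z, exists a b, z = s a + s b * y.

Let c : {rmorphism k -> K} := (s \o (@P1_const k))%FUN.

(** [discrete_valuation_ring] is stated for a precurve but reads off only the function field and the
    constants; [C0] supplies these so that the points of [C] can be defined. *)
Let C0 : precurve k := @Precurve k K c unit (fun=> setT).

(* The abstract curve of the function field K: its points are all the discrete
   valuation rings of K over k. *)
Let C : precurve k :=
  @Precurve k K c {O : set K | @discrete_valuation_ring k C0 O} (fun O => sval O).

Let sy : @quadratic_field k C s y f.
Proof. by split. Qed.

Let Csm : smooth C. Proof. by move=> [O HO]. Qed.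

Let Cpr : proper_curve C.
Proof.
move=> V HV; exists (exist _ V HV); split; first by split.
move=> [O HO] [/= OV _].
have [v [vP eO]] := dvr_valuation HO; have [w [wP eV]] := dvr_valuation HV.
have eq : V = O.
  rewrite eO eV; symmetry; apply: valring_eq; apply: valring_max => //.
  by rewrite -eO -eV.
by apply: eq_exist.
Qed.

Let infP : exists P w, @is_point_valuation k C P w /\ @infinite_place k C s w.
Proof. exact: (infinite_point_exists two sy sf Csm Cpr). Qed.

Let degF : finite_degree s 2. Proof. exact: finite_degree2_of_span yF span. Qed.

Let Ccurve : smooth_projective_curve C.
Proof.
split=> //; first by exists s, 2.
have [P [w [Pw wI]]] := infP.
apply: (rational_place_geometrically_irreducible wI.1) => z.
exact: (infinite_place_residue two sy cf sf wI).
Qed.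

Let projection : exists h : morphism C (P1 k), pullback h = s.
Proof.
have H P : exists Q : P1_point k, forall z,
    (P1_stalk Q z -> stalk (p := C) P (s z)) /\
    (@max_ideal k (P1 k) Q z -> max_ideal (C := C) P (s z)).
  have [w Pw] := point_valuation Csm P; case: (Pw) => wpl _; case: (wpl) => wP _.
  have [Q [v [Qv vw]]] := place_lies_over wP (fun a => place_const sy a wpl) (place_nontrivial sy wpl).
  exists Q => z; split.
    by move=> /(P1_stalkP _ Qv) Hz; apply/(stalkP _ Pw); apply: (vw _).1.
  have -> : @max_ideal k (P1 k) Q z <-> vge v 1 z.
    by case: (Qv) => vP e _; rewrite /max_ideal /= e; exact: nonunits_valring.
  by move=> Hz; apply/(max_idealP _ Pw); apply: (vw _).2.
pose h P := projT1 (cid (H P)).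
have hP P z : (P1_stalk (h P) z -> stalk (p := C) P (s z)) /\
    (@max_ideal k (P1 k) (h P) z -> max_ideal (C := C) P (s z)) by rewrite /h; case: cid.
have sc a : s (const (P1 k) a) = const C a by [].
by exists (@Morphism k C (P1 k) h s sc (fun P z => (hP P z).1) (fun P z => (hP P z).2)).
Qed.

Let Chyp : hyperelliptic_curve g C.
Proof.
split=> //; first exact: (hyperelliptic_genus two sy cf sf Csm Cpr).
by have [h eh] := projection; exists h; rewrite /has_degree eh.
Qed.

Lemma model_curve : exists X : pointed_hyperelliptic_curve k g,
  presented (base_point X) f.
Proof.
have [P [w [Pw wI]]] := infP.
have Prat : rational_point P.
  move=> z /(stalkP _ Pw) Hz; have [a Ha] := infinite_place_residue two sy cf sf wI Hz.
  by exists a; apply/(max_idealP _ Pw).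
have Pw' : weierstrass_point P.
  have [h eh] := projection; exists h; split; first by rewrite /has_degree eh.
  case: (wI) => wpl wX; case: (wpl) => wP _.
  have ehP : on_points h P = None.
    case E : (on_points h P) => [[p pP]|] //.
    have X0 : P1_stalk (on_points h P) 'X%:F.
      have [v Qv] := P1_valuation (Some (exist _ p pP)).
      by rewrite E; apply/(P1_stalkP _ Qv); apply: (finite_vge0 Qv).
    have := @pullback_stalk _ _ _ h P _ X0; rewrite eh => /(stalkP _ Pw).
    by rewrite (negbTE wX).
  move=> z; rewrite ehP eh; have [v Qv] := P1_valuation (None : P1_point k).
  have vP : valuation v by case: Qv.
  have -> : @max_ideal k (P1 k) None z <-> vge v 1 z.
    by case: (Qv) => _ e _; rewrite /max_ideal -[stalk _]/(P1_stalk _) e; exact: nonunits_valring.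
  (* The ramification index at infinity is 2, so [s z] has value at least 2 and remains in the
     maximal ideal after division by a uniformizer [t]. *)
  move=> Hz; have [t [t0 wt]] := val_uniformizer wP; exists t, (t^-1 * s z); split.
  - by apply/(max_idealP _ Pw); rewrite vge_neq0 ?wt.
  - apply/(max_idealP _ Pw); rewrite vge_mul_eq ?invr_eq0 // valV // wt.
    have [->|z0] := eqVneq z 0; first by rewrite rmorph0 vge0.
    have sz0 : s z != 0 by rewrite fmorph_eq0; exact: z0.
    rewrite (vge_neq0 _ _ sz0) (infinite_place_val two sy sf wI Qv z0).
    by move: Hz; rewrite (vge_neq0 _ _ z0); move: (v z) => x; clear; lia.
  - by rewrite mulrA divff // mul1r.
exists (PointedHyperellipticCurve Chyp Prat Pw'); exists s, y, w.
by split.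
Qed.

End Construction.

Lemma model_exists : exists X : pointed_hyperelliptic_curve k g, presented (base_point X) f.
Proof.
have [K [s [y [yD yF span]]]] := quadratic_extension hyperelliptic_poly_nonsquare.
exact: (model_curve yD yF span).
Qed.

End Model.

(** * Classification *)

Section Classification.
Variables (k : finFieldType) (g : nat).
Hypotheses (two : (2 : k) != 0) (g1 : (1 < g)%N).
Implicit Types (X Y : pointed_hyperelliptic_curve k g) (f : {poly k}).

Lemma isomorphic_presented X Y f : pointed_isomorphic X Y ->
  presented (base_point Y) f -> presented (base_point X) f.
Proof.
move=> [m [[m' [mK _ pK pK']] eP]] [s [y [w [sy Pw [wpl wX]]]]].
case: (sy) => sc yD yF span.
have [w' Pw'] := point_valuation (@curve_of_smooth k g X) (base_point X).
exists (pullback m \o s)%FUN, (pullback m y), w'; split=> //.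
  split=> [c|//=|a /(can_inj pK)|z /=].
  - by rewrite /= sc pullback_const.
  - by rewrite -rmorphXn yD.
  - exact: yF.
  - have [a [b e]] := span (pullback m' z); exists a, b.
    by rewrite -(rmorphM (pullback m)) -(rmorphD (pullback m)) -e pK'.
split; first by case: Pw'.
apply: contra wX => /(stalkP _ Pw') H; apply/(stalkP _ Pw).
have : stalk (on_points m' (base_point Y)) (pullback m (s 'X%:F)) by rewrite -eP mK.
by move/pullback_stalk; rewrite pK.
Qed.

Lemma presented_isomorphic X Y f : size f = (2 * g.+1)%N ->
  presented (base_point X) f -> presented (base_point Y) f -> pointed_isomorphic X Y.
Proof.
move=> sf [s [y [w [sy Pw [wpl wX]]]]] [s' [y' [w' [sy' Pw' wI']]]].
have [m [mI mX]] := same_equation_isomorphism (@curve_of_smooth k g X) (@curve_of_proper k g X)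
  (@curve_of_smooth k g Y) (@curve_of_proper k g Y) sy sy'.
exists m; split=> //.
have [u Qu] := point_valuation (@curve_of_smooth k g Y) (on_points m (base_point X)).
apply: (infinite_point_unique two sy' sf (@curve_of_smooth k g Y) (@curve_of_proper k g Y) Qu _ Pw' wI').
split; first by case: Qu.
by apply: contra wX => /(stalkP _ Qu)/mX/(stalkP _ Pw).
Qed.

(** In both presentations the place at infinity is that of the base point, so the coordinates can be
    compared; monicity turns the change into an element of the group. *)
Lemma presented_equivalent X f f' : hyperelliptic_poly g f -> hyperelliptic_poly g f' ->
  presented (base_point X) f -> presented (base_point X) f' ->
  exists x : affine_group k, f' = affine_act (2 * g + 1) x f.
Proof.
move=> [fm cf sf] [fm' cf' sf'] [s [y [w [sy Pw wI]]]] [s' [y' [w' [sy' Pw' [_ wX']]]]].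
have wI' : infinite_place s' w.
  split; first by case: Pw.
  by apply: contra wX' => /(stalkP _ Pw)/(stalkP _ Pw').
have [u [v [e [u0 e0 ef]]]] := compare_coordinates two (ltnW g1) sy sy' cf sf cf' sf' wI wI'.
have [t t0 et] := monic_change_square fm fm' sf u0 e0 ef.
have tU : t \is a GRing.unit by rewrite unitfE.
by exists ((FinRing.unit k tU, v) : affine_group k).
Qed.

Lemma presented_act X f (x : affine_group k) :
  presented (base_point X) f -> presented (base_point X) (affine_act (2 * g + 1) x f).
Proof.
move=> [s [y [w [sy Pw wI]]]]; have t0 := unit_neq0 x.1.
have e0 : unit_val x.1 ^- (2 * g + 1) != 0 by rewrite invr_eq0 expf_neq0.
have [s' [sy' wI']] := change_coordinates sy x.2 wI (expf_neq0 2 t0) e0.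
exists s', (const (curve_of X) (unit_val x.1 ^- (2 * g + 1)) * y), w.
have -> : affine_act (2 * g + 1) x f = (unit_val x.1 ^- (2 * g + 1)) ^+ 2 *: (f \Po affine_poly (unit_val x.1 ^+ 2) x.2).
  by rewrite /affine_act exprVn -exprM mulnC.
by split.
Qed.

Lemma hyperelliptic_polyP f : hyperelliptic_poly g f <-> monic_of (2 * g + 1) f /\ separable f.
Proof.
have e : (2 * g.+1 = (2 * g + 1).+1)%N by clear; lia.
split=> [[fm cf sf]|[/andP[fm /eqP sf] cf]]; last by split=> //; rewrite e.
by rewrite /monic_of fm sf e eqxx.
Qed.

Local Notation n := (2 * g + 1)%N.
Local Notation classes := (affine_classes k n).

(** The representatives are curves presented by one polynomial from each orbit. A curve [X] goes to
    the orbit of any polynomial presenting it: equations in one orbit present the same curve, and an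
    isomorphism pulls a presentation of the representative back to [X], where any two presentations
    are equivalent. *)
Lemma pointed_isomorphism_classes : num_classes (@pointed_isomorphic k g) #|classes|.
Proof.
have H (i : 'I_#|classes|) : exists a X, [/\ a \in separable_monics k n,
    enum_val i = orbit (monic_action k n) [set: affine_group k]%SET a :> {set _}
    & presented (base_point X) (to_monic a)].
  have /affine_classesP[a aS ea] := enum_valP i.
  have fa : hyperelliptic_poly g (to_monic a).
    by apply/hyperelliptic_polyP; move: aS; rewrite inE => aS; split=> //; apply: to_monicP.
  by have [X HX] := model_exists two g1 fa; exists a, X.
have [a /choice[r Hr]] := choice H; exists r => X.
have [f fP Xf] := pointed_curve_presented X two.
have [fM fS] := (hyperelliptic_polyP f).1 fP.
pose b : {poly_n k} := of_monic n f; have eb : to_monic b = f by rewrite of_monicK.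
have bS : b \in separable_monics k n by rewrite inE eb.
have bC : orbit (monic_action k n) [set: affine_group k]%SET b \in classes by apply/affine_classesP; exists b.
pose i := enum_rank_in bC (orbit (monic_action k n) [set: affine_group k]%SET b).
have ei : enum_val i = orbit (monic_action k n) [set: affine_group k]%SET b by rewrite enum_rankK_in.
have [aS ea Pa] := Hr i.
exists i; split.
  have : a i \in orbit (monic_action k n) [set: affine_group k]%SET b.
    by rewrite -ei ea orbit_refl.
  move=> /orbitP[x _ ex].
  apply: (@presented_isomorphic X (r i) (to_monic (a i))) => //.
    by have := to_monicP (a i) => /andP[_ /eqP ->]; clear; lia.
  rewrite -ex /= monic_actE eb; exact: presented_act.
move=> j Xj; have [ajS eaj Pj] := Hr j.
have Xj' := isomorphic_presented Xj Pj.
have faj : hyperelliptic_poly g (to_monic (a j)).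
  by apply/hyperelliptic_polyP; split; [apply: to_monicP|move: ajS; rewrite inE].
have [x ex] := presented_equivalent fP faj Xf Xj'.
apply: enum_val_inj; rewrite ei eaj; apply/esym/orbit_eqP/orbitP; exists x; first by rewrite inE.
by apply: to_monic_inj; rewrite /= monic_actE eb ex.
Qed.

End Classification.

Theorem theorem3p2 (k : finFieldType) (p : nat) (hp : p \in [pchar k])
    (hodd : odd p) (g : nat) (hg : (1 < g)%N) :
  let q := #|k| in
  exists N : nat,
    num_classes (@pointed_isomorphic k g) N /\
    N%:R =
      2 * q%:R ^+ (2 * g - 1)%N
      + 2 * A1 q ((2 * g + 1)%N%:R / p%:R)
      + \sum_(m <- divisors (2 * g + 1)%N | (1 < m)%N)
          2 * (totient m)%:R *
          (if (m %| q - 1)%N then A2 q ((2 * g + 1) %/ m)%N else 0)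
      + \sum_(m <- divisors (2 * g)%N | (1 < m)%N)
          2 * (totient m)%:R *
          (if (2 * m %| q - 1)%N then A2 q ((2 * g) %/ m)%N else 0)
      :> rat.
Proof.
move=> q; exists #|affine_classes k (2 * g + 1)|.
have two : (2 : k) != 0.
  rewrite -(dvdn_pcharf hp) dvdn_prime2 //; last by case/andP: hp.
  by apply: contraTneq hodd => ->.
split; first exact: pointed_isomorphism_classes.
exact: (class_number_formula hp hodd (ltnW hg)).
Qed.
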